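(* Let $k$ be a positive integer, and let $B=\{B_t : t\ge 0\}$ be a fractional Brownian motion in $\mathbb{R}^d$ with Hurst index $H\in(0,1)$ such that $Hd=1$. Let $E$ be a fixed, nonempty compact set in $\mathbb{R}^d$ with positive capacity with respect to the function $\phi(s)=(\log_+(1/s))^k$. Then $E$ contains $k$-tuple points of $B$ with positive probability, i.e. $$\mathbb{P}\big(\text{there exist } x\in E \text{ and } 0\le t_1<t_2<\cdots<t_k \text{ with } B_{t_1}=B_{t_2}=\cdots=B_{t_k}=x\big)>0.$$
   Context: Fractional Brownian motion: the one-dimensional fractional Brownian motion of Hurst index $0<H<1$ is a mean zero Gaussian process $\{B_t : t\ge 0\}$ with continuous sample paths and covariance $\mathbb{E}(B_tB_s)=\frac12(|t|^{2H}+|s|^{2H}-|t-s|^{2H})$. The fractional Brownian motion in $\mathbb{R}^d$ of Hurst index $H$ is $B_t=(B_t^1,\dots,B_t^d)$, where $B^1,\dots,B^d$ are i.i.d. copies of the one-dimensional fractional Brownian motion of Hurst index $H$. $k$-tuple point: $x\in\mathbb{R}^d$ is a $k$-tuple point for the path $\omega$ if there are times $t_1<t_2<\cdots<t_k$ (in $[0,\infty)$) such that $x=B_{t_1}(\omega)=\cdots=B_{t_k}(\omega)$. Notation: $\log_+(x)=\max\{\log x,0\}$, and $\log_+(1/s)=\infty$ at $s=0$; $|\cdot|$ is the Euclidean norm. Capacity: for a nonempty Borel set $E\subset\mathbb{R}^d$ and a function $\phi:[0,\infty)\to[0,\infty]$, the capacity of $E$ with respect to $\phi$ is $C_\phi(E)=\big[\inf_\mu\int_E\int_E\phi(|z_1-z_2|)\,\mu(dz_1)\,\mu(dz_2)\big]^{-1}$,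 the infimum being over all probability measures $\mu$ on $E$ (with $1/\infty=0$, $1/0=\infty$). Thus $E$ has positive capacity with respect to $\phi$ if and only if there is a probability measure $\mu$ on $E$ with $\int_E\int_E\phi(|z_1-z_2|)\,\mu(dz_1)\,\mu(dz_2)<\infty$. *)

(* Defs.v *)
From HB Require Import structures.
From mathcomp Require Import all_boot all_order all_algebra.
From mathcomp Require Import all_classical all_reals all_analysis.

Set Implicit Arguments.
Unset Strict Implicit.
Unset Printing Implicit Defensive.

Import Order.TTheory GRing.Theory Num.Theory.
Import numFieldNormedType.Exports.

Local Open Scope classical_set_scope.
Local Open Scope ring_scope.

(* The library's norm on 'rV[R]_d is the sup norm; it has the same topology. *)
Definition enorm (R : realType) (d : nat) (x : 'rV[R]_d) : R :=
  Num.sqrt (\sum_(i < d) x ord0 i ^+ 2).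

Definition borel (T : topologicalType) := g_sigma_algebraType (@open T).

(* Extended-real inverse and logarithm give log_+ (1/0) = +oo. *)
Definition log_plus_inv (R : realType) (s : R) : \bar R :=
  maxe (lne (s%:E)^-1%E) 0%E.

Section capacity.
Context {R : realType} {d : nat}.
Local Open Scope ereal_scope.

Definition energy (phi : R -> \bar R) (E : set 'rV[R]_d)
    (mu : probability (borel 'rV[R]_d) R) : \bar R :=
  \int[mu]_(z2 in E) \int[mu]_(z1 in E)
    phi (enorm ((z1 : 'rV[R]_d) - (z2 : 'rV[R]_d))%R).

(* Probability measures on E are those on R^d giving full mass to E.
   The inverse on \bar R satisfies +oo^-1 = 0 and 0^-1 = +oo. *)
Definition capacity (phi : R -> \bar R) (E : set 'rV[R]_d) : \bar R :=
  (ereal_inf [set energy phi E mu | mu in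
    [set mu : probability (borel 'rV[R]_d) R | mu E = 1]])^-1.

End capacity.

Section processes.
Context {disp : measure_display} {T : measurableType disp} {R : realType}.
Variable P : probability T R.

(* Degenerate laws are Gaussian; they need a separate clause because
   normal_prob m 0 is not the Dirac mass at m. *)
Definition gaussian (Y : T -> R) : Prop :=
  measurable_fun setT Y /\
  exists m s : R, forall U : set R, measurable U ->
    P (Y @^-1` U) = if s == 0 then \d_m U else normal_prob m s U.

(* In the predicates below a process indexed by [0, oo) is a function on R
   whose values at negative times are irrelevant. *)
Definition gaussian_process (X : R -> T -> R) : Prop :=
  forall (n : nat) (a t : 'I_n -> R), (forall i, 0 <= t i) ->
    gaussian (fun w => \sum_(i < n) a i * X (t i) w).

Record fbm1 (H : R) (X : R -> T -> R) : Prop := FBM1 {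
  fbm1_gaussian : gaussian_process X;
  fbm1_mean0 : forall t : R, 0 <= t -> ('E_P[X t] = 0)%E;
  fbm1_cov : forall t s : R, 0 <= t -> 0 <= s ->
    'E_P[(X t \* X s)%R]%E =
    ((`|t| `^ (2 * H) + `|s| `^ (2 * H) - `|t - s| `^ (2 * H)) / 2)%:E;
  fbm1_continuous : forall w, {within `[0, +oo[, continuous (X ^~ w)}
}.

Definition sigma_process (X : R -> T -> R) : set (set T) :=
  <<s \bigcup_(t in `[0, +oo[) preimage_set_system setT (X t) measurable >>.

Definition independent_sigma (I : finType) (F : I -> set (set T)) : Prop :=
  forall (J : {set I}) (A : I -> set T), (forall i, i \in J -> F i (A i)) ->
    P (\bigcap_(i in [set` J]) A i) = (\prod_(i in J) P (A i))%E.

Definition coord (d : nat) (B : R -> T -> 'rV[R]_d) (i : 'I_d) : R -> T -> R :=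
  fun t w => B t w ord0 i.

Record fbm (d : nat) (H : R) (B : R -> T -> 'rV[R]_d) : Prop := FBM {
  fbm_coord : forall i, fbm1 H (coord B i);
  fbm_indep : independent_sigma (fun i => sigma_process (coord B i))
}.

End processes.

Definition tuple_point (R : realType) (V : Type) (k : nat) (b : R -> V)
    (x : V) : Prop :=
  exists t : 'I_k -> R,
    [/\ forall i, 0 <= t i,
        forall i j : 'I_k, (i < j)%N -> t i < t j &
        forall i, b (t i) = x].

(* Main.v *)
Require Import Defs.
From HB Require Import structures.
From mathcomp Require Import all_boot all_order all_algebra.
From mathcomp Require Import all_classical all_reals all_analysis.
From mathcomp Require Import measurable_realfun ring lra zify.
Set Implicit Arguments.
Unset Strict Implicit.
Unset Printing Implicit Defensive.
Import Order.TTheory GRing.Theory Num.Theory.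
Import numFieldNormedType.Exports.
Local Open Scope classical_set_scope.
Local Open Scope ring_scope.

(** The proof is a second-moment argument for the time that the path spends
    near E, carried out on a grid of times, so that only finite-dimensional
    Gaussian laws occur.

    Let mu be a probability on E of finite energy, let eps = N^-H, and let the
    grid times be tau (2 j + 1 + l / N) for j < k and l < N: one block of N
    times for each of the k coincidences. Put Z_N = int_E prod_j sum_l exp (-
    |B_t - x|^2 / (2 eps^2)) mu(dx), where t is the l-th time of the j-th
    block. Because H d = 1, a kernel of width eps in R^d has size eps^d = 1 /
    N, so each of the sums has a mean of order one, and the mean of Z_N is
    bounded below uniformly in N (first_moment_pt). For the second moment, two
    grid times of the same block at index distance m contribute about 1 / (N
    (m + 1)), as long as the fBm can travel from x to y in the time m / N,
    that is when m is at least |x - y|^d N. Summing over a block gives a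
    harmonic sum truncated at that point, of order 1 + log_+ (1 / |x - y|),
    and the k blocks give its k-th power (second_moment_pt). Hence the second
    moment of Z_N is at most a constant plus a constant times the energy of mu
    (Ex_le_energy), and the Paley-Zygmund inequality bounds P (Z_N >= a / 2)
    below uniformly in N, where a is the lower bound of the means (near_hits).
    On the event that this happens for infinitely many N, the path comes
    arbitrarily close to E at k times from disjoint blocks; by continuity and
    compactness it then meets E at one point at k such times (gap_attained).
    The same compactness expresses the event of the theorem through countably
    many times and points, which makes it measurable (hits_measurable).

    The two Gaussian bounds behind the moments avoid densities and
    determinants. Since exp (- |y|^2 / 2) is the mean of cos <y, N> for a
    standard Gaussian N, Fubini turns the mean of a Gaussian kernel into the
    mean over N of the characteristic function of the process
    (gauss_kernel_le, gauss_kernel_ge). The essential input is then a lower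
    bound for the covariance form. It comes from 2 H <= 1, which holds as d >=
    2: increments over disjoint intervals are nonpositively correlated
    (powR_4pt, incr_cov_lt), while each increment is nonnegatively correlated
    with the final value, so in the increment coordinates the covariance form
    is a Dirichlet form with nonnegative weights (dirichlet_form,
    fcov_form_ge). Keeping two of its terms gives exactly the non-degeneracy
    that the kernels require (pair_form_gap, pair_form_incr). The d
    coordinates are combined by independence (indep_Ex_prod). *)

(** * Expectations of bounded measurable functions *)

Section bounded_measurable.
Context {disp : measure_display} {T : measurableType disp} {R : realType}.
Implicit Types (f g : T -> R) (P : probability T R).

(** Almost all integrands below are of this kind; for them integrability over
    a probability is automatic, and linearity and Fubini need no further side
    conditions. *)
Definition bmfun (f : T -> R) :=
  measurable_fun setT f /\ exists M, forall x, `|f x| <= M.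

Definition Ex (P : probability T R) (f : T -> R) : R := \int[P]_x f x.

Lemma bmfun_integrable P f : bmfun f -> P.-integrable setT (EFin \o f).
Proof.
move=> [mf [M fM]]; apply: measurable_bounded_integrable => //.
  by apply: le_lt_trans (ltry 1); exact: probability_le1.
exists M; split; first exact: num_real.
by move=> y My x _; exact: le_trans (fM x) (ltW My).
Qed.

Lemma bmfun_cst c : bmfun (fun=> c).
Proof. by split => //; exists `|c|. Qed.

Lemma bmfunD f g : bmfun f -> bmfun g -> bmfun (fun x => f x + g x).
Proof.
move=> [mf [M fM]] [mg [N gN]]; split; first exact: measurable_funD.
by exists (M + N) => x; rewrite (le_trans (ler_normD _ _))// lerD.
Qed.

Lemma bmfunM f g : bmfun f -> bmfun g -> bmfun (fun x => f x * g x).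
Proof.
move=> [mf [M fM]] [mg [N gN]]; split; first exact: measurable_funM.
by exists (M * N) => x; rewrite normrM ler_pM.
Qed.

Lemma bmfun_sum (I : Type) (s : seq I) (F : I -> T -> R) :
  (forall i, bmfun (F i)) -> bmfun (fun x => \sum_(i <- s) F i x).
Proof.
move=> bF; elim: s => [|i s IH].
  by under eq_fun do rewrite big_nil; exact: bmfun_cst.
by under eq_fun do rewrite big_cons; exact: bmfunD.
Qed.

Lemma bmfun_prod (I : Type) (s : seq I) (F : I -> T -> R) :
  (forall i, bmfun (F i)) -> bmfun (fun x => \prod_(i <- s) F i x).
Proof.
move=> bF; elim: s => [|i s IH].
  by under eq_fun do rewrite big_nil; exact: bmfun_cst.
by under eq_fun do rewrite big_cons; exact: bmfunM.
Qed.

Lemma bmfun_indic (A : set T) : measurable A -> bmfun (\1_A : T -> R).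
Proof.
move=> mA; split; first exact: measurable_indic.
by exists 1 => x; rewrite indicE normr_nat lern1; case: (_ \in _).
Qed.

Lemma bmfun_cos f : measurable_fun setT f -> bmfun (fun x => cos (f x)).
Proof.
move=> mf; split.
  by apply: measurableT_comp => //; apply: continuous_measurable_fun; exact: continuous_cos.
by exists 1 => x; rewrite ler_norml cos_geN1 cos_le1.
Qed.

Lemma bmfun_sin f : measurable_fun setT f -> bmfun (fun x => sin (f x)).
Proof.
move=> mf; split.
  by apply: measurableT_comp => //; apply: continuous_measurable_fun; exact: continuous_sin.
by exists 1 => x; rewrite ler_norml sin_geN1 sin_le1.
Qed.

Lemma bmfun_exp f b : measurable_fun setT f -> (forall x, f x <= b) ->
  bmfun (fun x => expR (f x)).
Proof.
move=> mf f0; split; first by apply: measurableT_comp.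
by exists (expR b) => x; rewrite ger0_norm ?expR_ge0// ler_expR.
Qed.

Lemma EFin_Ex P f : bmfun f -> (Ex P f)%:E = (\int[P]_x (f x)%:E)%E.
Proof.
by move=> bf; rewrite /Ex /Rintegral fineK//; apply: integrable_fin_num => //; exact: bmfun_integrable.
Qed.

Lemma Ex_cst P c : Ex P (fun=> c) = c.
Proof. by rewrite /Ex Rintegral_cst//= probability_setT/= mulr1. Qed.

Lemma ExD P f g : bmfun f -> bmfun g -> Ex P (fun x => f x + g x) = Ex P f + Ex P g.
Proof. by move=> bf bg; rewrite /Ex RintegralD//; exact: bmfun_integrable. Qed.

Lemma ExDc P f c : bmfun f -> Ex P (fun x => f x + c) = Ex P f + c.
Proof. by move=> bf; have := ExD P bf (bmfun_cst c); rewrite Ex_cst. Qed.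

Lemma ExB P f g : bmfun f -> bmfun g -> Ex P (fun x => f x - g x) = Ex P f - Ex P g.
Proof. by move=> bf bg; rewrite /Ex RintegralB//; exact: bmfun_integrable. Qed.

Lemma ExZ P f c : bmfun f -> Ex P (fun x => c * f x) = c * Ex P f.
Proof. by move=> bf; rewrite /Ex RintegralZl//; exact: bmfun_integrable. Qed.

Lemma Ex_sum P (I : Type) (s : seq I) (F : I -> T -> R) : (forall i, bmfun (F i)) ->
  Ex P (fun x => \sum_(i <- s) F i x) = \sum_(i <- s) Ex P (F i).
Proof.
move=> bF; elim: s => [|i s IH].
  by under eq_fun do rewrite big_nil; rewrite big_nil Ex_cst.
under eq_fun do rewrite big_cons.
by rewrite big_cons ExD ?IH//; exact: bmfun_sum.
Qed.

Lemma eq_Ex P f g : f =1 g -> Ex P f = Ex P g.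
Proof. by move=> fg; congr Ex; apply/funext. Qed.

Lemma le_Ex P f g : bmfun f -> bmfun g -> (forall x, f x <= g x) -> Ex P f <= Ex P g.
Proof. by move=> bf bg fg; apply: le_Rintegral => //; exact: bmfun_integrable. Qed.

Lemma Ex_ge0 P f : (forall x, 0 <= f x) -> 0 <= Ex P f.
Proof. by move=> f0; apply: Rintegral_ge0. Qed.

Lemma Ex_indic P (A : set T) : measurable A -> Ex P \1_A = fine (P A).
Proof. by move=> mA; rewrite /Ex /Rintegral integral_indic// setIT. Qed.

Lemma normr_Ex P f M : bmfun f -> (forall x, `|f x| <= M) -> `|Ex P f| <= M.
Proof.
move=> bf fM; rewrite ler_norml; apply/andP; split.
  rewrite -[leLHS](Ex_cst P); apply: le_Ex => //; first exact: bmfun_cst.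
  by move=> x; have := fM x; rewrite ler_norml => /andP[].
rewrite -[leRHS](Ex_cst P); apply: le_Ex => //; first exact: bmfun_cst.
by move=> x; have := fM x; rewrite ler_norml => /andP[].
Qed.

End bounded_measurable.

Section fubini.
Context {d1 d2 : measure_display} {T1 : measurableType d1}
  {T2 : measurableType d2} {R : realType}.
Variables (P : probability T1 R) (Q : probability T2 R).
Implicit Type f : T1 * T2 -> R.

Lemma bmfun_pair1 f x : bmfun f -> bmfun (fun y => f (x, y)).
Proof.
by move=> [mf [M fM]]; split; [exact: measurableT_comp|exists M => y; exact: fM].
Qed.

Lemma bmfun_pair2 f y : bmfun f -> bmfun (fun x => f (x, y)).
Proof.
by move=> [mf [M fM]]; split; [exact: measurableT_comp|exists M => x; exact: fM].
Qed.

Lemma bmfun_Ex1 f : bmfun f -> bmfun (fun x => Ex Q (fun y => f (x, y))).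
Proof.
move=> bf; have [mf [M fM]] := bf; split; last first.
  exists M => x; apply: normr_Ex => //; exact: bmfun_pair1.
apply/measurable_EFinP.
rewrite (_ : _ \o _ = fubini_F Q (EFin \o f)).
  by apply: (@measurable_fubini_F _ _ _ _ _ P Q); exact: (bmfun_integrable (P \x Q)%E bf).
by apply/funext => x; rewrite /= EFin_Ex//; exact: bmfun_pair1.
Qed.

Lemma bmfun_Ex2 f : bmfun f -> bmfun (fun y => Ex P (fun x => f (x, y))).
Proof.
move=> bf; have [mf [M fM]] := bf; split; last first.
  exists M => x; apply: normr_Ex => //; exact: bmfun_pair2.
apply/measurable_EFinP.
rewrite (_ : _ \o _ = fubini_G P (EFin \o f)).
  by apply: (@measurable_fubini_G _ _ _ _ _ P Q); exact: (bmfun_integrable (P \x Q)%E bf).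
by apply/funext => x; rewrite /= EFin_Ex//; exact: bmfun_pair2.
Qed.

Lemma Ex_fubini f : bmfun f ->
  Ex P (fun x => Ex Q (fun y => f (x, y))) = Ex Q (fun y => Ex P (fun x => f (x, y))).
Proof.
move=> bf; apply: EFin_inj.
rewrite EFin_Ex; last exact: bmfun_Ex1.
rewrite EFin_Ex; last exact: bmfun_Ex2.
under eq_integral do rewrite (EFin_Ex _ (bmfun_pair1 _ bf)).
under [RHS]eq_integral do rewrite (EFin_Ex _ (bmfun_pair2 _ bf)).
by apply: (@Fubini _ _ _ _ _ P Q (EFin \o f)); exact: (bmfun_integrable (P \x Q)%E bf).
Qed.

Lemma Ex_prod1 f : bmfun f ->
  Ex (P \x Q)%E f = Ex P (fun x => Ex Q (fun y => f (x, y))).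
Proof.
move=> bf; apply: EFin_inj; rewrite EFin_Ex//.
rewrite EFin_Ex; last exact: bmfun_Ex1.
under [RHS]eq_integral do rewrite (EFin_Ex _ (bmfun_pair1 _ bf)).
apply/esym; apply: (@integral12_prod_meas1 _ _ _ _ _ P Q (EFin \o f)).
exact: (bmfun_integrable (P \x Q)%E bf).
Qed.

End fubini.

(** * One-dimensional Gaussian integrals *)

(** The law normal_prob lives on the copy measurableTypeR R of the line; the
    identity transports it to R itself, where the other lemmas on integrals
    apply. *)
Definition idTR {R : realType} : measurableTypeR R -> R := fun x => x.

Lemma measurable_idTR {R : realType} : measurable_fun setT (@idTR R).
Proof. by move=> _ A mA; rewrite setTI. Qed.

HB.instance Definition _ (R : realType) :=
  isMeasurableFun.Build _ _ _ _ (@idTR R) (@measurable_idTR R).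

Definition normal_law {R : realType} (m s : R) : probability R R :=
  distribution (normal_prob m s) (@idTR R).

Section normal_integral.
Context {R : realType}.
Notation mu := (@lebesgue_measure R).
Notation N := (@normal_law R).

(** The normal law is defined by its density, so its Radon-Nikodym derivative
    is that density almost everywhere. *)
Lemma ge0_integral_normal (m s : R) (f : R -> \bar R) :
  measurable_fun setT f -> (forall x, (0 <= f x)%E) ->
  (\int[N m s]_x f x = \int[mu]_x (f x * (normal_pdf m s x)%:E))%E.
Proof.
move=> mf f0; rewrite /normal_law ge0_integral_distribution//.
rewrite -[LHS]/(\int[normal_prob m s]_x f x)%E.
have dom : normal_prob m s `<< mu := normal_prob_dominates m s.
rewrite -(Radon_Nikodym_SigmaFinite.change_of_variables dom f0 measurableT mf).
apply: ae_eq_integral => //.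
- apply: emeasurable_funM => //.
  exact: measurable_int (Radon_Nikodym_SigmaFinite.f_integrable dom).
- by apply: emeasurable_funM => //; apply/measurable_EFinP; exact: measurable_normal_pdf.
- apply: ae_eqe_mul2l; apply: integral_ae_eq => //.
  + exact: Radon_Nikodym_SigmaFinite.f_integrable.
  + by apply/measurable_EFinP; exact: measurable_normal_pdf.
  + by move=> E _ mE; rewrite -(Radon_Nikodym_SigmaFinite.f_integral dom).
Qed.

(** Exponential tilting, the common form of completing a square: a weight g
    turns one normal density into a multiple of another. *)
Lemma ge0_normal_tilt (m s m' s' C : R) (g f : R -> R) :
  0 <= C -> measurable_fun setT g -> (forall x, 0 <= g x) ->
  (forall x, g x * normal_pdf m s x = C * normal_pdf m' s' x) ->
  measurable_fun setT f -> (forall x, 0 <= f x) ->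
  (\int[N m s]_x (g x * f x)%:E = C%:E * \int[N m' s']_x (f x)%:E)%E.
Proof.
move=> C0 mg g0 gC mf f0.
rewrite ge0_integral_normal; last 2 first.
- by apply/measurable_EFinP; exact: measurable_funM.
- by move=> x; rewrite lee_fin mulr_ge0.
rewrite ge0_integral_normal; last 2 first.
- exact/measurable_EFinP.
- by move=> x; rewrite lee_fin.
rewrite -ge0_integralZl//; last 2 first.
- apply/measurable_EFinP; apply: measurable_funM => //; exact: measurable_normal_pdf.
- by move=> x _; rewrite lee_fin mulr_ge0 ?normal_pdf_ge0.
apply: eq_integral => x _; rewrite -!EFinM; congr EFin.
by rewrite mulrAC gC mulrAC mulrA.
Qed.

Lemma ge0_integrable_normal_tilt (m s m' s' C : R) (g : R -> R) :
  0 <= C -> measurable_fun setT g -> (forall x, 0 <= g x) ->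
  (forall x, g x * normal_pdf m s x = C * normal_pdf m' s' x) ->
  (N m s).-integrable setT (EFin \o g).
Proof.
move=> C0 mg g0 gC; apply/integrableP; split; first exact/measurable_EFinP.
under eq_integral do rewrite /= ger0_norm// -[g _]mulr1.
rewrite (ge0_normal_tilt C0 mg g0 gC)//.
by rewrite -(EFin_Ex (N m' s') (bmfun_cst 1)) Ex_cst mule1 ltry.
Qed.

(** Reduction of a bounded f to the nonnegative f + M. *)
Lemma normal_tilt (m s m' s' C : R) (g f : R -> R) :
  0 <= C -> measurable_fun setT g -> (forall x, 0 <= g x) ->
  (forall x, g x * normal_pdf m s x = C * normal_pdf m' s' x) ->
  bmfun f ->
  \int[N m s]_x (g x * f x) = C * Ex (N m' s') f.
Proof.
move=> C0 mg g0 gC bf; have [mf [M fM]] := bf.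
have ig := ge0_integrable_normal_tilt C0 mg g0 gC.
have igf : (N m s).-integrable setT (EFin \o (fun x => g x * f x)).
  apply: (@le_integrable _ _ _ (N m s) _ measurableT _ (EFin \o (fun x => M * g x))).
  - by apply/measurable_EFinP; exact: measurable_funM.
  - move=> x _; rewrite /= lee_fin !normrM mulrC ler_wpM2r//.
    exact: le_trans (fM x) (ler_norm _).
  - exact: (integrableZl measurableT M ig).
have H : \int[N m s]_x (g x * (f x + M)) = C * Ex (N m' s') (fun x => f x + M).
  rewrite /Rintegral (ge0_normal_tilt C0 mg g0 gC); last 2 first.
  - exact: measurable_funD.
  - by move=> x; have := fM x; rewrite ler_norml => /andP[+ _]; rewrite -subr_ge0 opprK.
  rewrite -EFin_Ex ?fineM//; apply: bmfunD => //; exact: bmfun_cst.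
have Hg : (\int[N m s]_x (g x)%:E = C%:E)%E.
  rewrite -[RHS]mule1 -(Ex_cst (N m' s') 1) EFin_Ex; last exact: bmfun_cst.
  rewrite -(@ge0_normal_tilt m s m' s' C g (fun=> 1))//.
  by apply: eq_integral => x _; rewrite mulr1.
(* the constant M is handled separately and subtracted at the end *)
have H2 : \int[N m s]_x (g x * M) = C * Ex (N m' s') (fun x => M).
  by rewrite RintegralZr// Ex_cst /Rintegral Hg.
have : \int[N m s]_x (g x * f x + g x * M) = C * Ex (N m' s') (fun x => f x + M).
  by rewrite -H; apply: eq_Rintegral => x _; rewrite mulrDr.
have igM : (N m s).-integrable setT (EFin \o (fun x => g x * M)).
  rewrite (_ : _ \o _ = (fun x => M%:E * (EFin \o g) x)%E); last first.
    by apply/funext => x; rewrite /= mulrC.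
  exact: (integrableZl measurableT M ig).
rewrite (RintegralD measurableT igf igM).
rewrite H2 ExD//; last exact: bmfun_cst.
by rewrite mulrDr => /addIr.
Qed.

(** Substitution x -> m + s x in the integral against the density. *)
Lemma ge0_normal_affine (m s : R) (f : R -> R) : 0 < s -> continuous f ->
  (forall x, 0 <= f x) ->
  (\int[N m s]_x (f x)%:E = \int[N 0 1]_x (f (m + s * x))%:E)%E.
Proof.
move=> s0 cf f0.
have mf := continuous_measurable_fun cf.
rewrite !ge0_integral_normal; last 4 first.
- by apply/measurable_EFinP; apply: measurableT_comp => //; apply: measurable_funD => //; exact: measurable_funM.
- by move=> x; rewrite lee_fin.
- exact/measurable_EFinP.
- by move=> x; rewrite lee_fin.
pose F (x : R) : R := m + s * x.
have F' : (F^`())%classic = cst s.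
  apply/funext => x; rewrite /F derive1E deriveD// deriveM// !derive_cst derive_id.
  by rewrite scaler0 addr0 add0r scaler1.
under eq_integral do rewrite -EFinM.
rewrite (@increasing_ge0_integration_by_substitutionT _ F)//.
- apply: eq_integral => x _; rewrite F' -!EFinM; congr EFin.
  rewrite -[LHS]/(f (F x) * normal_pdf m s (F x) * s) /F -mulrA; congr (_ * _).
  rewrite !normal_pdfE ?gt_eqF// /normal_fun /normal_peak.
  have -> : m + s * x - m = s * x by ring.
  have -> : - (s * x) ^+ 2 / (s ^+ 2 *+ 2) = - (x - 0) ^+ 2 / (1 ^+ 2 *+ 2).
    rewrite -mulr_natr -[1 ^+ 2 *+ 2]mulr_natr; field; by rewrite gt_eqF.
  rewrite mulrAC; congr (_ * _).
  rewrite -mulrnAr sqrtrM ?sqr_ge0// sqrtr_sqr gtr0_norm//.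
  by rewrite expr1n mul1r invfM mulrAC mulVf ?mul1r// gt_eqF.
- by move=> x y xy; rewrite /F ltrD2l ltr_pM2l.
- by rewrite F' => ?; exact: cvg_cst.
- by rewrite F'; exact: is_cvg_cst.
- by rewrite F'; exact: is_cvg_cst.
- apply: cvg_comp (_ : (s * x @[x --> -oo] --> -oo)%R) _.
    by apply: gt0_cvgMrNy => //; exact: cvg_id.
  exact: cvg_addrl_Ny.
- apply: cvg_comp (_ : (s * x @[x --> +oo] --> +oo)%R) _.
    by apply: gt0_cvgMry => //; exact: cvg_id.
  exact: cvg_addrl.
- move=> x; apply: cvgM; [exact: cf|apply: continuous_normal_pdf].
  by rewrite gt_eqF.
- by move=> x; rewrite mulr_ge0 ?normal_pdf_ge0.
Qed.

Lemma normal_affine (m s : R) (f : R -> R) : 0 < s -> continuous f -> bmfun f ->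
  Ex (N m s) f = Ex (N 0 1) (fun x => f (m + s * x)).
Proof.
move=> s0 cf bf; have [mf [M fM]] := bf.
have bF : bmfun (fun x => f (m + s * x)).
  split; last by exists M => x; exact: fM.
  by apply: measurableT_comp => //; apply: measurable_funD => //; exact: measurable_funM.
have : Ex (N m s) (fun x => f x + M) = Ex (N 0 1) (fun x => f (m + s * x) + M).
  rewrite /Ex /Rintegral (@ge0_normal_affine m s (fun x => f x + M))//.
    by move=> x; apply: cvgD; [exact: cf|exact: cvg_cst].
  by move=> x; have := fM x; rewrite ler_norml => /andP[+ _]; rewrite -subr_ge0 opprK.
by rewrite (ExDc _ _ bf) (ExDc _ _ bF); exact: addIr.
Qed.

End normal_integral.

Section normal_moments.
Context {R : realType}.
Notation N := (@normal_law R).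

Lemma normal_pdf_expM (m s h x : R) : s != 0 ->
  expR (h * x) * normal_pdf m s x =
  expR (m * h + s ^+ 2 * h ^+ 2 / 2) * normal_pdf (m + s ^+ 2 * h) s x.
Proof.
move=> s0; rewrite !normal_pdfE// /normal_fun mulrCA [RHS]mulrCA; congr (_ * _).
rewrite -!expRD; congr expR; field.
by rewrite s0.
Qed.

Lemma measurable_expRM (h : R) : measurable_fun setT (fun x : R => expR (h * x)).
Proof. by apply: measurableT_comp => //; exact: measurable_funM. Qed.

Lemma integrable_normal_exp (m s h : R) : s != 0 ->
  (N m s).-integrable setT (EFin \o (fun x => expR (h * x))).
Proof.
move=> s0; apply: (@ge0_integrable_normal_tilt _ m s (m + s ^+ 2 * h) s (expR (m * h + s ^+ 2 * h ^+ 2 / 2))).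
- exact: expR_ge0.
- exact: measurable_expRM.
- by move=> x; exact: expR_ge0.
- by move=> x; exact: normal_pdf_expM.
Qed.

(** Cameron-Martin formula in dimension one. *)
Lemma normal_expM (m s h : R) f : s != 0 -> bmfun f ->
  \int[N m s]_x (expR (h * x) * f x) =
  expR (m * h + s ^+ 2 * h ^+ 2 / 2) * Ex (N (m + s ^+ 2 * h) s) f.
Proof.
move=> s0 bf; apply: normal_tilt bf => [||x|x].
- exact: expR_ge0.
- exact: measurable_expRM.
- exact: expR_ge0.
- exact: normal_pdf_expM.
Qed.

Lemma expR_norm_le (a x : R) : 0 <= a -> expR (a * `|x|) <= expR (a * x) + expR (- a * x).
Proof.
move=> a0; case: (lerP 0 x) => x0.
  by rewrite (ger0_norm x0) lerDl expR_ge0.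
by rewrite (ltr0_norm x0) mulrN mulNr lerDr expR_ge0.
Qed.

Lemma integrable_normal_expnorm (m s a : R) : s != 0 ->
  (N m s).-integrable setT (EFin \o (fun x => expR (a * x) + expR (- a * x))).
Proof.
move=> s0.
exact: (integrableD measurableT (integrable_normal_exp m a s0) (integrable_normal_exp m (- a) s0)).
Qed.

Lemma le_norm_exp (x : R) : `|x| <= expR `|x|.
Proof. by apply: le_trans (expR_ge1Dx _); rewrite lerDr. Qed.

Lemma integrable_normal_le (m s C a : R) (f : R -> R) : s != 0 -> 0 <= a ->
  measurable_fun setT f -> (forall x, `|f x| <= C * expR (a * `|x|)) ->
  (N m s).-integrable setT (EFin \o f).
Proof.
move=> s0 a0 mf fC.
have := integrableZl measurableT `|C| (integrable_normal_expnorm m a s0).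
apply: le_integrable => //; first exact/measurable_EFinP.
move=> x _; rewrite /= lee_fin (le_trans (fC x))//.
rewrite (le_trans _ (ler_norm _))//.
rewrite (@le_trans _ _ (`|C| * expR (a * `|x|)))//.
  by rewrite ler_wpM2r ?expR_ge0// ler_norm.
by rewrite ler_wpM2l// expR_norm_le.
Qed.

(** Differentiation under the integral sign at the origin, with domination by
    exp ((a + 2) |x|). The moments and Stein's identity below are derivatives
    of this kind of explicit Laplace transforms. *)
Lemma is_derive_laplace (m s C a : R) (phi : R -> R) : s != 0 -> 0 <= a ->
  measurable_fun setT phi -> (forall x, `|phi x| <= C * expR (a * `|x|)) ->
  is_derive (0 : R) 1 (fun h => \int[N m s]_x (phi x * expR (h * x)))
    (\int[N m s]_x (x * phi x)).
Proof.
move=> s0 a0 mphi phiC.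
have C0 : 0 <= C.
  have := le_trans (normr_ge0 _) (phiC 0).
  by rewrite normr0 mulr0 expR0 mulr1.
pose f (h x : R) := phi x * expR (h * x).
have fD (h x : R) : is_derive h (1 : R) (f ^~ x) (phi x * (x * expR (h * x))).
  apply: is_derive_eq.
  by rewrite scaler0 add0r /GRing.scale/= mulr1 [expR _ * x]mulrC.
have pD (h x : R) : partial1of2 f h x = phi x * (x * expR (h * x)).
  by rewrite partial1of2E; exact: derive_val.
pose G (x : R) := C * (expR ((a + 2) * x) + expR (- (a + 2) * x)).
have key (h x : R) : `|h| <= 1 -> expR (h * x) <= expR `|x|.
  move=> h1; rewrite ler_expR (le_trans (ler_norm _))// normrM.
  by rewrite -[leRHS]mul1r ler_wpM2r.
have I0 : `](-1:R), 1[%classic 0 by rewrite /= in_itv/= ltrN10 ltr01.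
have hyp1 (h : R) : `](-1:R), 1[%classic h -> (N m s).-integrable setT (EFin \o f h).
  move=> h1; apply: (@integrable_normal_le _ _ C (a + 1)) => //.
    by rewrite addr_ge0.
    by apply: measurable_funM => //; exact: measurable_expRM.
  move=> x; rewrite normrM (ger0_norm (expR_ge0 _)).
  rewrite mulrDl mul1r expRD mulrA ler_pM ?expR_ge0//.
  apply: key; move: h1; rewrite /= in_itv/= => /andP[h1 h2].
  by rewrite ler_norml (ltW h1) (ltW h2).
have hyp2 (h x : R) : `](-1:R), 1[%classic h -> [set: R] x -> derivable (f ^~ x) h 1.
  by move=> _ _; exact: ex_derive.
have hyp3 x : 0 <= G x by rewrite mulr_ge0// addr_ge0 ?expR_ge0.
have hyp4 : (N m s).-integrable setT (EFin \o G).
  exact: (integrableZl measurableT C (integrable_normal_expnorm m (a + 2) s0)).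
have hyp5 (h x : R) : `](-1:R), 1[%classic h -> [set: R] x -> `|partial1of2 f h x| <= G x.
  move=> h1 _; rewrite pD.
  have h1' : `|h| <= 1.
    move: h1; rewrite /= in_itv/= => /andP[h1 h2].
    by rewrite ler_norml (ltW h1) (ltW h2).
  rewrite !normrM (ger0_norm (expR_ge0 _)) /G.
  rewrite (@le_trans _ _ (C * expR ((a + 2) * `|x|)))//; last first.
    by rewrite ler_wpM2l// expR_norm_le// addr_ge0.
  have -> : (a + 2) * `|x| = a * `|x| + (`|x| + `|x|) by ring.
  rewrite expRD [leRHS]mulrA; apply: ler_pM.
  - exact: normr_ge0.
  - by apply: mulr_ge0; [exact: normr_ge0|exact: expR_ge0].
  - exact: phiC.
  by rewrite expRD; apply: ler_pM; rewrite ?normr_ge0 ?expR_ge0 ?le_norm_exp ?key.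
have D1 := @derivable_under_integral R _ _ (N m s) f setT measurableT 0 (-1) 1 I0 hyp1 hyp2 G hyp3 hyp4 hyp5.
have D2 := @differentiation_under_integral R _ _ (N m s) f setT measurableT 0 (-1) 1 I0 hyp1 hyp2 G hyp3 hyp4 hyp5.
apply: DeriveDef => //.
rewrite -derive1E D2; apply: eq_Rintegral => x _.
by rewrite pD mul0r expR0 mulr1 mulrC.
Qed.

(** The shift h + d keeps the point of differentiation at the origin, where
    is_derive_laplace applies. *)
Lemma is_derive_mgf (m s h : R) :
  is_derive (0 : R) 1 (fun d : R => expR (m * (h + d) + s ^+ 2 * (h + d) ^+ 2 / 2))
   ((m + s ^+ 2 * h) * expR (m * h + s ^+ 2 * h ^+ 2 / 2)).
Proof.
apply: is_derive_eq.
rewrite /GRing.scale/= !addr0 mulrC; congr (_ * _); by field.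
Qed.

Lemma is_derive_mgf' (m s : R) :
  is_derive (0 : R) 1 (fun h : R => (m + s ^+ 2 * h) * expR (m * h + s ^+ 2 * h ^+ 2 / 2))
   (m ^+ 2 + s ^+ 2).
Proof.
apply: is_derive_eq.
rewrite /GRing.scale/= !expr0n/= !(mulr0, addr0, mul0r) expR0; by field.
Qed.

Lemma normal_mgf (m s h : R) : s != 0 ->
  \int[N m s]_x expR (h * x) = expR (m * h + s ^+ 2 * h ^+ 2 / 2).
Proof.
move=> s0; rewrite -[RHS]mulr1 -[X in _ * X](Ex_cst (N (m + s ^+ 2 * h) s) 1).
rewrite -(normal_expM m h s0 (bmfun_cst 1)).
by apply: eq_Rintegral => x _; rewrite mulr1.
Qed.

Lemma normal_mgf1 (m s h : R) : s != 0 ->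
  \int[N m s]_x (x * expR (h * x)) =
  (m + s ^+ 2 * h) * expR (m * h + s ^+ 2 * h ^+ 2 / 2).
Proof.
move=> s0.
have := @is_derive_laplace m s 1 `|h| (fun x => expR (h * x)) s0 (normr_ge0 _) (measurable_expRM h).
move=> /(_ _)/wrap[].
  by move=> x; rewrite mul1r ger0_norm ?expR_ge0// ler_expR -normrM ler_norm.
rewrite (_ : (fun _ => _) = (fun d : R => expR (m * (h + d) + s ^+ 2 * (h + d) ^+ 2 / 2))); last first.
  apply/funext => d; rewrite -normal_mgf//; apply: eq_Rintegral => x _.
  by rewrite -expRD mulrDl.
by move=> [_ <-]; rewrite (@derive_val _ _ _ _ _ _ _ (is_derive_mgf m s h)).
Qed.

Lemma normal_mean (m s : R) : s != 0 -> \int[N m s]_x x = m.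
Proof.
move=> s0; have := normal_mgf1 m 0 s0.
under eq_Rintegral do rewrite mul0r expR0 mulr1.
by move=> ->; rewrite expr0n/= !(mulr0, mul0r, addr0) expR0 mulr1.
Qed.

Lemma normal_moment2 (m s : R) : s != 0 -> \int[N m s]_x (x ^+ 2) = m ^+ 2 + s ^+ 2.
Proof.
move=> s0.
have := @is_derive_laplace m s 1 1 id s0 ler01 (@measurable_id _ _ _).
move=> /(_ _)/wrap[].
  by move=> x; rewrite mul1r mul1r le_norm_exp.
under [X in is_derive _ _ X _]eq_fun do rewrite normal_mgf1//.
move=> [_]; rewrite (@derive_val _ _ _ _ _ _ _ (is_derive_mgf' m s)) => ->.
by apply: eq_Rintegral => x _; rewrite expr2.
Qed.

(** Gaussian integration by parts for the sine. Both sides are the derivative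
    at 0 of the Laplace transform of sin (r x + t), which the Cameron-Martin
    formula computes. *)
Lemma stein_sin (r t : R) :
  \int[N 0 1]_x (x * sin (r * x + t)) = r * Ex (N 0 1) (fun x => cos (r * x + t)).
Proof.
have mrt : measurable_fun setT (fun x : R => r * x + t).
  by apply: measurable_funD => //; exact: measurable_funM.
have := @is_derive_laplace 0 1 1 0 (fun x => sin (r * x + t)) (oner_neq0 _) (lexx _)
  (bmfun_sin mrt).1.
move=> /(_ _)/wrap[].
  by move=> x; rewrite mul1r mul0r expR0 ler_norml sin_geN1 sin_le1.
set S := Ex (N 0 1) (fun x => sin (r * x + t)).
set C := Ex (N 0 1) (fun x => cos (r * x + t)).
rewrite (_ : (fun _ => _) = (fun h : R => expR (h ^+ 2 / 2) * (cos (r * h) * S + sin (r * h) * C))); last first.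
  apply/funext => h.
  under eq_Rintegral do rewrite mulrC.
  rewrite (normal_expM _ _ (oner_neq0 _) (bmfun_sin mrt)) mul0r add0r expr1n mul1r add0r.
  congr (_ * _); rewrite normal_affine//; last 2 first.
  - by move=> x; apply: (@continuous_comp _ _ _ (fun x : R => r * x + t) (@sin R));
      [apply: cvgD; [apply: cvgMr; exact: cvg_id|exact: cvg_cst]|exact: continuous_sin].
  - exact: bmfun_sin.
  rewrite /S /C -!ExZ; [|exact: bmfun_cos|exact: bmfun_sin].
  rewrite -ExD; last 2 first.
  - by apply: bmfunM; [exact: bmfun_cst|exact: bmfun_sin].
  - by apply: bmfunM; [exact: bmfun_cst|exact: bmfun_cos].
  apply: eq_Ex => x /=.
  rewrite (_ : r * (1 * h + 1 * x) + t = (r * x + t) + r * h); last by ring.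
  by rewrite sinD mulrC [cos _ * sin _]mulrC.
move=> [_ <-].
apply: (@derive_val _ _ _ _ _ _ _ (_ : is_derive _ _ _ _)).
apply: is_derive_eq.
rewrite /GRing.scale/= !(expr0n, mulr0, mul0r, add0r, addr0, cos0, sin0, expR0)/=.
by ring.
Qed.

(** Differentiation under the integral sign in the frequency. *)
Lemma is_derive_normal_cos (r t : R) :
  is_derive r (1 : R) (fun r => Ex (N 0 1) (fun x => cos (r * x + t)))
    (- \int[N 0 1]_x (x * sin (r * x + t))).
Proof.
pose f (r x : R) := cos (r * x + t).
have fD (h x : R) : is_derive h (1 : R) (f ^~ x) (- (x * sin (h * x + t))).
  apply: is_derive_eq.
  by rewrite scaler0 add0r addr0 /GRing.scale/= mulr1 mulNr mulrC.
have pD (h x : R) : partial1of2 f h x = - (x * sin (h * x + t)).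
  by rewrite partial1of2E; exact: derive_val.
pose G (x : R) := expR (1 * x) + expR (- 1 * x).
have I0 : `](r - 1), (r + 1)[%classic r.
  by rewrite /= in_itv/= ltrBlDr ltrDl ltr01.
have m1 : (1 : R) != 0 by exact: oner_neq0.
have hyp1 (h : R) : `](r - 1), (r + 1)[%classic h -> (N 0 1).-integrable setT (EFin \o f h).
  move=> _; apply: bmfun_integrable; apply: bmfun_cos.
  by apply: measurable_funD => //; exact: measurable_funM.
have hyp2 (h x : R) : `](r - 1), (r + 1)[%classic h -> [set: R] x -> derivable (f ^~ x) h 1.
  by move=> _ _; exact: ex_derive.
have hyp3 x : 0 <= G x by rewrite addr_ge0 ?expR_ge0.
have hyp4 : (N 0 1).-integrable setT (EFin \o G).
  exact: (integrable_normal_expnorm 0 1 m1).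
have hyp5 (h x : R) : `](r - 1), (r + 1)[%classic h -> [set: R] x -> `|partial1of2 f h x| <= G x.
  move=> h1 _; rewrite pD normrN normrM.
  rewrite (@le_trans _ _ (expR (1 * `|x|)))// ?expR_norm_le//.
  rewrite mul1r -[leRHS]mulr1 ler_pM// ?le_norm_exp// ler_norml.
  by rewrite sin_geN1 sin_le1.
have D1 := @derivable_under_integral R _ _ (N 0 1) f setT measurableT r (r - 1) (r + 1) I0 hyp1 hyp2 G hyp3 hyp4 hyp5.
have D2 := @differentiation_under_integral R _ _ (N 0 1) f setT measurableT r (r - 1) (r + 1) I0 hyp1 hyp2 G hyp3 hyp4 hyp5.
apply: DeriveDef => //.
rewrite -derive1E D2.
rewrite -mulN1r -RintegralZl//; last first.
  apply: (@integrable_normal_le _ _ 1 1 _ m1) => //.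
    apply: measurable_funM => //; apply: (bmfun_sin _).1.
    by apply: measurable_funD => //; exact: measurable_funM.
  move=> x; rewrite !mul1r normrM -[leRHS]mulr1 ler_pM// ?le_norm_exp// ler_norml.
  by rewrite sin_geN1 sin_le1.
by apply: eq_Rintegral => x _; rewrite pD mulN1r.
Qed.

(** By Stein's identity the left-hand side g(r) solves g' = - r g, so that
    g(r) exp (r^2 / 2) is constant. *)
Lemma normal_cos0 (r t : R) :
  Ex (N 0 1) (fun x => cos (r * x + t)) = expR (- (r ^+ 2 / 2)) * cos t.
Proof.
pose g (r : R) := Ex (N 0 1) (fun x => cos (r * x + t)).
have gD (x : R) : is_derive x (1 : R) g (- (x * g x)).
  by rewrite -stein_sin; exact: is_derive_normal_cos.
have FD (x : R) : is_derive x (1 : R) (fun r : R => g r * expR (r ^+ 2 / 2)) 0.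
  apply: is_derive_eq.
  rewrite /GRing.scale/=; by field.
have := is_derive_0_is_cst r 0 FD.
rewrite /g expr0n/= mul0r expR0 mulr1.
under [X in _ = Ex _ X]eq_fun do rewrite mul0r add0r.
by rewrite Ex_cst => <-; rewrite mulrCA -expRD addNr expR0 mulr1.
Qed.

Lemma normal_cos (m s r t : R) : s != 0 ->
  Ex (N m s) (fun x => cos (r * x + t)) = expR (- (s ^+ 2 * r ^+ 2 / 2)) * cos (r * m + t).
Proof.
have mrt : measurable_fun setT (fun x : R => r * x + t).
  by apply: measurable_funD => //; exact: measurable_funM.
have pos (u : R) : 0 < u ->
    Ex (N m u) (fun x => cos (r * x + t)) = expR (- (u ^+ 2 * r ^+ 2 / 2)) * cos (r * m + t).
  move=> u0; rewrite normal_affine//; last 2 first.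
  - by move=> x; apply: (@continuous_comp _ _ _ (fun x : R => r * x + t) (@cos R));
      [apply: cvgD; [apply: cvgMr; exact: cvg_id|exact: cvg_cst]|exact: continuous_cos].
  - exact: bmfun_cos.
  rewrite (@eq_Ex _ _ _ _ _ (fun x => cos ((r * u) * x + (r * m + t)))); last first.
    by move=> x; congr cos; ring.
  by rewrite normal_cos0 exprMn [r ^+ 2 * _]mulrC.
move=> s0; have [s1|s1] := ltP 0 s; first exact: pos.
have s2 : 0 < - s by rewrite oppr_gt0 lt_neqAle s0.
rewrite -(sqrrN s) -(pos _ s2).
have := @normal_tilt _ m s m (- s) 1 (fun=> 1) _ ler01 (measurable_cst _) (fun=> ler01) _ (bmfun_cos mrt).
rewrite mul1r => <-; first by apply: eq_Rintegral => x _; rewrite mul1r.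
move=> x; rewrite !mul1r !normal_pdfE ?oppr_eq0//.
by rewrite /normal_peak /normal_fun sqrrN.
Qed.

Lemma normal_pdf_quad (v b x : R) : 0 <= v ->
  expR (- (v * x ^+ 2 + 2 * b * x) / 2) * normal_pdf 0 1 x =
  ((Num.sqrt (1 + v))^-1 * expR (b ^+ 2 / (2 * (1 + v)))) *
    normal_pdf (- b / (1 + v)) (Num.sqrt (1 + v))^-1 x.
Proof.
move=> v0; have v1 : 0 < 1 + v by rewrite ltr_pwDl.
have s1 : Num.sqrt (1 + v) != 0 by rewrite sqrtr_eq0 -ltNge.
rewrite !normal_pdfE ?invr_eq0// /normal_fun.
have -> : normal_peak (Num.sqrt (1 + v))^-1 = Num.sqrt (1 + v) * normal_peak 1 :> R.
  rewrite /normal_peak expr1n mul1r -mulrnAr sqrtrM ?sqr_ge0// sqrtr_sqr.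
  by rewrite ger0_norm ?invr_ge0 ?sqrtr_ge0// invfM invrK.
have E (q p C D : R) : q != 0 -> (q^-1 * C) * ((q * p) * D) = p * (C * D).
  by move=> q0; field.
rewrite mulrCA E//; congr (_ * _); rewrite -!expRD; congr expR.
rewrite exprVn sqr_sqrtr ?(ltW v1)//; field.
by rewrite gt_eqF.
Qed.

Lemma normal_quad (v b : R) f : 0 <= v -> bmfun f ->
  \int[N 0 1]_x (expR (- (v * x ^+ 2 + 2 * b * x) / 2) * f x) =
  ((Num.sqrt (1 + v))^-1 * expR (b ^+ 2 / (2 * (1 + v)))) *
    Ex (N (- b / (1 + v)) (Num.sqrt (1 + v))^-1) f.
Proof.
move=> v0 bf; apply: normal_tilt bf => [||x|x].
- by rewrite mulr_ge0 ?expR_ge0// invr_ge0 sqrtr_ge0.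
- apply: measurableT_comp => //; apply: measurable_funM => //.
  apply: measurableT_comp => //; apply: measurable_funD.
    by apply: measurable_funM => //; exact: measurable_funX.
  exact: measurable_funM.
- exact: expR_ge0.
- exact: normal_pdf_quad.
Qed.

End normal_moments.

Section gauss_consequences.
Context {R : realType}.
Notation N01 := (@normal_law R 0 1).

Lemma measurable_quad (v b q : R) :
  measurable_fun setT (fun x : R => - (v * x ^+ 2 + 2 * b * x + q) / 2).
Proof.
apply: measurable_funM => //; apply: measurableT_comp => //.
apply: measurable_funD => //; apply: measurable_funD; last exact: measurable_funM.
by apply: measurable_funM => //; exact: measurable_funX.
Qed.

(** Under the Gaussian weight x has variance 1 / (1 + v), so the phase r x
    costs the factor exp (- r^2 / (2 (1 + v))), whatever the mean of x. *)
Lemma gauss_cos_le (v b q r t : R) : 0 <= v ->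
  Ex N01 (fun x => expR (- (v * x ^+ 2 + 2 * b * x + q) / 2) * cos (r * x + t)) <=
  expR (- (r ^+ 2 / (2 * (1 + v)))) *
  Ex N01 (fun x => expR (- (v * x ^+ 2 + 2 * b * x + q) / 2)).
Proof.
move=> v0.
have v1 : 0 < 1 + v by rewrite ltr_pwDl.
have mrt : measurable_fun setT (fun x : R => r * x + t).
  by apply: measurable_funD => //; exact: measurable_funM.
have E x : expR (- (v * x ^+ 2 + 2 * b * x + q) / 2) =
    expR (- (v * x ^+ 2 + 2 * b * x) / 2) * expR (- q / 2).
  by rewrite -expRD; congr expR; field.
rewrite (@eq_Ex _ _ _ _ _ (fun x : R => expR (- (v * x ^+ 2 + 2 * b * x) / 2) *
    (expR (- q / 2) * cos (r * x + t)))); last by move=> x; rewrite E mulrA.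
rewrite [X in _ <= _ * X](@eq_Ex _ _ _ _ _ (fun x : R => expR (- (v * x ^+ 2 + 2 * b * x) / 2) *
    (expR (- q / 2)))); last by move=> x; rewrite E.
have b1 : bmfun (fun x : R => cos (r * x + t)) by exact: bmfun_cos.
have b2 : bmfun (fun x : R => expR (- q / 2) * cos (r * x + t)).
  by apply: bmfunM => //; exact: bmfun_cst.
have := normal_quad b v0 b2; rewrite -/(Ex _ _) => ->.
have := normal_quad b v0 (bmfun_cst (expR (- q / 2))); rewrite -/(Ex _ _) => ->.
rewrite Ex_cst ExZ// normal_cos; last by rewrite invr_eq0 sqrtr_eq0 -ltNge.
rewrite [leRHS]mulrCA ler_wpM2l//.
rewrite [leRHS]mulrC ler_wpM2l ?expR_ge0//.
rewrite exprVn sqr_sqrtr ?(ltW v1)//.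
have -> : (1 + v)^-1 * r ^+ 2 / 2 = r ^+ 2 / (2 * (1 + v)).
  by field; rewrite gt_eqF.
by rewrite -[leRHS]mulr1 ler_wpM2l ?expR_ge0// cos_le1.
Qed.

Lemma bmfun_gauss_sq (w c : R) : 0 <= w -> bmfun (fun x : R => expR (- (w * (x + c) ^+ 2) / 2)).
Proof.
move=> w0; apply: (@bmfun_exp _ _ _ _ 0).
  apply: measurable_funM => //; apply: measurableT_comp => //.
  apply: measurable_funM => //; apply: measurable_funX.
  exact: measurable_funD.
by move=> x; rewrite mulNr oppr_le0 divr_ge0// mulr_ge0// sqr_ge0.
Qed.

(** A shift of the centre only decreases the integral. *)
Lemma gauss_sq_le (w c : R) : 0 <= w ->
  Ex N01 (fun x => expR (- (w * (x + c) ^+ 2) / 2)) <= (Num.sqrt (1 + w))^-1.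
Proof.
move=> w0.
have w1 : 0 < 1 + w by rewrite ltr_pwDl.
rewrite (@eq_Ex _ _ _ _ _ (fun x : R => expR (- (w * x ^+ 2 + 2 * (w * c) * x) / 2) *
    (expR (- (w * c ^+ 2) / 2)))); last first.
  by move=> x; rewrite -expRD; congr expR; field.
have := normal_quad (w * c) w0 (bmfun_cst (expR (- (w * c ^+ 2) / 2))); rewrite -/(Ex _ _) => ->.
rewrite Ex_cst -mulrA -[leRHS]mulr1 ler_wpM2l ?invr_ge0 ?sqrtr_ge0//.
rewrite -expRD expR_le1.
have -> : (w * c) ^+ 2 / (2 * (1 + w)) + - (w * c ^+ 2) / 2 = - (w * c ^+ 2 / (2 * (1 + w))).
  by field; rewrite gt_eqF.
by rewrite oppr_le0; apply: divr_ge0; apply: mulr_ge0; rewrite ?sqr_ge0 ?(ltW w1).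
Qed.

Lemma gauss_sqE (w : R) : 0 <= w ->
  Ex N01 (fun x => expR (- (w * x ^+ 2) / 2)) = (Num.sqrt (1 + w))^-1.
Proof.
move=> w0.
rewrite (@eq_Ex _ _ _ _ _ (fun x : R => expR (- (w * x ^+ 2 + 2 * 0 * x) / 2) * 1)); last first.
  by move=> x; rewrite mulr1 mulr0 mul0r addr0.
have := normal_quad 0 w0 (bmfun_cst 1); rewrite -/(Ex _ _) => ->.
by rewrite Ex_cst expr0n/= mul0r expR0 !mulr1.
Qed.

(** * Families of independent standard Gaussians *)

(** The space is built by taking products with the line; the two formulas are
    the only facts about independent Gaussians that the duality arguments use. *)
Lemma gaussian_space_ord n : exists (d : measure_display) (S : measurableType d)
    (G : probability S R) (N : 'I_n -> S -> R),
  [/\ forall i, measurable_fun setT (N i),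
   forall (y : 'I_n -> R) (c : R),
     Ex G (fun s => cos (\sum_i y i * N i s + c)) =
     expR (- (\sum_i y i ^+ 2) / 2) * cos c &
   forall (f : 'I_n -> R -> R), (forall i, bmfun (f i)) ->
     Ex G (fun s => \prod_i f i (N i s)) = \prod_i Ex N01 (f i)].
Proof.
elim: n => [|n [d [S [G [N [mN cosN prodN]]]]]].
  exists default_measure_display, R, N01, (fun _ _ => 0); split=> //.
  - move=> y c; rewrite (@eq_Ex _ _ _ _ _ (fun=> cos c)) => [|x]; last by rewrite big_ord0 add0r.
    by rewrite Ex_cst [X in - X]big_ord0 oppr0 mul0r expR0 mul1r.
  - move=> f bf; rewrite (@eq_Ex _ _ _ _ _ (fun=> 1)) => [|x]; last by rewrite big_ord0.
    by rewrite Ex_cst big_ord0.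
pose N' (i : 'I_n.+1) (p : S * R) :=
  if unlift ord0 i is Some j then N j p.1 else p.2.
have N0 p : N' ord0 p = p.2 by rewrite /N' unlift_none.
have NS p j : N' (lift ord0 j) p = N j p.1 by rewrite /N' liftK.
have mN' i : measurable_fun setT (N' i).
  by rewrite /N'; case: unlift => [j|//]; exact: measurableT_comp.
exists _, _, (G \x N01)%E, N'; split => //.
- move=> y c; rewrite Ex_prod1; last first.
    apply: bmfun_cos; apply: measurable_funD => //; apply: measurable_sum => i.
    exact: measurable_funM.
  pose A := expR (- (y ord0 ^+ 2 / 2)).
  rewrite (@eq_Ex _ _ _ _ _ (fun s : S => A * cos (\sum_i y (lift ord0 i) * N i s + c))); last first.
    move=> s; rewrite -normal_cos0; apply: eq_Ex => x.
    rewrite big_ord_recl N0/= -addrA; congr (cos (_ + (_ + _))).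
    by apply: eq_bigr => i _; rewrite NS.
  rewrite ExZ; last first.
    apply: bmfun_cos; apply: measurable_funD => //; apply: measurable_sum => i.
    exact: measurable_funM.
  rewrite cosN mulrA -expRD big_ord_recl; congr (expR _ * _).
  by field.
- move=> f bf.
  have bN i : bmfun (fun p => f i (N' i p)).
    have [mf [M fM]] := bf i; split; last by exists M => x; exact: fM.
    exact: measurableT_comp.
  rewrite Ex_prod1; last exact: bmfun_prod.
  rewrite (@eq_Ex _ _ _ _ _ (fun s : S => Ex N01 (f ord0) * \prod_i f (lift ord0 i) (N i s))); last first.
    move=> s; rewrite mulrC -ExZ//; apply: eq_Ex => x.
    rewrite big_ord_recl N0/= mulrC; congr (_ * _).
    by apply: eq_bigr => i _; rewrite NS.
  rewrite ExZ; last first.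
    apply: bmfun_prod => i.
    have [mf [M fM]] := bf (lift ord0 i); split; last by exists M => x; exact: fM.
    exact: measurableT_comp.
  rewrite (prodN (fun i => f (lift ord0 i))) ?big_ord_recl// => i; exact: bf.
Qed.

Lemma gaussian_space (I : finType) : exists (d : measure_display) (S : measurableType d)
    (G : probability S R) (N : I -> S -> R),
  [/\ forall i, measurable_fun setT (N i),
   forall (y : I -> R) (c : R),
     Ex G (fun s => cos (\sum_i y i * N i s + c)) =
     expR (- (\sum_i y i ^+ 2) / 2) * cos c &
   forall (f : I -> R -> R), (forall i, bmfun (f i)) ->
     Ex G (fun s => \prod_i f i (N i s)) = \prod_i Ex N01 (f i)].
Proof.
have [d [S [G [N [mN cosN prodN]]]]] := gaussian_space_ord #|I|.
have rx : {on predT, bijective (@enum_val I I)} by exact/onW_bij/enum_val_bij.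
exists d, S, G, (fun i => N (enum_rank i)); split => //.
- move=> y c; rewrite (reindex _ rx)/= -(cosN (fun i => y (enum_val i))); apply: eq_Ex => s; congr (cos (_ + _)).
  by rewrite (reindex _ rx)/=; apply: eq_bigr => i _; rewrite enum_valK.
- move=> f bf; rewrite (reindex _ rx)/= -(prodN (fun i => f (enum_val i)))//; apply: eq_Ex => s.
  by rewrite (reindex _ rx)/=; apply: eq_bigr => i _; rewrite enum_valK.
Qed.

End gauss_consequences.

(** * Characteristic functions of fractional Brownian motion *)

Section fbm_char.
Context {disp : measure_display} {T : measurableType disp} {R : realType}.
Variable P : probability T R.

(** The law of Y is a point mass or a normal law, and in both cases its mean
    and second moment determine the characteristic function. *)
Lemma gaussian_cos (Y : T -> R) (c : R) : gaussian P Y ->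
  P.-integrable setT (EFin \o Y) -> P.-integrable setT (EFin \o (fun w => Y w ^+ 2)) ->
  \int[P]_w Y w = 0 ->
  Ex P (fun w => cos (Y w + c)) = expR (- (\int[P]_w (Y w ^+ 2)) / 2) * cos c.
Proof.
move=> [mY [m [s lawY]]] iY iY2 EY0.
pose Y' : {mfun T >-> R} := mfun_Sub (mem_set mY).
have E (f : R -> R) : measurable_fun setT f -> P.-integrable setT (EFin \o (fun w => f (Y w))) ->
    (\int[P]_w (f (Y w))%:E = \int[distribution P Y']_y (f y)%:E)%E.
  move=> mf iF; rewrite integral_distribution//.
  exact/measurable_EFinP.
have icos : P.-integrable setT (EFin \o (fun w => cos (Y w + c))).
  by apply: bmfun_integrable; apply: bmfun_cos; exact: measurable_funD.
have mcos : measurable_fun setT (fun y : R => cos (y + c)).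
  by apply: (bmfun_cos _).1; exact: measurable_funD.
have msq : measurable_fun setT (fun y : R => y ^+ 2) by exact: measurable_funX.
have F1 := E id (@measurable_id _ _ _) iY.
have F2 := E (fun y => y ^+ 2) msq iY2.
have F3 := E (fun y => cos (y + c)) mcos icos.
have {}F1 : \int[distribution P Y']_y y = 0 by rewrite -EY0 /Rintegral F1.
have {}F2 : \int[distribution P Y']_y (y ^+ 2) = \int[P]_w (Y w ^+ 2) by rewrite /Rintegral F2.
have {}F3 : Ex P (fun w => cos (Y w + c)) = \int[distribution P Y']_y (cos (y + c)).
  by rewrite /Ex /Rintegral F3.
have [s0|s0] := eqVneq s 0.
  have D (f : R -> R) : measurable_fun setT f -> \int[distribution P Y']_y f y = f m.
    move=> mf; rewrite /Rintegral (@eq_measure_integral _ _ _ _ (\d_m : measure R R)).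
      rewrite integral_dirac//; last exact/measurable_EFinP.
      by rewrite diracT mul1e.
    by move=> A mA _; have := lawY A mA; rewrite s0 eqxx.
  move: F1; rewrite (D id)// => m0.
  rewrite F3 -F2 (D _ mcos) (D _ msq) m0 expr0n/= oppr0 mul0r expR0 mul1r add0r//.
have D (f : R -> R) : \int[distribution P Y']_y f y = \int[normal_law m s]_y f y.
  congr fine; apply: eq_measure_integral.
  by move=> A mA _; have := lawY A mA; rewrite (negbTE s0).
move: F1; rewrite D normal_mean// => m0.
rewrite F3 -F2 !D normal_moment2// m0 expr0n/= add0r.
have := normal_cos 0 1 c s0; rewrite expr1n mulr1 mulr0 add0r mulNr => <-.
by apply: eq_Ex => x; rewrite mul1r.
Qed.

Definition fcov (H t s : R) : R :=
  (`|t| `^ (2 * H) + `|s| `^ (2 * H) - `|t - s| `^ (2 * H)) / 2.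

Variables (H : R) (X : R -> T -> R).
Hypothesis fX : fbm1 P H X.

Lemma fbm1_measurable t : 0 <= t -> measurable_fun setT (X t).
Proof.
move=> t0; have G : gaussian_process P X := fbm1_gaussian fX.
have [+ _] := G 1%N (fun=> 1) (fun=> t) (fun=> t0).
by under eq_fun do rewrite big_ord1 mul1r.
Qed.

Lemma fbm1_integrable t : 0 <= t -> P.-integrable setT (EFin \o X t).
Proof.
move=> t0; have mX := fbm1_measurable t0.
apply/integrableP; split; first exact/measurable_EFinP.
rewrite /= integral_fin_num_abs//.
by have := fbm1_mean0 fX t0; rewrite unlock => ->.
Qed.

Lemma fbm1_integrableM t s : 0 <= t -> 0 <= s ->
  P.-integrable setT (EFin \o (fun w => X t w * X s w)).
Proof.
move=> t0 s0; have mX := fbm1_measurable t0; have mX' := fbm1_measurable s0.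
apply/integrableP; split; first by apply/measurable_EFinP; exact: measurable_funM.
rewrite /= integral_fin_num_abs//; last exact: measurable_funM.
by have := fbm1_cov fX t0 s0; rewrite unlock => ->.
Qed.

(** A linear combination of values of the process is Gaussian, centred, with
    the variance given by the covariance form. *)
Lemma fbm1_cos_ord n (a t : 'I_n -> R) (c : R) : (forall i, 0 <= t i) ->
  Ex P (fun w => cos (\sum_i a i * X (t i) w + c)) =
  expR (- (\sum_i \sum_j a i * a j * fcov H (t i) (t j)) / 2) * cos c.
Proof.
move=> t0.
pose Y w := \sum_i a i * X (t i) w.
have gY : gaussian P Y by have G : gaussian_process P X := fbm1_gaussian fX; exact: G.
have Y1 : (EFin \o Y) = (fun w => \sum_(i < n) ((a i)%:E * (EFin \o X (t i)) w))%E.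
  apply/funext => w; rewrite /= /Y -sumEFin; apply: eq_bigr => i _.
  by rewrite EFinM.
have Y2 : (EFin \o (fun w => Y w ^+ 2)) = (fun w => \sum_(i < n) \sum_(j < n)
    ((a i * a j)%R%:E * (EFin \o (fun w => X (t i) w * X (t j) w)%R) w))%E.
  apply/funext => w; rewrite /= /Y expr2 mulr_suml -sumEFin; apply: eq_bigr => i _.
  rewrite mulr_sumr -sumEFin; apply: eq_bigr => j _.
  by rewrite -EFinM; congr EFin; ring.
have i1 i : P.-integrable setT (fun w => (a i)%:E * (EFin \o X (t i)) w)%E.
  by apply: integrableZl => //; exact: fbm1_integrable.
have i2 i j : P.-integrable setT
    (fun w => (a i * a j)%R%:E * (EFin \o (fun w => X (t i) w * X (t j) w)%R) w)%E.
  by apply: integrableZl => //; exact: fbm1_integrableM.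
have i3 i : P.-integrable setT (fun w => \sum_(j < n)
    (a i * a j)%R%:E * (EFin \o (fun w => X (t i) w * X (t j) w)%R) w)%E.
  exact: integrable_sum.
rewrite (@gaussian_cos Y c gY).
- congr (expR (- _ / 2) * _).
  apply: EFin_inj; rewrite -[LHS]/((fine (\int[P]_w (EFin \o (fun w => Y w ^+ 2)%R) w)%E)%:E) Y2.
  rewrite integral_sum//.
  under eq_bigr => i _.
    rewrite integral_sum//.
    under eq_bigr => j _.
      rewrite integralZl//; last exact: fbm1_integrableM.
      have := fbm1_cov fX (t0 i) (t0 j); rewrite unlock => ->.
      rewrite -EFinM -/(fcov H (t i) (t j)).
      over.
    rewrite sumEFin.
    over.
  by rewrite sumEFin.
- by rewrite Y1; exact: integrable_sum.
- by rewrite Y2; exact: integrable_sum.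
- rewrite -[LHS]/(fine (\int[P]_w (EFin \o Y) w)%E) Y1 integral_sum//.
  rewrite big1// => i _; rewrite integralZl//; last exact: fbm1_integrable.
  by have := fbm1_mean0 fX (t0 i); rewrite unlock => ->; rewrite mule0.
Qed.

Lemma fbm1_cos (I : finType) (a t : I -> R) (c : R) : (forall i, 0 <= t i) ->
  Ex P (fun w => cos (\sum_i a i * X (t i) w + c)) =
  expR (- (\sum_i \sum_j a i * a j * fcov H (t i) (t j)) / 2) * cos c.
Proof.
move=> t0.
have rx : {on predT, bijective (@enum_val I I)} by exact/onW_bij/enum_val_bij.
have := @fbm1_cos_ord #|I| (fun i => a (enum_val i)) (fun i => t (enum_val i)) c (fun i => t0 _).
rewrite [X in expR (- X / 2)](_ : _ = \sum_i \sum_j a i * a j * fcov H (t i) (t j)).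
  by move=> <-; apply: eq_Ex => w; rewrite (reindex _ rx).
by rewrite [RHS](reindex _ rx)/=; apply: eq_bigr => i _; rewrite [RHS](reindex _ rx).
Qed.

End fbm_char.

(** * Expectations of Gaussian kernels by Fourier duality *)

Section elementary.
Context {R : realType}.

Lemma cos_ge (x : R) : 1 - x ^+ 2 / 2 <= cos x.
Proof.
have sin_le (y : R) : 0 < y -> sin y ^+ 2 <= y ^+ 2.
  move=> y0; have [|c _] := @MVT R sin cos 0 y y0.
    by apply: continuous_subspaceT => z; exact: continuous_sin.
  rewrite sin0 !subr0 => ->; rewrite exprMn ler_piMl ?sqr_ge0//.
have pos (y : R) : 0 < y -> 1 - y ^+ 2 / 2 <= cos y.
  move=> y0; have -> : cos y = 1 - 2 * sin (y / 2) ^+ 2.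
    have {1}-> : y = (y / 2) *+ 2 by rewrite -mulr_natr divfK.
    rewrite cos_mulr2n cos2sin2 -mulr_natr; ring.
  have /sin_le : 0 < y / 2 by rewrite divr_gt0.
  by rewrite exprMn exprVn; nra.
have [x0|x0|->] := ltgtP x 0; last by rewrite cos0 expr0n/= mul0r subr0.
- by rewrite -sqrrN -cosN pos// oppr_gt0.
- exact: pos.
Qed.

Lemma cauchy_schwarz_sum (I : finType) (x y : I -> R) :
  (\sum_i x i * y i) ^+ 2 <= (\sum_i x i ^+ 2) * (\sum_i y i ^+ 2).
Proof.
have : 0 <= \sum_i \sum_j (x i * y j - x j * y i) ^+ 2.
  by apply: sumr_ge0 => i _; apply: sumr_ge0 => j _; exact: sqr_ge0.
have -> : \sum_i \sum_j (x i * y j - x j * y i) ^+ 2 =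
  2 * ((\sum_i x i ^+ 2) * (\sum_i y i ^+ 2) - (\sum_i x i * y i) ^+ 2).
  have -> : (\sum_i x i ^+ 2) * (\sum_i y i ^+ 2) = \sum_i \sum_j x i ^+ 2 * y j ^+ 2.
    by rewrite mulr_suml; apply: eq_bigr => i _; rewrite mulr_sumr.
  have -> : (\sum_i x i * y i) ^+ 2 = \sum_i \sum_j (x i * y i) * (x j * y j).
    by rewrite expr2 mulr_suml; apply: eq_bigr => i _; rewrite mulr_sumr.
  rewrite mulrBr {1}mulr_natl mulr2n.
  have E : \sum_i \sum_j x i ^+ 2 * y j ^+ 2 = \sum_i \sum_j x j ^+ 2 * y i ^+ 2.
    by rewrite exchange_big.
  rewrite {2}E -big_split/= mulr_sumr -sumrB; apply: eq_bigr => i _.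
  rewrite -big_split/= mulr_sumr -sumrB; apply: eq_bigr => j _; ring.
by rewrite pmulr_rge0// subr_ge0.
Qed.

End elementary.

Lemma bmfun_expN2 (disp : measure_display) (T : measurableType disp) (R : realType) (f : T -> R) : measurable_fun setT f -> (forall w, 0 <= f w) ->
  bmfun (fun w => expR (- f w / 2)).
Proof.
move=> mf f0; apply: (@bmfun_exp _ _ _ _ 0).
  by apply: measurable_funM => //; exact: measurableT_comp.
by move=> w; rewrite mulNr oppr_le0 divr_ge0.
Qed.

Section gauss_kernel.
Context {disp : measure_display} {T : measurableType disp} {R : realType}.
Variables (P : probability T R) (I : finType) (Y : I -> T -> R) (q : (I -> R) -> R).
Hypothesis mY : forall i, measurable_fun setT (Y i).
Hypothesis charY : forall (z : I -> R) (c : R),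
  Ex P (fun w => cos (\sum_i z i * Y i w + c)) = expR (- q z / 2) * cos c.

(** The upper bound by duality. The factor at i0 is the mean of cos ((Y_i0 -
    r) x) over a standard normal x, the other factors are the mean of cos <Y -
    y, N> over independent standard normals N. After Fubini the mean over P is
    the characteristic function at N + x e_i0, equal to exp (- q (N + x e_i0)
    / 2), which is the exponential of a quadratic polynomial in x with leading
    coefficient v. Integrating the phase r x over x gives the first factor of
    the bound; the remaining mean of exp (- q / 2) is bounded through the
    diagonal form w. *)
Lemma gauss_kernel_le (i0 : I) (v r : R) (w y : I -> R) :
  0 <= v -> (forall i, 0 <= w i) ->
  (forall z, exists b, forall x : R,
     q (fun i => z i + x * (i == i0)%:R) = v * x ^+ 2 + 2 * b * x + q z) ->
  (forall z, \sum_i w i * z i ^+ 2 <= q z) ->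
  Ex P (fun t => expR (- ((Y i0 t - r) ^+ 2 + \sum_i (Y i t - y i) ^+ 2) / 2)) <=
  expR (- (r ^+ 2 / (2 * (1 + v)))) * \prod_i (Num.sqrt (1 + w i))^-1.
Proof.
move=> v0 w0 qs qw.
have [d [S [G [N [mN cosG prodG]]]]] := @gaussian_space R I.
pose e0 t := expR (- (Y i0 t - r) ^+ 2 / 2).
pose A (t : T) (s : S) := \sum_i (Y i t - y i) * N i s.
have mA : measurable_fun setT (fun p : T * S => A p.1 p.2).
  apply: measurable_sum => i; apply: measurable_funM.
    by apply: measurable_funB => //; exact: measurableT_comp.
  exact: measurableT_comp.
have mA1 s : measurable_fun setT (A ^~ s).
  apply: measurable_sum => i; apply: measurable_funM => //.
  exact: measurable_funB.
have mA2 t : measurable_fun setT (A t).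
  by apply: measurable_sum => i; exact: measurable_funM.
have be0 : bmfun e0.
  apply: bmfun_expN2; last by move=> t; exact: sqr_ge0.
  by apply: measurable_funX; exact: measurable_funB.
have bcA : bmfun (fun p : T * S => e0 p.1 * cos (A p.1 p.2)).
  apply: bmfunM; last exact: bmfun_cos.
  have [me [M eM]] := be0; split; last by exists M => p; exact: eM.
  exact: measurableT_comp.
rewrite (@eq_Ex _ _ _ _ _ (fun t : T => Ex G (fun s => e0 t * cos (A t s)))); last first.
  move=> t; rewrite ExZ; last first.
    exact: bmfun_cos.
  have := cosG (fun i => Y i t - y i) 0; rewrite cos0 mulr1.
  rewrite (@eq_Ex _ _ _ _ _ (fun s : S => cos (A t s))) => [->|s]; last by rewrite addr0.
  by rewrite /e0 -expRD; congr expR; field.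
rewrite (Ex_fubini P G bcA).
pose z s i := N i s.
pose B s x := \prod_i expR (- (w i * (N i s + x * (i == i0)%:R) ^+ 2) / 2).
have bB : bmfun (fun p : S * R => B p.1 p.2).
  apply: bmfun_prod => i; apply: (@bmfun_exp _ _ _ _ 0).
    apply: measurable_funM => //; apply: measurableT_comp => //.
    apply: measurable_funM => //; apply: measurable_funX.
    apply: measurable_funD; first exact: measurableT_comp.
    exact: measurable_funM.
  by move=> p; rewrite mulNr oppr_le0 divr_ge0// mulr_ge0// sqr_ge0.
have BE s x : B s x = expR (- (\sum_i w i * (N i s + x * (i == i0)%:R) ^+ 2) / 2).
  rewrite /B -expR_sum; congr expR.
  by rewrite -mulr_suml -sumrN.
set K := expR (- (r ^+ 2 / _)).
have J s : Ex P (fun t => e0 t * cos (A t s)) <= K * Ex (normal_law 0 1) (B s).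
  have [b qb] := qs (z s).
  pose th := \sum_i N i s * y i.
  have E1 t : e0 t * cos (A t s) = Ex (normal_law 0 1) (fun x => cos ((Y i0 t - r) * x + A t s)).
    by rewrite normal_cos0 /e0 mulNr.
  rewrite (eq_Ex P E1).
  have bC : bmfun (fun p : T * R => cos ((Y i0 p.1 - r) * p.2 + A p.1 s)).
    apply: bmfun_cos; apply: measurable_funD; last exact: (measurableT_comp (mA1 s)).
    apply: measurable_funM => //; apply: measurable_funB => //.
    exact: measurableT_comp.
  rewrite (Ex_fubini P (normal_law 0 1) bC)/=.
  have E2 x : Ex P (fun t => cos ((Y i0 t - r) * x + A t s)) =
      expR (- (v * x ^+ 2 + 2 * b * x + q (z s)) / 2) * cos (r * x + th).
    rewrite -qb -[in RHS]cosN -charY; apply: eq_Ex => t; congr cos.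
    have -> : \sum_i (z s i + x * (i == i0)%:R) * Y i t = \sum_i N i s * Y i t + x * Y i0 t.
      under eq_bigr do rewrite mulrDl.
      rewrite big_split/=; congr (_ + _); rewrite (bigD1 i0)//= eqxx mulr1.
      by rewrite big1 ?addr0// => i /negbTE ->; rewrite mulr0 mul0r.
    have -> : A t s = \sum_i N i s * Y i t - th.
      by rewrite /A /th -sumrB; apply: eq_bigr => i _; ring.
    ring.
  rewrite (eq_Ex _ E2) (le_trans (gauss_cos_le _ _ _ _ v0))// ler_wpM2l ?expR_ge0//.
  apply: le_Ex; last first.
  - move=> x; rewrite BE ler_expR ler_pM2r// lerN2.
    by rewrite -qb (le_trans (qw _)).
  - exact: (bmfun_pair1 s bB).
  - have H x : v * x ^+ 2 + 2 * b * x + q (z s) >= 0.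
      rewrite -qb (le_trans _ (qw _))// sumr_ge0// => i _.
      by rewrite mulr_ge0// sqr_ge0.
    apply: (@bmfun_exp _ _ _ _ 0); first exact: measurable_quad.
    by move=> x; rewrite mulNr oppr_le0 divr_ge0.
apply: (@le_trans _ _ (Ex G (fun s => K * Ex (normal_law 0 1) (B s)))).
  apply: le_Ex => //; first exact: (bmfun_Ex2 P G bcA).
  by apply: bmfunM; [exact: bmfun_cst|exact: (bmfun_Ex1 G (normal_law 0 1) bB)].
rewrite ExZ; last exact: (bmfun_Ex1 G (normal_law 0 1) bB).
rewrite ler_wpM2l ?expR_ge0// (Ex_fubini G (normal_law 0 1) bB)/=.
rewrite -[leRHS](Ex_cst (normal_law 0 1)); apply: le_Ex.
- exact: (bmfun_Ex2 G (normal_law 0 1) bB).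
- exact: bmfun_cst.
move=> x; rewrite (prodG (fun i n => expR (- (w i * (n + x * (i == i0)%:R) ^+ 2) / 2))).
  apply: ler_prod => i _; rewrite gauss_sq_le// andbT.
  by apply: Ex_ge0 => n; exact: expR_ge0.
by move=> i; exact: bmfun_gauss_sq.
Qed.

(** The lower bound by duality. The mean over P equals the mean of exp (- q N
    / 2) cos <N, y>, and cos u >= 1 - u^2 / 2. The main term is bounded
    through q <= a |z|^2; in the error term <N, y>^2 <= |N|^2 |y|^2, and |N|^2
    is absorbed by half of the exponential decay. *)
Lemma gauss_kernel_ge (a b : R) (y : I -> R) : 0 < b -> b <= a ->
  (forall z, b * \sum_i z i ^+ 2 <= q z) ->
  (forall z, q z <= a * \sum_i z i ^+ 2) ->
  (Num.sqrt (1 + a))^-1 ^+ #|I| -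
    2 / b * (\sum_i y i ^+ 2) * (Num.sqrt (1 + b / 2))^-1 ^+ #|I| <=
  Ex P (fun t => expR (- (\sum_i (Y i t - y i) ^+ 2) / 2)).
Proof.
move=> b0 ba qb qa.
have [d [S [G [N [mN cosG prodG]]]]] := @gaussian_space R I.
pose A (t : T) (s : S) := \sum_i (Y i t - y i) * N i s.
have mA : measurable_fun setT (fun p : T * S => A p.1 p.2).
  apply: measurable_sum => i; apply: measurable_funM.
    by apply: measurable_funB => //; exact: measurableT_comp.
  exact: measurableT_comp.
rewrite (@eq_Ex _ _ _ _ _ (fun t : T => Ex G (fun s => cos (A t s)))); last first.
  move=> t; have := cosG (fun i => Y i t - y i) 0; rewrite cos0 mulr1 => <-.
  by apply: eq_Ex => s; rewrite addr0.
have bcA : bmfun (fun p : T * S => cos (A p.1 p.2)) by exact: bmfun_cos.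
rewrite (Ex_fubini P G bcA)/=.
pose D := \sum_i y i ^+ 2.
have D0 : 0 <= D by apply: sumr_ge0 => i _; exact: sqr_ge0.
pose e c s := \prod_i expR (- (c * (N i s) ^+ 2) / 2).
have eE c s : e c s = expR (- (c * \sum_i N i s ^+ 2) / 2).
  rewrite /e -expR_sum; congr expR.
  by rewrite -mulr_suml sumrN -mulr_sumr.
have be c : 0 <= c -> bmfun (e c).
  move=> c0; apply: bmfun_prod => i; apply: bmfun_expN2.
    by apply: measurable_funM => //; exact: measurable_funX.
  by move=> s; rewrite mulr_ge0// sqr_ge0.
have Ee c : 0 <= c -> Ex G (e c) = (Num.sqrt (1 + c))^-1 ^+ #|I|.
  move=> c0; rewrite (prodG (fun i n => expR (- (c * n ^+ 2) / 2))).
    by under eq_bigr do rewrite gauss_sqE//; rewrite prodr_const.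
  move=> i; have := bmfun_gauss_sq 0 c0.
  by under eq_fun do rewrite addr0.
have a0 : 0 <= a by exact: le_trans (ltW b0) ba.
have b2 : 0 <= b / 2 by rewrite divr_ge0// ltW.
rewrite -Ee// -Ee// -ExZ//; last exact: be.
rewrite -ExB//; [|exact: be|by apply: bmfunM; [exact: bmfun_cst|exact: be]].
apply: le_Ex.
- rewrite -[X in bmfun X]/(fun x => e a x + - (2 / b * D * e (b / 2) x)).
  have -> : (fun x => e a x + - (2 / b * D * e (b / 2) x)) =
     (fun x => e a x + - (2 / b * D) * e (b / 2) x) by apply/funext => x; rewrite mulNr.
  by apply: bmfunD; [exact: be|apply: bmfunM; [exact: bmfun_cst|exact: be]].
- exact: (bmfun_Ex2 P G bcA).
move=> s; pose z i := N i s; pose th := \sum_i N i s * y i.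
rewrite (@eq_Ex _ _ _ _ _ (fun t : T => cos (\sum_i z i * Y i t + - th))); last first.
  by move=> t; congr cos; rewrite /A /th -sumrB; apply: eq_bigr => i _; rewrite /z; ring.
rewrite charY cosN !eE.
pose Q := \sum_i N i s ^+ 2; rewrite -/Q.
have Q0 : 0 <= Q by apply: sumr_ge0 => i _; exact: sqr_ge0.
have thQ : th ^+ 2 <= Q * D by exact: cauchy_schwarz_sum.
have h1 : expR (- q z / 2) * (1 - th ^+ 2 / 2) <= expR (- q z / 2) * cos th.
  by rewrite ler_wpM2l ?expR_ge0// cos_ge.
apply: le_trans h1; rewrite mulrBr mulr1 lerB//.
  by rewrite ler_expR ler_pM2r// lerN2 qa.
have h2 : expR (- q z / 2) <= expR (- (b * Q) / 2).
  by rewrite ler_expR ler_pM2r// lerN2 qb.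
apply: (@le_trans _ _ (expR (- (b * Q) / 2) * (Q * D / 2))).
  by apply: ler_pM => //; rewrite ?expR_ge0 ?divr_ge0 ?sqr_ge0// ler_pM2r.
have -> : expR (- (b * Q) / 2) = expR (- (b / 2 * Q) / 2) * expR (- (b * Q / 4)).
  by rewrite -expRD; congr expR; field.
rewrite mulrAC [leRHS]mulrC -mulrA ler_wpM2l ?expR_ge0//.
have h3 : (b * Q / 4) * expR (- (b * Q / 4)) <= 1.
  rewrite expRN ler_pdivrMr ?expR_gt0// mul1r (le_trans _ (expR_ge1Dx _))//.
  by rewrite lerDr.
have -> : Q * D / 2 * expR (- (b * Q / 4)) = 2 / b * D * (b * Q / 4 * expR (- (b * Q / 4))).
  by field; rewrite gt_eqF.
by rewrite -[leRHS]mulr1 ler_wpM2l// mulr_ge0// divr_ge0// ltW.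
Qed.

End gauss_kernel.

(** * The covariance form in increment coordinates *)

Section powR_concave.
Context {R : realType}.
Variable a : R.
Hypotheses (a0 : 0 < a) (a1 : a <= 1).

Lemma powR_concave (l x y : R) : 0 <= l -> l <= 1 -> 0 <= x -> 0 <= y ->
  l * x `^ a + (1 - l) * y `^ a <= (l * x + (1 - l) * y) `^ a.
Proof.
move=> l0 l1 x0 y0.
have p1 : 1 <= a^-1 by rewrite invf_ge1.
have aV : a * a^-1 = 1 by rewrite mulfV// gt_eqF.
have aV' : a^-1 * a = 1 by rewrite mulVf// gt_eqF.
have l1' : 0 <= 1 - l by rewrite subr_ge0.
have := @convex_powR R a^-1 p1 (Itv01 l0 l1) (x `^ a) (y `^ a).
rewrite !inE/= !in_itv/= !andbT !powR_ge0 => /(_ isT isT).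
rewrite !convRE/= /unstable.onem -!powRrM aV !powRr1//.
move=> h.
rewrite -[leLHS]powRr1; last by rewrite addr_ge0// mulr_ge0// powR_ge0.
rewrite -[X in _ `^ X <= _]aV' powRrM ge0_ler_powR// ?nnegrE ?powR_ge0//; first exact: ltW.
by rewrite addr_ge0// mulr_ge0.
Qed.

(** The points x + y and y + z are the two complementary convex combinations
    of y and x + y + z, so this is concavity used twice. For 2 H <= 1 it says
    that increments over disjoint intervals are nonpositively correlated. *)
Lemma powR_4pt (x y z : R) : 0 <= x -> 0 <= y -> 0 <= z ->
  (x + y + z) `^ a + y `^ a <= (x + y) `^ a + (y + z) `^ a.
Proof.
move=> x0 y0 z0.
have [xz|xz] := eqVneq (x + z) 0.
  have [/eqP -> /eqP ->] : x == 0 /\ z == 0.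
    by move/eqP: xz; rewrite paddr_eq0// => /andP.
  by rewrite add0r !addr0.
have L0 : 0 < x + z by rewrite lt_neqAle eq_sym xz addr_ge0.
pose l := x / (x + z).
have l0 : 0 <= l by rewrite divr_ge0// ltW.
have l1 : l <= 1 by rewrite ler_pdivrMr// mul1r lerDl.
have xyz0 : 0 <= x + y + z by rewrite !addr_ge0.
have h1 := powR_concave l0 l1 xyz0 y0.
have h2 := powR_concave l0 l1 y0 xyz0.
have e1 : l * (x + y + z) + (1 - l) * y = x + y by rewrite /l; field.
have e2 : l * y + (1 - l) * (x + y + z) = y + z by rewrite /l; field.
rewrite e1 in h1; rewrite e2 in h2.
have := lerD h1 h2; apply: le_trans.
by rewrite le_eqVlt; apply/orP; left; apply/eqP; ring.
Qed.

End powR_concave.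

Section dirichlet.
Context {R : realType}.

(** Expansion of the square: b_i b_j = (b_i^2 + b_j^2 - (b_i - b_j)^2) / 2. *)
Lemma dirichlet_form n (M : 'I_n -> 'I_n -> R) (b : 'I_n -> R) :
  (forall i j, M i j = M j i) ->
  \sum_i \sum_j b i * b j * M i j =
  \sum_i b i ^+ 2 * (\sum_j M i j) +
  2^-1 * \sum_i \sum_j (- M i j) * (b i - b j) ^+ 2.
Proof.
move=> sM.
have E : \sum_i \sum_j b i ^+ 2 * M i j = \sum_i \sum_j b j ^+ 2 * M i j.
  rewrite exchange_big/=; apply: eq_bigr => i _; apply: eq_bigr => j _.
  by rewrite sM.
have -> : \sum_i b i ^+ 2 * (\sum_j M i j) =
   2^-1 * (\sum_i \sum_j b i ^+ 2 * M i j + \sum_i \sum_j b j ^+ 2 * M i j).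
  have half (x : R) : 2^-1 * (x + x) = x by field.
  rewrite -E half.
  by apply: eq_bigr => i _; rewrite mulr_sumr.
rewrite -mulrDr -!big_split/= mulr_sumr; apply: eq_bigr => i _.
rewrite -!big_split/= mulr_sumr; apply: eq_bigr => j _.
by field.
Qed.

(** All terms of the Dirichlet form are nonnegative; only the two row sums at
    i and j and the edge between them are kept. *)
Lemma dirichlet_ge n (M : 'I_n -> 'I_n -> R) (b : 'I_n -> R) (i j : 'I_n) :
  (forall i j, M i j = M j i) -> (forall i j, i != j -> M i j <= 0) ->
  (forall i, 0 <= \sum_j M i j) -> i != j ->
  b i ^+ 2 * (\sum_l M i l) + b j ^+ 2 * (\sum_l M j l) + (- M i j) * (b i - b j) ^+ 2
  <= \sum_i \sum_j b i * b j * M i j.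
Proof.
move=> sM M0 R0 ij; rewrite dirichlet_form//.
have T0 x y : 0 <= - M x y * (b x - b y) ^+ 2.
  have [->|xy] := eqVneq x y; first by rewrite subrr expr0n/= mulr0.
  by rewrite mulr_ge0 ?sqr_ge0// oppr_ge0 M0.
apply: lerD.
  rewrite [leRHS](bigD1 i)//= lerD2l [leRHS](bigD1 j)//=; last by rewrite eq_sym.
  by rewrite lerDl sumr_ge0// => x _; rewrite mulr_ge0 ?sqr_ge0.
pose S x := \sum_y - M x y * (b x - b y) ^+ 2.
rewrite -[X in _ <= _ * X]/(\sum_x S x) (bigD1 i)//= (bigD1 j)//=; last by rewrite eq_sym.
rewrite {1}/S (bigD1 j)//=.
rewrite {1}/S [X in _ + (X + _)](bigD1 i)//=.
have -> : - M j i * (b j - b i) ^+ 2 = - M i j * (b i - b j) ^+ 2.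
  by rewrite sM -sqrrN opprB.
set m := - M i j * _.
set s1 := \sum_(_ < _ | _) _; set s2 := \sum_(_ < _ | _) _; set s3 := \sum_(_ < _ | _) _.
have p1 : 0 <= s1 by apply: sumr_ge0.
have p2 : 0 <= s2 by apply: sumr_ge0.
have p3 : 0 <= s3 by apply: sumr_ge0 => x _; apply: sumr_ge0.
lra.
Qed.

(** Change of coordinates in a quadratic form: a bilinear expression in the
    values becomes one in the increments. *)
Lemma bilinear_exchange n (c : 'I_n -> R) (B M : 'I_n -> 'I_n -> R) :
  \sum_l \sum_m c l * c m * (\sum_i \sum_j B i l * B j m * M i j) =
  \sum_i \sum_j (\sum_l c l * B i l) * (\sum_m c m * B j m) * M i j.
Proof.
transitivity (\sum_l \sum_m \sum_i \sum_j c l * c m * (B i l * B j m * M i j)).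
  apply: eq_bigr => l _; apply: eq_bigr => m _.
  by rewrite mulr_sumr; apply: eq_bigr => i _; rewrite mulr_sumr.
transitivity (\sum_i \sum_j \sum_l \sum_m c l * c m * (B i l * B j m * M i j)).
  rewrite pair_big/= [RHS]pair_big/=.
  under eq_bigr do rewrite pair_big/=.
  under [RHS]eq_bigr do rewrite pair_big/=.
  by rewrite exchange_big.
apply: eq_bigr => i _; apply: eq_bigr => j _.
rewrite -mulrA mulr_suml; apply: eq_bigr => l _.
rewrite mulr_suml mulr_sumr; apply: eq_bigr => m _; ring.
Qed.

End dirichlet.

(** If sum_l c_l X_(r_(l+1)) is written in the increments of X along r, with
    X_0 = 0, this is the coefficient of the i-th increment. *)
Definition tail_sum {R : realType} (n : nat) (c : nat -> R) (i : nat) : R :=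
  \sum_(l < n) c l * (i <= l)%:R.

Lemma tail_sumB {R : realType} (n : nat) (c : nat -> R) (i : nat) : (i < n)%N ->
  tail_sum n c i - tail_sum n c i.+1 = c i.
Proof.
move=> ilt; rewrite /tail_sum -sumrB (bigD1 (Ordinal ilt))//= leqnn ltnn mulr1 mulr0 subr0.
rewrite big1 ?addr0// => l /eqP li.
have -> : (i <= l)%N = (i < l)%N.
  by rewrite leq_eqVlt; case: eqP => // il; case: li; apply: val_inj.
by rewrite subrr.
Qed.

Section increments.
Context {R : realType}.
Variables (a : R) (r : nat -> R).
Hypotheses (a0 : 0 < a) (a1 : a <= 1) (r0 : r 0%N = 0)
  (rS : forall i, r i <= r i.+1).

Let K (t s : R) : R := (`|t| `^ a + `|s| `^ a - `|t - s| `^ a) / 2.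
Let d (i j : nat) : R := `|r i - r j| `^ a.
(** Covariance of the increments of fBm over [r_i, r_(i+1)] and [r_j,
    r_(j+1)]. *)
Definition incr_cov (i j : nat) : R := (d i.+1 j + d i j.+1 - d i j - d i.+1 j.+1) / 2.
Local Notation M := incr_cov.

Lemma r_homo i j : (i <= j)%N -> r i <= r j.
Proof. by move=> ij; apply: (nondecreasing_seqP r).1. Qed.

Lemma incr_covC i j : M i j = M j i.
Proof.
have dC x y : d x y = d y x by rewrite /d distrC.
rewrite /M (dC j.+1 i) (dC j i.+1) (dC j i) (dC j.+1 i.+1); congr (_ / _); ring.
Qed.

Lemma d_powR i j : (i <= j)%N -> d i j = (r j - r i) `^ a.
Proof. by move=> ij; rewrite /d distrC ger0_norm// subr_ge0 r_homo. Qed.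

Lemma incr_cov_lt i j : (i < j)%N -> M i j <= 0.
Proof.
move=> ij; have x0 : 0 <= r i.+1 - r i by rewrite subr_ge0.
have y0 : 0 <= r j - r i.+1 by rewrite subr_ge0 r_homo.
have z0 : 0 <= r j.+1 - r j by rewrite subr_ge0.
have := powR_4pt a0 a1 x0 y0 z0.
rewrite /M !d_powR//; [|lia|lia|lia].
have -> : r i.+1 - r i + (r j - r i.+1) + (r j.+1 - r j) = r j.+1 - r i by ring.
have -> : r i.+1 - r i + (r j - r i.+1) = r j - r i by ring.
have -> : r j - r i.+1 + (r j.+1 - r j) = r j.+1 - r i.+1 by ring.
by move=> h; rewrite ler_pdivrMr// mul0r -subr_ge0; move: h; rewrite -subr_ge0 => h; lra.
Qed.

Lemma incr_cov_le0 i j : i != j -> M i j <= 0.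
Proof.
by rewrite neq_ltn => /orP[|] ij; [|rewrite incr_covC]; exact: incr_cov_lt.
Qed.

Lemma sum_telescope (f : nat -> R) n : \sum_(j < n) (f j.+1 - f j) = f n - f 0%N.
Proof.
elim: n => [|n IH]; first by rewrite big_ord0 subrr.
by rewrite big_ord_recr/= IH; ring.
Qed.

(** The row sum telescopes to the covariance of the i-th increment with the
    value at r_n. *)
Lemma incr_cov_row n i : (i < n)%N ->
  (r i.+1 `^ a - r i `^ a) / 2 <= \sum_(j < n) M i j.
Proof.
move=> ilt.
have -> : \sum_(j < n) M i j =
    \sum_(j < n) (((d i j.+1 - d i.+1 j.+1) / 2) - ((d i j - d i.+1 j) / 2)).
  by apply: eq_bigr => j _; rewrite /M; field.
rewrite (sum_telescope (fun j => (d i j - d i.+1 j) / 2)).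
have dn x : d x 0%N = r x `^ a.
  by rewrite /d r0 subr0 ger0_norm// -r0 r_homo.
rewrite !dn; have : d i.+1 n <= d i n.
  rewrite !d_powR//; [|lia].
  have h := r_homo ilt.
  rewrite ge0_ler_powR ?(ltW a0)// ?nnegrE ?subr_ge0//.
    by rewrite r_homo//; lia.
  by have := rS i; lra.
by move=> h; lra.
Qed.

Lemma incr_cov_sum l m : \sum_(i < l) \sum_(j < m) M i j = K (r l) (r m).
Proof.
have E i : \sum_(j < m) M i j = K (r i.+1) (r m) - K (r i) (r m).
  have -> : \sum_(j < m) M i j = \sum_(j < m)
      ((K (r i.+1) (r j.+1) - K (r i) (r j.+1)) - (K (r i.+1) (r j) - K (r i) (r j))).
    by apply: eq_bigr => j _; rewrite /M /K /d; field.
  rewrite (sum_telescope (fun j => K (r i.+1) (r j) - K (r i) (r j))).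
  rewrite r0 /K !subr0 normr0; ring.
under eq_bigr do rewrite E.
rewrite (sum_telescope (fun i => K (r i) (r m))) r0 /K.
rewrite normr0 powR0 ?gt_eqF// sub0r normrN; ring.
Qed.

(** The Dirichlet form of the increments, restricted to two of them. The point
    r_0 = 0 makes the values sums of increments. *)
Lemma fcov_form_ge n (c : nat -> R) (i j : nat) : (i < n)%N -> (j < n)%N -> i != j ->
  tail_sum n c i ^+ 2 * ((r i.+1 `^ a - r i `^ a) / 2) +
  tail_sum n c j ^+ 2 * ((r j.+1 `^ a - r j `^ a) / 2) +
  (- M i j) * (tail_sum n c i - tail_sum n c j) ^+ 2 <=
  \sum_(l < n) \sum_(m < n) c l * c m * K (r l.+1) (r m.+1).
Proof.
move=> ilt jlt ij; pose b := tail_sum n c; rewrite -/(b i) -/(b j).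
have -> : \sum_(l < n) \sum_(m < n) c l * c m * K (r l.+1) (r m.+1) =
    \sum_(x < n) \sum_(y < n) b x * b y * M x y.
  rewrite -(bilinear_exchange (fun l : 'I_n => c l) (fun (i l : 'I_n) => (i <= l)%:R) (fun x y : 'I_n => M x y)).
  apply: eq_bigr => l _; apply: eq_bigr => m _; congr (_ * _).
  rewrite -incr_cov_sum (big_ord_widen _ (fun x => \sum_(j0 < m.+1) M x j0) (ltn_ord l)) big_mkcond/=.
  apply: eq_bigr => x _; rewrite ltnS.
  case: (x <= l)%N; last by rewrite big1// => y _; rewrite !mul0r.
  rewrite (big_ord_widen _ (fun y => M x y) (ltn_ord m)) big_mkcond/=.
  apply: eq_bigr => y _; rewrite ltnS mul1r.
  by case: (y <= m)%N; rewrite ?mul1r ?mul0r.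
have R0 (x : 'I_n) : 0 <= \sum_(y < n) M x y.
  apply: le_trans (incr_cov_row (ltn_ord x)).
  rewrite divr_ge0// subr_ge0 ge0_ler_powR ?(ltW a0)// ?nnegrE -?r0 ?r_homo//.
have := @dirichlet_ge R n (fun x y => M x y) (fun x => b x) (Ordinal ilt) (Ordinal jlt).
move=> /(_ (fun i j => incr_covC i j)) /(_ (fun i j ij => incr_cov_le0 ij)) /(_ R0 ij).
apply: le_trans; rewrite lerD2r lerD// ler_wpM2l ?sqr_ge0//.
  exact: (incr_cov_row ilt).
exact: (incr_cov_row jlt).
Qed.

End increments.

Lemma one_powR {R : realType} (x : R) : 1 `^ x = 1 :> R.
Proof. by rewrite powR1. Qed.

(** * The covariance form at pairs of times in separated blocks *)

Section pairs.
Context {R : realType}.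
Variables (a tau : R) (k : nat) (p q A B : nat -> R).
Hypotheses (a0 : 0 < a) (a1 : a <= 1) (tau0 : 0 < tau).
Hypothesis tp : forall j, tau * (2 * j%:R + 1) <= p j.
Hypothesis pq : forall j, p j <= q j.
Hypothesis qt : forall j, q j <= tau * (2 * j%:R + 2).

(** The nondecreasing sequence 0, p_0, q_0, p_1, q_1, ..., with A_j and B_j
    the coefficients of the values at p_j and q_j. The form runs over 2 k + 1
    points: p_k, with coefficient 0, closes the gap after the last pair. *)
Definition pair_seq (i : nat) : R :=
  if i is i'.+1 then (if odd i' then q i'./2 else p i'./2) else 0.

Definition pair_coef (i : nat) : R :=
  if (i < k.*2)%N then (if odd i then B i./2 else A i./2) else 0.

Local Notation r := pair_seq.
Local Notation n := (k.*2.+1).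

Definition pair_form : R :=
  \sum_(l < n) \sum_(m < n) pair_coef l * pair_coef m *
    ((`|r l.+1| `^ a + `|r m.+1| `^ a - `|r l.+1 - r m.+1| `^ a) / 2).

(** A quarter of a lower bound, in units of tau^a, for the growth of r^a
    across a gap of length tau that ends before tau (2 k + 2). *)
Definition gap_const : R := (1 - (1 - (2 * k%:R + 2)^-1) `^ a) / 4.
(** For a < 1 the increment over [p_j, q_j] is strictly negatively correlated
    with the gap that follows it, and strict concavity at two equal lengths
    measures by how much. For a = 1 the increments are uncorrelated and the
    row sums alone suffice. *)
Definition incr_const : R := if a == 1 then 1 / 4 else (2 - 2 `^ a) / 2.
Definition form_const : R := Num.min gap_const incr_const.

Lemma gap_const_gt0 : 0 < gap_const.
Proof.
rewrite /gap_const divr_gt0// subr_gt0 -[ltRHS](one_powR a).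
have h : 0 < 2 * k%:R + 2 :> R by rewrite ltr_wpDl// mulr_ge0.
rewrite gt0_ltr_powR// ?nnegrE//.
  by rewrite subr_ge0 invf_le1//; have : 0 <= k%:R :> R by []; lra.
Qed.

Lemma incr_const_gt0 : 0 < incr_const.
Proof.
rewrite /incr_const; case: eqVneq => [_|an1]; first by rewrite divr_gt0.
rewrite divr_gt0// subr_gt0 -[ltRHS]powRr1// -subr_gt0.
have alt : a < 1 by rewrite lt_neqAle an1.
rewrite subr_gt0 /powR pnatr_eq0/= ltr_expR ltr_pM2r// ln_gt0//.
by rewrite ltr1n.
Qed.

Lemma form_const_gt0 : 0 < form_const.
Proof. by rewrite /form_const lt_min gap_const_gt0 incr_const_gt0. Qed.

Lemma pair_seq_odd j : r (j.*2.+1) = p j.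
Proof. by rewrite /= odd_double doubleK. Qed.

Lemma pair_seq_even j : r (j.*2.+2) = q j.
Proof. by rewrite /= odd_double/= uphalf_double. Qed.

Lemma pair_seqS i : r i <= r i.+1.
Proof.
have [j [->|->]] : exists j, i = j.*2 \/ i = j.*2.+1.
- exists i./2; have := odd_double_half i; case: (odd i) => <-; [right|left];
    by rewrite /= ?add1n ?add0n ?doubleK ?uphalf_double.
- rewrite pair_seq_odd; case: j => [|j].
    rewrite double0/=; have := tp 0; rewrite mulr0 add0r mulr1; apply: le_trans.
    exact: ltW.
  rewrite doubleS pair_seq_even (le_trans (qt j))// (le_trans _ (tp _))//.
  by rewrite ler_pM2l// -natr1; lra.
- by rewrite pair_seq_odd pair_seq_even.
Qed.

Lemma pair_gap_ge j : (j <= k)%N ->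
  tau `^ a * (1 - (1 - (2 * k%:R + 2)^-1) `^ a) <= r (j.*2.+1) `^ a - r (j.*2) `^ a.
Proof.
move=> jk; rewrite pair_seq_odd.
have N0 : 0 < 2 * k%:R + 2 :> R by rewrite ltr_wpDl// mulr_ge0.
have Nj : tau * (2 * j%:R + 2) <= tau * (2 * k%:R + 2).
  by rewrite ler_pM2l// lerD2r ler_pM2l// ler_nat.
have pN : p j <= tau * (2 * k%:R + 2).
  exact: le_trans (pq j) (le_trans (qt j) Nj).
have j0 : 0 <= j%:R :> R by [].
have ptau : tau <= p j.
  apply: le_trans (tp j); rewrite -[leLHS]mulr1 ler_pM2l//; lra.
have rp : r j.*2 <= p j - tau.
  case: j Nj pN j0 ptau jk => [|j] Nj pN j0 ptau jk; first by rewrite double0 subr_ge0.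
  rewrite doubleS pair_seq_even lerBrDr (le_trans _ (tp _))//.
  have := qt j; rewrite -natr1; lra.
have r0 : 0 <= r j.*2.
  case: j {rp ptau j0 pN Nj jk} => [|j]; first by rewrite double0.
  rewrite doubleS pair_seq_even (le_trans _ (pq j))// (le_trans _ (tp j))//.
  by rewrite mulr_ge0 ?(ltW tau0)// addr_ge0// mulr_ge0.
set u := 1 - (2 * k%:R + 2)^-1.
have u0 : 0 <= u.
  by rewrite /u subr_ge0 invf_le1//; have : 0 <= k%:R :> R by []; lra.
have p0 : 0 <= p j by apply: le_trans ptau; exact: ltW.
have ru : r j.*2 <= p j * u.
  apply: le_trans rp _; rewrite /u mulrBr mulr1 lerD2l lerN2.
  by rewrite ler_pdivrMr// mulrC.
have h : r j.*2 `^ a <= p j `^ a * u `^ a.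
  by rewrite -powRM// ge0_ler_powR ?(ltW a0)// ?nnegrE// mulr_ge0.
apply: (@le_trans _ _ (p j `^ a * (1 - u `^ a))); last by rewrite mulrBr mulr1 lerD2l lerN2.
rewrite ler_wpM2r//.
  rewrite subr_ge0 -[leRHS](one_powR a) ge0_ler_powR ?(ltW a0)// ?nnegrE//.
  by rewrite /u lerBlDr lerDl invr_ge0 ltW.
by rewrite ge0_ler_powR ?(ltW a0)// ?nnegrE// ltW.
Qed.

Lemma pair_seq_powR_ge0 (i : nat) : 0 <= r i.+1 `^ a - r i `^ a.
Proof.
have h := pair_seqS.
have z j : 0 <= r j by rewrite -[0]/(r 0%N); exact: r_homo.
by rewrite subr_ge0 ge0_ler_powR ?(ltW a0)// ?nnegrE.
Qed.

(** The increments over the gaps before and after the j-th pair have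
    coefficients differing by A_j + B_j, and their row sums are at least of
    order tau^a, because the gaps are at least tau long. *)
Lemma pair_form_gap j : (j < k)%N -> form_const * (tau `^ a * (A j + B j) ^+ 2) <= pair_form.
Proof.
move=> jk.
have l1 : (j.*2 < n)%N by lia.
have l2 : (j.*2.+2 < n)%N by lia.
have l3 : (j.*2.+1 < n)%N by lia.
have l12 : j.*2 != j.*2.+2 by rewrite -addn2 -[X in X != _]addn0 eqn_add2l.
have := fcov_form_ge a0 a1 (erefl : r 0%N = 0) pair_seqS pair_coef l1 l2 l12.
rewrite -/pair_form.
have cA : pair_coef j.*2 = A j by rewrite /pair_coef odd_double doubleK; case: ifP => //; lia.
have cB : pair_coef j.*2.+1 = B j by rewrite /pair_coef /= odd_double/= uphalf_double; case: ifP => //; lia.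
(* the coefficients at p_j and q_j are differences of consecutive tail
   sums *)
have b1 := tail_sumB pair_coef l1; have b2 := tail_sumB pair_coef l3.
set x := tail_sum _ _ _ in b1 *; set y := tail_sum _ _ j.*2.+1 in b1 b2 *.
set z := tail_sum _ _ j.*2.+2 in b2 *.
have -> : A j + B j = x - z by rewrite -cA -cB -b1 -b2; ring.
have g1 := pair_gap_ge (ltnW jk); have := pair_gap_ge jk; rewrite doubleS => g2.
have M0 := incr_cov_le0 a0 a1 pair_seqS l12.
apply: le_trans.
apply: (@le_trans _ _ (gap_const * (tau `^ a * (x - z) ^+ 2))).
  by rewrite ler_wpM2r ?ge_min ?lexx// mulr_ge0 ?sqr_ge0 ?powR_ge0.
apply: (@le_trans _ _ (x ^+ 2 * (tau `^ a * (4 * gap_const) / 2) + z ^+ 2 * (tau `^ a * (4 * gap_const) / 2))).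
  (* x^2 + z^2 >= (x - z)^2 / 2 *)
  have h : 0 <= gap_const * tau `^ a * (x + z) ^+ 2.
    apply: mulr_ge0 (sqr_ge0 _); apply: mulr_ge0 (powR_ge0 _ _).
    exact: ltW gap_const_gt0.
  rewrite -subr_ge0; apply: le_trans h _.
  by rewrite le_eqVlt; apply/orP; left; apply/eqP; field.
have k4 : 4 * gap_const = 1 - (1 - (2 * k%:R + 2)^-1) `^ a by rewrite /gap_const; field.
rewrite k4 -[leLHS]addr0; apply: lerD.
  by apply: lerD; rewrite ler_wpM2l ?sqr_ge0// ler_pM2r.
by rewrite mulr_ge0 ?sqr_ge0// oppr_ge0.
Qed.

(** The increment over [p_j, q_j] has a coefficient that differs by B_j from
    that of the following gap, which is at least as long as [p_j, q_j]. *)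
Lemma pair_form_incr j : (j < k)%N -> form_const * ((q j - p j) `^ a * B j ^+ 2) <= pair_form.
Proof.
move=> jk.
have l1 : (j.*2.+1 < n)%N by lia.
have l2 : (j.*2.+2 < n)%N by lia.
have l12 : j.*2.+1 != j.*2.+2 by rewrite neq_ltn ltnSn.
have := fcov_form_ge a0 a1 (erefl : r 0%N = 0) pair_seqS pair_coef l1 l2 l12.
rewrite -/pair_form.
have cB : pair_coef j.*2.+1 = B j by rewrite /pair_coef /= odd_double/= uphalf_double; case: ifP => //; lia.
have b2 := tail_sumB pair_coef l1.
set y := tail_sum _ _ j.*2.+1 in b2 *; set z := tail_sum _ _ j.*2.+2 in b2 *.
have -> : B j = y - z by rewrite b2.
rewrite -/y -/z.
apply: le_trans.
apply: (@le_trans _ _ (incr_const * ((q j - p j) `^ a * (y - z) ^+ 2))).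
  by rewrite ler_wpM2r ?ge_min ?lexx ?orbT// mulr_ge0 ?sqr_ge0 ?powR_ge0.
have u0 : 0 <= q j - p j by rewrite subr_ge0.
have ul : q j - p j <= p j.+1 - q j.
  have := qt j; have := tp j; have := tp j.+1; rewrite -natr1; lra.
have M0 := incr_cov_le0 a0 a1 pair_seqS l12.
have h1 : 0 <= - incr_cov a r j.*2.+1 j.*2.+2 * (y - z) ^+ 2.
  by rewrite mulr_ge0 ?sqr_ge0// oppr_ge0.
have h2 := pair_seq_powR_ge0 j.*2.+1; have h3 := pair_seq_powR_ge0 j.*2.+2.
rewrite /incr_const; case: eqVneq => [e1|an1].
  move: h2 h3.
  have rr i : 0 <= r i by rewrite -[0]/(r 0%N); apply: r_homo => //; exact: pair_seqS.
  rewrite e1 !powRr1// => h2 h3.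
  have := pair_seq_odd j.+1; rewrite doubleS => ->.
  rewrite pair_seq_odd pair_seq_even.
  (* for a = 1 again y^2 + z^2 >= (y - z)^2 / 2, with the two lengths
     bounded below by q_j - p_j *)
  have h4 : 0 <= (q j - p j) * (y + z) ^+ 2 by rewrite mulr_ge0 ?sqr_ge0.
  have h5 : z ^+ 2 * ((q j - p j) / 2) <= z ^+ 2 * ((p j.+1 - q j) / 2).
    by rewrite ler_wpM2l ?sqr_ge0// ler_pM2r.
  rewrite e1 in h1; rewrite -[leLHS]addr0; apply: lerD => //.
  apply: le_trans (lerD (lexx _) h5); rewrite -subr_ge0.
  apply: le_trans (_ : 0 <= (q j - p j) * (y + z) ^+ 2 / 4) _; first by rewrite divr_ge0.
  by rewrite le_eqVlt; apply/orP; left; apply/eqP; field.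
rewrite -[leLHS]add0r; apply: lerD.
  by rewrite addr_ge0// mulr_ge0 ?sqr_ge0// divr_ge0.
rewrite mulrA ler_wpM2r ?sqr_ge0//.
rewrite /incr_cov !d_powR//; try exact: pair_seqS.
have := pair_seq_odd j.+1; rewrite doubleS => ->.
rewrite pair_seq_odd pair_seq_even subrr powR0 ?gt_eqF//.
have l0 : 0 <= p j.+1 - q j - (q j - p j) by rewrite subr_ge0.
have := powR_4pt a0 a1 u0 u0 l0.
have -> : q j - p j + (q j - p j) + (p j.+1 - q j - (q j - p j)) = p j.+1 - p j by ring.
have -> : q j - p j + (p j.+1 - q j - (q j - p j)) = p j.+1 - q j by ring.
have -> : q j - p j + (q j - p j) = 2 * (q j - p j) by ring.
rewrite powRM//.
by lra.
lia.
Qed.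

End pairs.

(** * Two-point upper bound for one coordinate *)

Section extension.
Context {R : realType} {k : nat}.

Definition ext (z : 'I_k -> R) (j : nat) : R := oapp z 0 (insub j).

Lemma extE z (j : 'I_k) : ext z j = z j.
Proof. by rewrite /ext valK. Qed.

Lemma extD z z' x j : ext (fun i => z i + x * z' i) j = ext z j + x * ext z' j.
Proof. by rewrite /ext; case: insub => [i|]//=; rewrite mulr0 addr0. Qed.

Lemma big_double (F : nat -> R) n :
  \sum_(l < n.*2.+1) F l = \sum_(j < n) (F j.*2 + F j.*2.+1) + F n.*2.
Proof.
elim: n => [|n IH]; first by rewrite big_ord0 add0r big_ord_recl big_ord0 addr0.
by rewrite doubleS 2!big_ord_recr/= IH big_ord_recr/= !addrA.
Qed.

End extension.

Section quadratic.
Context {R : realType}.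

(** A quadratic form along a line, with the linear coefficient written out as
    twice something, as gauss_kernel_le asks. *)
Lemma quad_shift n (K : nat -> nat -> R) (c c' : nat -> R) x :
  \sum_(l < n) \sum_(m < n) (c l + x * c' l) * (c m + x * c' m) * K l m =
  (\sum_(l < n) \sum_(m < n) c' l * c' m * K l m) * x ^+ 2 +
  2 * (2^-1 * \sum_(l < n) \sum_(m < n) (c l * c' m + c' l * c m) * K l m) * x +
  \sum_(l < n) \sum_(m < n) c l * c m * K l m.
Proof.
rewrite mulrA mulfV// mul1r !mulr_suml -!big_split/=; apply: eq_bigr => l _.
rewrite !mulr_suml -!big_split/=; apply: eq_bigr => m _; ring.
Qed.

Lemma quad_support2 n (K : nat -> nat -> R) (c : nat -> R) i j :
  (i < n)%N -> (j < n)%N -> i != j -> (forall l, l != i -> l != j -> c l = 0) ->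
  \sum_(l < n) \sum_(m < n) c l * c m * K l m =
  c i ^+ 2 * K i i + c j ^+ 2 * K j j + c i * c j * (K i j + K j i).
Proof.
move=> il jl ij c0.
have E (F : nat -> R) : (forall l, l != i -> l != j -> F l = 0) ->
    \sum_(l < n) F l = F i + F j.
  move=> F0; rewrite (bigD1 (Ordinal il))//= (bigD1 (Ordinal jl))//=; last first.
    by rewrite -val_eqE/= eq_sym.
  rewrite big1 ?addr0// => l /andP[li lj]; apply: F0.
    by rewrite -val_eqE in li.
  by rewrite -val_eqE in lj.
rewrite (E (fun l => \sum_(m < n) c l * c m * K l m)); last first.
  by move=> l li lj; rewrite big1// => m _; rewrite (c0 l)// !mul0r.
rewrite (E (fun m => c i * c m * K i m)) ?(E (fun m => c j * c m * K j m)); first ring.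
  by move=> l li lj; rewrite (c0 l)// mulr0 mul0r.
by move=> l li lj; rewrite (c0 l)// mulr0 mul0r.
Qed.

End quadratic.

Section component.
Context {disp : measure_display} {T : measurableType disp} {R : realType}.
Variables (P : probability T R) (H : R) (X : R -> T -> R).
Hypothesis fX : fbm1 P H X.
Local Notation a := (2 * H).
Hypotheses (a0 : 0 < a) (a1 : a <= 1).
Variables (k : nat) (tau : R).
Hypotheses (k0 : (0 < k)%N) (tau0 : 0 < tau).

(** Consecutive blocks of length tau are separated by gaps of length tau, and
    the first block starts at tau. *)
Definition block_times (t : nat -> R) := forall j : nat,
  tau * (2 * j%:R + 1) <= t j <= tau * (2 * j%:R + 2).

Lemma block_times_ge0 t j : block_times t -> 0 <= t j.
Proof.
move=> /(_ j)/andP[+ _]; apply: le_trans.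
by rewrite mulr_ge0 ?(ltW tau0)// addr_ge0// mulr_ge0.
Qed.

Section upper.
Variables (t s : nat -> R).
Hypotheses (bt : block_times t) (bs : block_times s).
Let p j := Num.min (t j) (s j).
Let q j := Num.max (t j) (s j).
Let u (j : nat) : R := `|s j - t j|.

Let tp j : tau * (2 * j%:R + 1) <= p j.
Proof. by rewrite /p le_min; have /andP[-> _] := bt j; have /andP[-> _] := bs j. Qed.

Let pq j : p j <= q j.
Proof. by rewrite /p /q le_max !ge_min lexx. Qed.

Let qt j : q j <= tau * (2 * j%:R + 2).
Proof. by rewrite /q ge_max; have /andP[_ ->] := bt j; have /andP[_ ->] := bs j. Qed.

Let u_tau j : u j <= tau.
Proof.
have := bt j; have := bs j; rewrite /u ler_norml => /andP[h1 h2] /andP[h3 h4].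
by apply/andP; split; lra.
Qed.

Let qpu j : q j - p j = u j.
Proof.
rewrite /q /p /u; case: (leP (t j) (s j)) => h.
  by rewrite ger0_norm// subr_ge0.
by rewrite ltr0_norm ?subr_lt0// opprB.
Qed.

Let A (z : bool * 'I_k -> R) (j : nat) : R :=
  let xi := ext (fun i => z (false, i)) j in let eta := ext (fun i => z (true, i)) j in
  if t j <= s j then eta - xi else xi.
Let B (z : bool * 'I_k -> R) (j : nat) : R :=
  let xi := ext (fun i => z (false, i)) j in let eta := ext (fun i => z (true, i)) j in
  if t j <= s j then xi else eta - xi.

(** The coordinates for pairs of times: the value at t_j and the increment
    from t_j to s_j. In these coordinates only the increments see the
    displacement y - x. *)
Definition incr_family (i : bool * 'I_k) (w : T) : R :=
  if i.1 then X (t i.2) w else X (s i.2) w - X (t i.2) w.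

(** The covariance form of incr_family. The pairs are reordered as p_j <= q_j,
    and A, B translate the coefficients accordingly. *)
Definition incr_form (z : bool * 'I_k -> R) : R := pair_form a k p q (A z) (B z).

Lemma sum_pair_family (F : bool * 'I_k -> R) :
  \sum_i F i = \sum_(j < k) (F (true, j) + F (false, j)).
Proof.
transitivity (\sum_b \sum_(j < k) F (b, j)).
  by rewrite pair_big/=; apply: eq_bigr => -[].
rewrite exchange_big/=; by apply: eq_bigr => j _; rewrite big_bool.
Qed.

Lemma incr_family_sum z w :
  \sum_i z i * incr_family i w =
  \sum_(l < k.*2.+1) pair_coef k (A z) (B z) l * X (pair_seq p q l.+1) w.
Proof.
rewrite (big_double (fun l => pair_coef k (A z) (B z) l * X (pair_seq p q l.+1) w)).
have c0 : pair_coef k (A z) (B z) k.*2 = 0 by rewrite /pair_coef ltnn.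
rewrite c0 mul0r addr0 sum_pair_family.
apply: eq_bigr => j _; rewrite pair_seq_odd pair_seq_even /pair_coef.
rewrite odd_double/= odd_double/= doubleK uphalf_double.
have -> : (j.*2 < k.*2)%N by rewrite ltn_double.
have -> : (j.*2.+1 < k.*2)%N by have := ltn_ord j; lia.
rewrite /A /B !extE /incr_family/= /p /q; case: leP => h; ring.
Qed.

Lemma pair_seq_ge0 i : 0 <= pair_seq p q i.
Proof. exact: (r_homo (pair_seqS tau0 tp pq qt) (leq0n i)). Qed.

Lemma incr_family_cos (e : R) z c :
  Ex P (fun w => cos (\sum_i z i * (e * incr_family i w) + c)) =
  expR (- (e ^+ 2 * incr_form z) / 2) * cos c.
Proof.
have := @fbm1_cos _ _ _ P H X fX 'I_k.*2.+1 (fun l => e * pair_coef k (A z) (B z) l)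
  (fun l => pair_seq p q l.+1) c (fun l => pair_seq_ge0 _).
rewrite (_ : \sum_i \sum_j _ = e ^+ 2 * incr_form z).
  move=> <-; apply: eq_Ex => w; congr (cos (_ + _)).
  rewrite (eq_bigr (fun i => e * (z i * incr_family i w))); last by move=> i _; ring.
  rewrite -mulr_sumr incr_family_sum mulr_sumr; apply: eq_bigr => l _; ring.
rewrite /incr_form /pair_form mulr_sumr; apply: eq_bigr => l _.
rewrite mulr_sumr; apply: eq_bigr => m _; rewrite /fcov; ring.
Qed.

Lemma pair_coef_shift z z' x l :
  pair_coef k (A (fun i => z i + x * z' i)) (B (fun i => z i + x * z' i)) l =
  pair_coef k (A z) (B z) l + x * pair_coef k (A z') (B z') l.
Proof.
rewrite /pair_coef; case: ifP => _; last by rewrite mulr0 addr0.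
by rewrite /A /B !extD; case: ifP => _; case: ifP => _; ring.
Qed.

(** The coefficient of x^2 is the variance u^a of the increment itself. *)
Lemma incr_form_shift (i0 : 'I_k) z : exists b, forall x : R,
  incr_form (fun i => z i + x * (i == (false, i0))%:R) =
  u i0 `^ a * x ^+ 2 + 2 * b * x + incr_form z.
Proof.
pose d (i : bool * 'I_k) : R := (i == (false, i0))%:R.
pose K (l m : nat) : R := fcov H (pair_seq p q l.+1) (pair_seq p q m.+1).
eexists => x; rewrite [LHS](_ : _ = \sum_(l < k.*2.+1) \sum_(m < k.*2.+1)
   (pair_coef k (A z) (B z) l + x * pair_coef k (A d) (B d) l) *
   (pair_coef k (A z) (B z) m + x * pair_coef k (A d) (B d) m) * K l m); last first.
  apply: eq_bigr => l _; apply: eq_bigr => m _.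
  by rewrite !(pair_coef_shift z d).
rewrite (quad_shift _ K); congr (_ * _ + _ + _).
have il := ltn_ord i0.
have l1 : (i0.*2 < k.*2.+1)%N by lia.
have l2 : (i0.*2.+1 < k.*2.+1)%N by lia.
have l12 : i0.*2 != i0.*2.+1 by rewrite neq_ltn ltnSn.
have e1 j : ext (fun i => d (true, i)) j = 0 by rewrite /ext; case: insub.
have e2 (j : nat) : ext (fun i => d (false, i)) j = (j == i0)%:R.
  rewrite /ext; case: insubP => [i ilt ij|]/=.
    by rewrite /d -ij; congr (_%:R); apply/eqP/eqP => [[->]//|/val_inj ->].
  by rewrite -leqNgt => kj; case: eqP => // ji; move: il; rewrite -ji ltnNge kj.
have c0 l : l != i0.*2 -> l != i0.*2.+1 -> pair_coef k (A d) (B d) l = 0.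
  move=> n1 n2; rewrite /pair_coef; case: ifP => // _.
  rewrite /A /B !e1 !e2.
  have -> : (l./2 == i0) = false.
    apply/negP => /eqP e; have := odd_double_half l; rewrite e.
    by case: (odd l) => /esym h; [move: n2|move: n1]; rewrite h ?add1n ?add0n eqxx.
  by rewrite subrr; do 2 case: ifP.
rewrite (quad_support2 K l1 l2 l12 c0) /K pair_seq_odd pair_seq_even.
rewrite /pair_coef odd_double/= odd_double/= doubleK uphalf_double.
have -> : (i0.*2 < k.*2)%N by rewrite ltn_double.
have -> : (i0.*2.+1 < k.*2)%N by lia.
rewrite /A /B !e1 !e2 eqxx -qpu /fcov !subrr normr0 powR0 ?gt_eqF//.
have -> : `|q i0 - p i0| = q i0 - p i0 by rewrite ger0_norm// subr_ge0.
rewrite distrC; have -> : `|q i0 - p i0| = q i0 - p i0 by rewrite ger0_norm// subr_ge0.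
by case: ifP => _; rewrite !mulr1n; field.
Qed.

Definition cupper : R := form_const a k / (8 * k%:R).

(** Non-degeneracy of each coordinate at its own scale: tau^a for the values,
    u_j^a for the increments. The 2 k bounds on single coordinates are
    averaged. *)
Lemma incr_form_ge z :
  \sum_(i : bool * 'I_k) cupper * (if i.1 then tau `^ a else u i.2 `^ a) * z i ^+ 2 <= incr_form z.
Proof.
set Q := incr_form z.
have kp := form_const_gt0 k a0 a1.
have h1 (j : 'I_k) : form_const a k * (tau `^ a * z (true, j) ^+ 2) <= Q.
  have := pair_form_gap (A z) (B z) a0 a1 tau0 tp pq qt (ltn_ord j).
  rewrite (_ : A z j + B z j = z (true, j))//.
  by rewrite /A /B !extE; case: ifP => _; ring.
have h2 (j : 'I_k) : form_const a k * (u j `^ a * z (false, j) ^+ 2) <= 4 * Q.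
  have := pair_form_incr (A z) (B z) a0 a1 tau0 tp pq qt (ltn_ord j).
  rewrite qpu -/Q.
  have ut : u j `^ a <= tau `^ a.
    by apply: ge0_ler_powR; rewrite ?nnegrE ?(ltW a0) ?(ltW tau0) ?u_tau ?normr_ge0.
  have h1j := h1 j.
  have Q0 : 0 <= Q.
    apply: (le_trans _ h1j); apply: mulr_ge0; first exact: ltW kp.
    by apply: mulr_ge0; [exact: powR_ge0|exact: sqr_ge0].
  rewrite /B !extE; case: ifP => _ h; first by apply: (le_trans (h : _ <= Q)); lra.
  apply: (@le_trans _ _ (form_const a k * (2 * (u j `^ a * (z (true, j) - z (false, j)) ^+ 2) + 2 * (u j `^ a * z (true, j) ^+ 2)))).
    rewrite ler_pM2l// -!(mulrCA (u j `^ a)) -mulrDr ler_wpM2l ?powR_ge0//.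
    have : 0 <= (2 * z (true, j) - z (false, j)) ^+ 2 by exact: sqr_ge0.
    by rewrite -subr_ge0 => hh; rewrite -subr_ge0; nra.
  have h3 : form_const a k * (u j `^ a * z (true, j) ^+ 2) <= Q.
    by apply: le_trans h1j; rewrite ler_pM2l// ler_wpM2r ?sqr_ge0.
  have {}h : form_const a k * (u j `^ a * (z (true, j) - z (false, j)) ^+ 2) <= Q := h.
  lra.
rewrite sum_pair_family/=.
have kR : 0 < k%:R :> R by rewrite ltr0n.
apply: (@le_trans _ _ (\sum_(j < k) k%:R^-1 * Q)); last first.
  by rewrite sumr_const card_ord -[_ *+ k]mulr_natl mulrA mulfV ?mul1r// gt_eqF.
apply: ler_sum => j _.
have E1 c y : cupper * c * y = (8 * k%:R)^-1 * (form_const a k * (c * y)).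
  by rewrite /cupper; ring.
rewrite !E1 -mulrDr invfM mulrAC [leRHS]mulrC ler_pM2r ?invr_gt0//.
rewrite mulrC ler_pdivrMr//.
have := h1 j; have := h2 j.
have Q0 : 0 <= Q.
  apply: (le_trans _ (h1 j)); apply: mulr_ge0; first exact: ltW kp.
  by apply: mulr_ge0; [exact: powR_ge0|exact: sqr_ge0].
lra.
Qed.

(** Upper bound for k pairs of times. The product is the price of being within
    eps of x at all the t_j and s_j; the exponential is the price of the
    displacement y - x over the time u of the pair i0, any of the k pairs. *)
Lemma comp_upper (x y eps : R) (i0 : 'I_k) : 0 < eps ->
  Ex P (fun w => expR (- (\sum_(j < k) ((X (t j) w - x) ^+ 2 + (X (s j) w - y) ^+ 2)) / (2 * eps ^+ 2))) <=
  expR (- ((y - x) ^+ 2 / (2 * (8 * eps ^+ 2 + u i0 `^ a)))) *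
  \prod_(j < k) ((Num.sqrt (1 + cupper * tau `^ a / (8 * eps ^+ 2)))^-1 *
                 (Num.sqrt (1 + cupper * u j `^ a / (8 * eps ^+ 2)))^-1).
Proof.
move=> e0.
(* 8 = 2 * 4: a factor 2 because the increment i0 is used twice, and a
   factor 4 from the passage to the increments below *)
pose l := (8 * eps ^+ 2)^-1.
have l0 : 0 < l by rewrite invr_gt0 mulr_gt0// exprn_gt0.
pose e := Num.sqrt l.
have e2 : e ^+ 2 = l by rewrite sqr_sqrtr// ltW.
have mX (r : R) : 0 <= r -> measurable_fun setT (X r).
  by move=> r0; exact: (fbm1_measurable fX r0).
have t0 j := block_times_ge0 j bt; have s0 j := block_times_ge0 j bs.
have mY i : measurable_fun setT (fun w => e * incr_family i w).
  apply: measurable_funM => //; rewrite /incr_family; case: i => -[] j /=; first exact: mX.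
  by apply: measurable_funB; exact: mX.
pose w i := l * (cupper * (if (i : bool * 'I_k).1 then tau `^ a else u i.2 `^ a)).
have kp := form_const_gt0 k a0 a1.
have cu0 : 0 <= cupper by rewrite divr_ge0 ?(ltW kp)// mulr_ge0.
have w0 i : 0 <= w i.
  by rewrite mulr_ge0 ?(ltW l0)// mulr_ge0//; case: ifP => _; exact: powR_ge0.
have qs z : exists b, forall v : R,
     e ^+ 2 * incr_form (fun i => z i + v * (i == (false, i0))%:R) =
     (l * u i0 `^ a) * v ^+ 2 + 2 * b * v + e ^+ 2 * incr_form z.
  have [b hb] := incr_form_shift i0 z; exists (l * b) => v.
  by rewrite hb e2; ring.
have qw z : \sum_i w i * z i ^+ 2 <= e ^+ 2 * incr_form z.
  rewrite e2 (eq_bigr (fun i : bool * 'I_k => l * (cupper * (if i.1 then tau `^ a else u i.2 `^ a) * z i ^+ 2))).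
    by rewrite -mulr_sumr ler_pM2l// incr_form_ge.
  by move=> i _; rewrite /w; ring.
have v0 : 0 <= l * u i0 `^ a by rewrite mulr_ge0 ?powR_ge0// ltW.
pose yy (i : bool * 'I_k) := e * (if i.1 then x else y - x).
have := @gauss_kernel_le _ _ _ P _ (fun i w => e * incr_family i w)
  (fun z => e ^+ 2 * incr_form z) mY (incr_family_cos e) (false, i0) (l * u i0 `^ a)
  (e * (y - x)) w yy v0 w0 qs qw.
have -> : (e * (y - x)) ^+ 2 / (2 * (1 + l * u i0 `^ a)) =
    (y - x) ^+ 2 / (2 * (8 * eps ^+ 2 + u i0 `^ a)).
  rewrite exprMn e2 /l; field.
  have h : 0 < 8 * eps ^+ 2 + u i0 `^ a.
    by rewrite ltr_wpDr ?powR_ge0// mulr_gt0// exprn_gt0.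
  by rewrite !gt_eqF// mulr_gt0// exprn_gt0.
have -> : \prod_i (Num.sqrt (1 + w i))^-1 = \prod_(j < k) ((Num.sqrt (1 + cupper * tau `^ a / (8 * eps ^+ 2)))^-1 *
                 (Num.sqrt (1 + cupper * u j `^ a / (8 * eps ^+ 2)))^-1).
  transitivity (\prod_b \prod_(j < k) (Num.sqrt (1 + w (b, j)))^-1).
    by rewrite pair_big/=; apply: eq_bigr => -[].
  rewrite exchange_big/=.
  apply: eq_bigr => j _; rewrite big_bool/= /w/= /l.
  by congr ((Num.sqrt (1 + _))^-1 * (Num.sqrt (1 + _))^-1); rewrite mulrC.
apply: le_trans; apply: le_Ex.
- apply: (@bmfun_exp _ _ _ _ 0).
    apply: measurable_funM => //; apply: measurableT_comp => //.
    apply: measurable_sum => j; apply: measurable_funD; apply: measurable_funX;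
      by apply: measurable_funB => //; exact: mX.
  move=> o; rewrite mulNr oppr_le0 divr_ge0//; last by rewrite mulr_ge0// sqr_ge0.
  by apply: sumr_ge0 => j _; rewrite addr_ge0// sqr_ge0.
- apply: bmfun_expN2; last by move=> o; rewrite addr_ge0 ?sqr_ge0// sumr_ge0// => i _; exact: sqr_ge0.
  apply: measurable_funD.
    by apply: measurable_funX; apply: measurable_funB => //; exact: mY.
  apply: measurable_sum => i; apply: measurable_funX.
  by apply: measurable_funB => //; exact: mY.
move=> o; rewrite ler_expR.
pose D (j : 'I_k) := (X (s j) o - X (t j) o - (y - x)) ^+ 2.
pose C (j : 'I_k) := (X (t j) o - x) ^+ 2.
have C0 j : 0 <= C j by exact: sqr_ge0.
have D0 j : 0 <= D j by exact: sqr_ge0.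
have E1 : (e * incr_family (false, i0) o - e * (y - x)) ^+ 2 = l * D i0.
  by rewrite -mulrBr exprMn e2 /incr_family.
have E2 : \sum_i (e * incr_family i o - yy i) ^+ 2 = l * \sum_(j < k) (C j + D j).
  rewrite sum_pair_family mulr_sumr; apply: eq_bigr => j _.
  by rewrite /yy/= -!mulrBr !exprMn e2 mulrDr.
rewrite E1 E2 mulNr [leRHS]mulNr lerN2 -mulrDr.
(* the kernel at i0 is counted once more than the others, which leaves
   room for the separate factor that gauss_kernel_le asks for *)
have h1 : D i0 + \sum_(j < k) (C j + D j) <= 2 * \sum_(j < k) (C j + D j).
  rewrite mulr_natl mulr2n lerD2r (bigD1 i0)//= -addrA ler_wpDl ?C0//.
  by rewrite lerDl sumr_ge0// => j _; rewrite addr_ge0 ?C0 ?D0.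
have h2 : \sum_(j < k) (C j + D j) <= 4 * \sum_(j < k) ((X (t j) o - x) ^+ 2 + (X (s j) o - y) ^+ 2).
  rewrite mulr_sumr; apply: ler_sum => j _; rewrite /C /D.
  set u1 := X (t j) o; set u2 := X (s j) o.
  (* with C = c^2 and D = e^2, this is C + D <= 4 (c^2 + (c + e)^2), that
     is 7 c^2 + 8 c e + 3 e^2 >= 0 *)
  have : 0 <= (7 * (u1 - x) + 4 * (u2 - u1 - (y - x))) ^+ 2 by exact: sqr_ge0.
  have : 0 <= (u2 - u1 - (y - x)) ^+ 2 by exact: sqr_ge0.
  lra.
have -> : (\sum_(j < k) ((X (t j) o - x) ^+ 2 + (X (s j) o - y) ^+ 2)) / (2 * eps ^+ 2) =
  l * (8 * \sum_(j < k) ((X (t j) o - x) ^+ 2 + (X (s j) o - y) ^+ 2)) / 2.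
  by rewrite /l; field; rewrite gt_eqF.
rewrite ler_pM2r// ler_pM2l//; lra.
Qed.

End upper.
End component.

(** * One-point lower bound for one coordinate *)

Section lower.
Context {disp : measure_display} {T : measurableType disp} {R : realType}.
Variables (P : probability T R) (H : R) (X : R -> T -> R).
Hypothesis fX : fbm1 P H X.
Local Notation a := (2 * H).
Hypotheses (a0 : 0 < a) (a1 : a <= 1).
Variables (k : nat) (tau : R).
Hypotheses (k0 : (0 < k)%N) (tau0 : 0 < tau).

(** The covariance form lies between clower tau^a |z|^2 and cmajor tau^a
    |z|^2. *)
Definition clower : R := form_const a k / k%:R.
Definition cmajor : R := k%:R * (2 * k%:R + 2) `^ a.

Lemma clower_gt0 : 0 < clower.
Proof. by rewrite divr_gt0 ?form_const_gt0// ltr0n. Qed.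

Variable t : nat -> R.
Hypothesis bt : block_times tau t.

Let K (i j : nat) : R := fcov H (t i) (t j).
Let Q (z : 'I_k -> R) : R := \sum_(i < k) \sum_(j < k) z i * z j * K i j.

(** Single times are pairs with p = q whose second coefficient vanishes. *)
Lemma pair_form_single z : pair_form a k t t (ext z) (fun=> 0) = Q z.
Proof.
rewrite /pair_form.
pose c := pair_coef k (ext z) (fun=> 0).
have c2 (j : 'I_k) : c j.*2 = z j.
  by rewrite /c /pair_coef odd_double doubleK extE ltn_double ltn_ord.
have c1 (j : 'I_k) : c j.*2.+1 = 0 by rewrite /c /pair_coef /= odd_double/=; case: ifP.
have cn : c k.*2 = 0 by rewrite /c /pair_coef ltnn.
pose F l m := c l * c m * fcov H (pair_seq t t l.+1) (pair_seq t t m.+1).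
rewrite -[LHS]/(\sum_(l < k.*2.+1) \sum_(m < k.*2.+1) F l m).
rewrite (big_double (fun l => \sum_(m < k.*2.+1) F l m)).
rewrite [X in _ + X]big1 => [|m _]; last by rewrite /F cn !mul0r.
rewrite addr0; apply: eq_bigr => i _.
rewrite [X in _ + X]big1 => [|m _]; last by rewrite /F c1 !mul0r.
rewrite addr0 (big_double (fun m => F i.*2 m)) /F cn mulr0 mul0r addr0.
apply: eq_bigr => j _; rewrite c1 mulr0 mul0r addr0 !c2 !pair_seq_odd//.
Qed.

Lemma fcov_form_lower z : clower * tau `^ a * \sum_i z i ^+ 2 <= Q z.
Proof.
have kR : 0 < k%:R :> R by rewrite ltr0n.
have h (j : 'I_k) : form_const a k * (tau `^ a * z j ^+ 2) <= Q z.
  rewrite -pair_form_single.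
  have tp i : tau * (2 * i%:R + 1) <= t i by have /andP[] := bt i.
  have tq i : t i <= tau * (2 * i%:R + 2) by have /andP[] := bt i.
  have := pair_form_gap (ext z) (fun=> 0) a0 a1 tau0 tp (fun=> lexx _) tq (ltn_ord j).
  by rewrite extE addr0.
rewrite mulr_sumr.
apply: (@le_trans _ _ (\sum_(j < k) k%:R^-1 * Q z)); last first.
  by rewrite sumr_const card_ord -[_ *+ k]mulr_natl mulrA mulfV ?mul1r// gt_eqF.
apply: ler_sum => j _; rewrite /clower.
have -> : form_const a k / k%:R * tau `^ a * z j ^+ 2 = k%:R^-1 * (form_const a k * (tau `^ a * z j ^+ 2)) by ring.
by rewrite ler_pM2l ?invr_gt0.
Qed.

Lemma fcov_form_upper z : Q z <= cmajor * tau `^ a * \sum_i z i ^+ 2.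
Proof.
pose N : R := 2 * k%:R + 2.
have N0 : 0 <= N by rewrite addr_ge0// mulr_ge0.
have t0 j := block_times_ge0 tau0 j bt.
have tN (j : 'I_k) : t j `^ a <= N `^ a * tau `^ a.
  rewrite -powRM// ?(ltW tau0)//.
  apply: ge0_ler_powR; rewrite ?nnegrE ?(ltW a0) ?t0 ?mulr_ge0 ?(ltW tau0)//.
  have /andP[_ h] := bt j; apply: le_trans h _; rewrite mulrC ler_pM2r//.
  rewrite lerD2r ler_pM2l// ler_nat; exact: ltnW.
have KN (i j : 'I_k) : `|K i j| <= N `^ a * tau `^ a.
  have sub (x y : R) : 0 <= x -> 0 <= y -> `|x - y| `^ a <= x `^ a + y `^ a.
    move=> x0 y0; wlog xy : x y x0 y0 / y <= x => [hw|].
      have [h|/ltW h] := leP y x; first exact: hw.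
      by rewrite distrC [leRHS]addrC; exact: hw.
    rewrite ger0_norm ?subr_ge0//; apply: (@le_trans _ _ (x `^ a)).
      apply: ge0_ler_powR; rewrite ?nnegrE ?(ltW a0) ?subr_ge0//.
      by rewrite lerBlDr lerDl.
    by rewrite lerDl powR_ge0.
  rewrite /K /fcov (ger0_norm (t0 i)) (ger0_norm (t0 j)) ger0_norm; last first.
    by rewrite divr_ge0// subr_ge0 sub.
  rewrite ler_pdivrMr//; have := tN i; have := tN j.
  have := powR_ge0 `|t i - t j| a; lra.
have D0 : 0 <= N `^ a * tau `^ a by rewrite mulr_ge0 ?powR_ge0.
apply: (@le_trans _ _ (\sum_(i < k) \sum_(j < k) `|z i| * `|z j| * (N `^ a * tau `^ a))).
  apply: ler_sum => i _; apply: ler_sum => j _.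
  apply: le_trans (ler_norm _) _; rewrite normrM [X in X * _ <= _]normrM; apply: ler_wpM2l; last exact: KN.
  exact: mulr_ge0.
have -> : \sum_(i < k) \sum_(j < k) `|z i| * `|z j| * (N `^ a * tau `^ a) =
    (\sum_(i < k) `|z i| * 1) ^+ 2 * (N `^ a * tau `^ a).
  under [in RHS]eq_bigr do rewrite mulr1.
  rewrite expr2 !mulr_suml; apply: eq_bigr => i _.
  by rewrite mulr_sumr mulr_suml.
rewrite /cmajor -/N.
have := cauchy_schwarz_sum (fun i => `|z i|) (fun=> 1 : R).
rewrite [X in _ * X]sumr_const expr1n card_ord.
under [X in _ <= X * _]eq_bigr do rewrite real_normK ?num_real//.
move=> h; apply: (@le_trans _ _ ((\sum_(i < k) z i ^+ 2) * k%:R * (N `^ a * tau `^ a))).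
  by rewrite ler_wpM2r.
by rewrite le_eqVlt; apply/orP; left; apply/eqP; ring.
Qed.

(** The standard deviation tau^H of the process in the blocks dominates M, so
    that the oscillation of the cosine costs at most half of the main term in
    gauss_kernel_ge. *)
Definition scale_large (M : R) : Prop :=
  4 * k%:R * M ^+ 2 * Num.sqrt (2 * cmajor / clower) ^+ k <= clower * tau `^ a.

Lemma comp_lower (x M eps : R) : 0 < eps -> eps <= 1 -> `|x| <= M -> scale_large M ->
  2^-1 * ((Num.sqrt (1 + cmajor * tau `^ a))^-1 * eps) ^+ k <=
  Ex P (fun w => expR (- (\sum_(j < k) (X (t j) w - x) ^+ 2) / (2 * eps ^+ 2))).
Proof.
move=> e0 e1 xM sc.
have t0 j := block_times_ge0 tau0 j bt.
have mX (r : R) : 0 <= r -> measurable_fun setT (X r).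
  by move=> r0; exact: (fbm1_measurable fX r0).
have mY (i : 'I_k) : measurable_fun setT (fun w => eps^-1 * X (t i) w).
  by apply: measurable_funM => //; exact: mX.
pose q (z : 'I_k -> R) := eps ^- 2 * Q z.
have qcos (z : 'I_k -> R) c : Ex P (fun w => cos (\sum_i z i * (eps^-1 * X (t i) w) + c)) =
    expR (- q z / 2) * cos c.
  have := fbm1_cos fX (fun i => eps^-1 * z i) c (fun i : 'I_k => t0 i).
  rewrite (_ : \sum_i \sum_j _ = q z).
    move=> <-; apply: eq_Ex => w; congr (cos (_ + _)); apply: eq_bigr => i _; ring.
  rewrite /q /Q mulr_sumr; apply: eq_bigr => i _; rewrite mulr_sumr; apply: eq_bigr => j _.
  rewrite /K -exprVn; ring.
have T0 : 0 < tau `^ a by rewrite powR_gt0.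
have E0 : 0 < eps ^+ 2 by rewrite exprn_gt0.
have V0 : 0 < eps ^- 2 by rewrite invr_gt0.
pose b := eps ^- 2 * (clower * tau `^ a); pose A := eps ^- 2 * (cmajor * tau `^ a).
have cl := clower_gt0.
have b0 : 0 < b by rewrite /b; apply: mulr_gt0 V0 _; exact: mulr_gt0 cl T0.
have kR : 1 <= k%:R :> R by rewrite ler1n.
have bA : b <= A.
  rewrite ler_pM2l//.
  have := le_trans (fcov_form_lower (fun=> 1)) (fcov_form_upper (fun=> 1)).
  by rewrite ler_pM2r// sumr_const expr1n card_ord ltr0n.
have qb z : b * \sum_i z i ^+ 2 <= q z by rewrite -mulrA ler_pM2l// fcov_form_lower.
have qA z : q z <= A * \sum_i z i ^+ 2 by rewrite -mulrA ler_pM2l// fcov_form_upper.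
have := gauss_kernel_ge mY qcos (fun=> eps^-1 * x) b0 bA qb qA.
rewrite card_ord sumr_const card_ord -[_ *+ k]mulr_natl.
rewrite [X in _ <= X -> _](_ : _ = Ex P (fun w => expR (- (\sum_(j < k) (X (t j) w - x) ^+ 2) / (2 * eps ^+ 2)))); last first.
  apply: eq_Ex => w; congr expR.
  rewrite (eq_bigr (fun j : 'I_k => eps ^- 2 * (X (t j) w - x) ^+ 2)).
    by rewrite -mulr_sumr; field; rewrite gt_eqF.
  by move=> j _; rewrite -mulrBr exprMn exprVn.
apply: le_trans.
have A0 : 0 < A by exact: lt_le_trans b0 bA.
have A1 : 0 < 1 + A by rewrite addr_gt0.
have B1 : 0 < 1 + b / 2 by rewrite addr_gt0// divr_gt0.
pose s := (Num.sqrt (1 + A))^-1 ^+ k.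
have s0 : 0 <= s by rewrite exprn_ge0// invr_ge0 sqrtr_ge0.
pose rho := Num.sqrt (2 * cmajor / clower).
have rat : (Num.sqrt (1 + b / 2))^-1 ^+ k <= rho ^+ k * s.
  rewrite /s -exprMn lerXn2r ?nnegrE ?mulr_ge0 ?invr_ge0 ?sqrtr_ge0//.
  rewrite ler_pdivlMr ?sqrtr_gt0// -sqrtrV ?(ltW B1)// -sqrtrM ?invr_ge0 ?(ltW B1)//.
  rewrite ler_wsqrtr// mulrC ler_pdivrMr//.
  have -> : 2 * cmajor / clower = 2 * A / b.
    by rewrite /A /b; field; rewrite !gt_eqF.
  have -> : 2 * A / b * (1 + b / 2) = 2 * A / b + A by field; rewrite gt_eqF.
  by rewrite lerD2r ler_pdivlMr// mul1r; lra.
have small : 2 / b * (k%:R * (eps^-1 * x) ^+ 2) * (Num.sqrt (1 + b / 2))^-1 ^+ k <= s / 2.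
  have f0 : 0 <= 2 / b * (k%:R * (eps^-1 * x) ^+ 2).
    by rewrite mulr_ge0 ?divr_ge0 ?(ltW b0)// mulr_ge0// sqr_ge0.
  apply: (le_trans (ler_wpM2l f0 rat)); rewrite [leLHS]mulrA [leRHS]mulrC ler_wpM2r//.
  have -> : 2 / b * (k%:R * (eps^-1 * x) ^+ 2) = 2 * k%:R * x ^+ 2 / (clower * tau `^ a).
    by rewrite /b; field; rewrite !gt_eqF.
  rewrite mulrAC ler_pdivrMr ?(mulr_gt0 cl T0)//.
  have xM2 : x ^+ 2 <= M ^+ 2.
    by rewrite -real_normK ?num_real// lerXn2r ?nnegrE// (le_trans _ xM).
  have : 4 * k%:R * x ^+ 2 * rho ^+ k <= 4 * k%:R * M ^+ 2 * rho ^+ k.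
    rewrite ler_wpM2r ?exprn_ge0 ?sqrtr_ge0// ler_wpM2l// mulr_ge0//.
  rewrite /scale_large -/rho in sc *; lra.
have CM0 : 0 < cmajor * tau `^ a by move: A0; rewrite /A pmulr_rgt0.
have main : ((Num.sqrt (1 + cmajor * tau `^ a))^-1 * eps) ^+ k <= s.
  rewrite /s lerXn2r ?nnegrE ?mulr_ge0 ?invr_ge0 ?sqrtr_ge0 ?(ltW e0)//.
  rewrite [leLHS]mulrC -[leRHS]mul1r ler_pdivlMr ?sqrtr_gt0// mulrAC ler_pdivrMr ?sqrtr_gt0; last first.
    by rewrite addr_gt0.
  rewrite mul1r -{1}(ger0_norm (ltW e0)) -sqrtr_sqr -sqrtrM ?(ltW E0)//.
  rewrite ler_wsqrtr// mulrDr mulr1 /A mulrA mulfV ?mul1r ?gt_eqF// lerD2r.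
  by rewrite expr_le1// ltW.
rewrite -/s lerBrDr; apply: (le_trans (lerD (ler_wpM2l _ main) small)) => //; lra.
Qed.

End lower.

(** * Products of independent functions *)

Section staircase.
Context {R : realType}.

Lemma staircase_count (y : R) (n : nat) : 0 <= y ->
  let s := \sum_(l < n) (l.+1%:R <= y)%R%:R in
  [/\ s <= y, (n%:R <= y -> s = n%:R) & (y <= n%:R -> y - 1 < s)].
Proof.
move=> y0; elim: n => [|n [IH1 IH2 IH3]] s.
  by rewrite /s big_ord0; split => // h; lra.
rewrite /s big_ord_recr/=; set s' := \sum_(_ < _) _ in IH1 IH2 IH3 *.
have [le|lt] := leP n.+1%:R y.
  have ny : n%:R <= y by rewrite (le_trans _ le)// ler_nat.
  rewrite IH2//; split => //.
  - by rewrite natr1.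
  - by rewrite natr1.
  - by move=> h; move: le h; rewrite -!natr1; lra.
rewrite addr0; split => //.
move=> _; have [/IH3//|h] := leP y n%:R.
by rewrite (IH2 (ltW h)); move: lt; rewrite -natr1; lra.
Qed.

(** Layers: x is approximated by 1/n times the number of levels l/n, 1 <= l <=
    n, below it. *)
Lemma staircase (x : R) (n : nat) : 0 <= x -> x <= 1 -> (0 < n)%N ->
  `|x - \sum_(l < n) n%:R^-1 * (l.+1%:R / n%:R <= x)%R%:R| <= n%:R^-1.
Proof.
move=> x0 x1 n0; have nR : 0 < n%:R :> R by rewrite ltr0n.
have nx0 : 0 <= n%:R * x by rewrite mulr_ge0.
have [h1 _ h3] := staircase_count n nx0.
have nx1 : n%:R * x <= n%:R by rewrite -[leRHS]mulr1 ler_pM2l.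
rewrite (eq_bigr (fun l : 'I_n => n%:R^-1 * (l.+1%:R <= n%:R * x)%R%:R)); last first.
  by move=> l _; rewrite ler_pdivrMr// [x * _]mulrC.
rewrite -mulr_sumr.
set s := \sum_(_ < _) _ in h1 h3 *.
have -> : x - n%:R^-1 * s = n%:R^-1 * (n%:R * x - s).
  by field; rewrite gt_eqF.
rewrite normrM ger0_norm// -[leRHS]mulr1 ler_wpM2l//.
rewrite ger0_norm ?subr_ge0//.
by have := h3 nx1; lra.
Qed.

(** Factors are exchanged one by one. *)
Lemma prod_dist (I : finType) (x y : I -> R) e :
  (forall i, 0 <= x i <= 1) -> (forall i, 0 <= y i <= 1) ->
  (forall i, `|x i - y i| <= e) ->
  `|\prod_i x i - \prod_i y i| <= #|I|%:R * e.
Proof.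
move=> hx hy he.
suff : forall s : seq I, `|\prod_(i <- s) x i - \prod_(i <- s) y i| <= (size s)%:R * e.
  by move=> /(_ (index_enum I)); rewrite cardT enumT.
elim=> [|i s IH]; first by rewrite !big_nil subrr normr0 mul0r.
rewrite !big_cons/=.
set a := \prod_(_ <- _) _ in IH *; set b := \prod_(_ <- _) _ in IH *.
have a01 : `|a| <= 1.
  rewrite ger0_norm /a; last by apply: prodr_ge0 => j _; have /andP[] := hx j.
  by apply: prodr_ile1 => j _; exact: hx.
have -> : x i * a - y i * b = (x i - y i) * a + y i * (a - b) by ring.
rewrite (le_trans (ler_normD _ _))// -natr1 [leRHS]mulrDl mul1r [leRHS]addrC.
apply: lerD.
  by rewrite normrM -[leRHS]mulr1 ler_pM.
have /andP[y0 y1] := hy i.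
by rewrite normrM (ger0_norm y0) (le_trans _ IH)// ler_piMl.
Qed.

End staircase.

Section independence.
Context {disp : measure_display} {T : measurableType disp} {R : realType}.
Variable P : probability T R.

(** Each factor is approximated uniformly by a combination of indicators of
    its level sets; for these the product formula is the independence of
    events, and the error is of order 1 / n. *)
Lemma indep_Ex_prod (I : finType) (F : I -> set (set T)) (f : I -> T -> R) :
  independent_sigma P F ->
  (forall i, F i `<=` measurable) ->
  (forall i w, 0 <= f i w <= 1) ->
  (forall i, measurable_fun setT (f i)) ->
  (forall i c, F i [set w | c <= f i w]) ->
  Ex P (fun w => \prod_i f i w) = \prod_i Ex P (f i).
Proof.
move=> indF mF f01 mf Ff.
have bf i : bmfun (f i).
  split => //; exists 1 => w; have /andP[h0 h1] := f01 i w.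
  by rewrite ger0_norm.
pose A i n l := [set w | l.+1%:R / n%:R <= f i w].
have mA i n l : measurable (A i n l) by apply: mF; exact: Ff.
pose g (i : I) (n : nat) (w : T) : R := \sum_(l < n) n%:R^-1 * \1_(A i n l) w.
have gE i n w : g i n w = \sum_(l < n) n%:R^-1 * (l.+1%:R / n%:R <= f i w)%R%:R.
  apply: eq_bigr => l _; rewrite indicE; congr (_ * _%:R); congr nat_of_bool.
  by apply/idP/idP; rewrite inE.
have bg i n : bmfun (g i n).
  by apply: bmfun_sum => l; apply: bmfunM; [exact: bmfun_cst|exact: bmfun_indic].
have EgE n : Ex P (fun w => \prod_i g i n w) = \prod_i Ex P (g i n).
  rewrite (@eq_Ex _ _ _ _ _ (fun w : T => \sum_(h : {ffun I -> 'I_n})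
      \prod_i (n%:R^-1 * \1_(A i n (h i)) w))); last by move=> w; exact: bigA_distr_bigA.
  rewrite Ex_sum; last first.
    by move=> h; apply: bmfun_prod => i; apply: bmfunM; [exact: bmfun_cst|exact: bmfun_indic].
  have E i : Ex P (g i n) = \sum_(l < n) n%:R^-1 * fine (P (A i n l)).
    rewrite Ex_sum; last by move=> l; apply: bmfunM; [exact: bmfun_cst|exact: bmfun_indic].
    by apply: eq_bigr => l _; rewrite ExZ ?Ex_indic//; exact: bmfun_indic.
  under [RHS]eq_bigr do rewrite E.
  rewrite bigA_distr_bigA; apply: eq_bigr => h _.
  rewrite (@eq_Ex _ _ _ _ _ (fun w : T => (\prod_(i : I) n%:R^-1) *
     \1_(\bigcap_(i in [set` [set: I]%SET]) A i n (h i)) w)); last first.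
    move=> w; rewrite big_split/=; congr (_ * _); rewrite indicE.
    case: (boolP (w \in _)) => wA.
      rewrite big1// => i _; rewrite indicE; move: wA; rewrite !inE => /(_ i)/=.
      by rewrite inE => /(_ isT) h1; rewrite mem_set.
    have [i wi] : exists i, w \notin A i n (h i).
      apply: contrapT => /forallNP wn; move/negP: wA; apply; rewrite inE => i _.
      by have /negP := wn i; rewrite negbK inE.
    by rewrite (bigD1 i)//= indicE (negbTE wi) mul0r.
  have mcap : measurable (\bigcap_(i in [set` [set: I]%SET]) A i n (h i)).
    by apply: fin_bigcap_measurable => //; exact: finite_finset.
  rewrite ExZ; last exact: bmfun_indic.
  rewrite Ex_indic// indF; last by move=> i _; exact: Ff.
  rewrite (eq_bigr (fun i => (fine (P (A i n (h i))))%:E)); last first.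
    by move=> i _; rewrite fineK// fin_num_measure.
  rewrite prodEFin/= big_split/=; congr (_ * _).
  by apply: eq_bigl => i; rewrite inE.
have g01 i n w : (0 < n)%N -> 0 <= g i n w <= 1.
  move=> n0; have nR : 0 < n%:R :> R by rewrite ltr0n.
  rewrite sumr_ge0 => [|l _]; last by rewrite mulr_ge0.
  apply: (@le_trans _ _ (\sum_(l < n) n%:R^-1)).
    by apply: ler_sum => l _; rewrite -[leRHS]mulr1 ler_wpM2l// indicE lern1 leq_b1.
  by rewrite sumr_const card_ord -[_ *+ n]mulr_natl mulfV// gt_eqF.
have fg i n w : (0 < n)%N -> `|f i w - g i n w| <= n%:R^-1.
  by move=> n0; rewrite gE; have /andP[h0 h1] := f01 i w; exact: staircase.
have Ex01 (h : T -> R) : bmfun h -> (forall w, 0 <= h w <= 1) -> 0 <= Ex P h <= 1.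
  move=> bh h01; rewrite Ex_ge0/=; last by move=> w; have /andP[] := h01 w.
  rewrite -[leRHS](Ex_cst P); apply: le_Ex => //; first exact: bmfun_cst.
  by move=> w; have /andP[] := h01 w.
have bound n : (0 < n)%N ->
   `|Ex P (fun w => \prod_i f i w) - \prod_i Ex P (f i)| <= 2 * #|I|%:R / n%:R.
  move=> n0.
  have b1 : bmfun (fun w => \prod_i f i w) by exact: bmfun_prod.
  have b2 : bmfun (fun w => \prod_i g i n w) by exact: bmfun_prod.
  rewrite -(subrK (\prod_i Ex P (g i n)) (Ex P _)) -addrA.
  rewrite (le_trans (ler_normD _ _))//.
  have -> : 2 * #|I|%:R / n%:R = #|I|%:R * n%:R^-1 + #|I|%:R * n%:R^-1 :> R by ring.
  apply: lerD.
    rewrite -EgE -ExB//; apply: normr_Ex.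
      rewrite (_ : (fun _ => _) = (fun w => \prod_i f i w + -1 * \prod_i g i n w)).
        by apply: bmfunD => //; apply: bmfunM => //; exact: bmfun_cst.
      by apply/funext => w; rewrite mulN1r.
    move=> w; apply: prod_dist => i; [exact: f01|exact: g01|exact: fg].
  rewrite distrC; apply: prod_dist => i; [exact: Ex01|by apply: Ex01 => // w; exact: g01|].
  rewrite -ExB//; apply: normr_Ex => [|w]; last exact: fg.
  rewrite (_ : (fun _ => _) = (fun w => f i w + -1 * g i n w)).
    by apply: bmfunD => //; apply: bmfunM => //; exact: bmfun_cst.
  by apply/funext => w; rewrite mulN1r.
apply/eqP; rewrite -subr_eq0 -normr_le0; apply/ler_addgt0Pr => e e0; rewrite add0r.
have c0 : 0 <= 2 * #|I|%:R / e :> R by rewrite divr_ge0 ?(ltW e0)// mulr_ge0.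
(* n large enough for the staircase error 2 |I| / n to be below e *)
pose n := (Num.truncn (2 * #|I|%:R / e : R)).+1.
apply: le_trans (bound n (ltn0Sn _)) _.
rewrite ler_pdivrMr ?ltr0n// [leRHS]mulrC -ler_pdivrMr//.
exact: ltW (truncnS_gt _).
Qed.

Lemma sigma_process_sub (X : R -> T -> R) : (forall t, 0 <= t -> measurable_fun setT (X t)) ->
  sigma_process X `<=` measurable.
Proof.
move=> mX; apply: smallest_sub; first exact: sigma_algebra_measurable.
move=> _ [t /= t0] [U mU <-].
by apply: mX => //; move: t0; rewrite in_itv/= andbT.
Qed.

(** Measurability with respect to the process itself, obtained by viewing the
    functions on the same space with the smaller sigma-algebra. *)
Lemma sigma_process_ge (X : R -> T -> R) (I : Type) (s : seq I) (F : I -> R -> R) (t : I -> R)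
    (G : R -> R) (c : R) :
  (forall i, 0 <= t i) -> (forall i, measurable_fun setT (F i)) -> measurable_fun setT G ->
  sigma_process X [set w | c <= G (\sum_(i <- s) F i (X (t i) w))].
Proof.
move=> t0 mF mG.
pose T' := g_sigma_algebraType (\bigcup_(t in `[0, +oo[) preimage_set_system setT (X t) measurable).
have mX i : measurable_fun setT (X (t i) : T' -> R).
  move=> _ U mU; apply: sub_sigma_algebra; exists (t i).
    by rewrite /= in_itv/= t0.
  by exists U.
have mf : measurable_fun setT ((fun w => G (\sum_(i <- s) F i (X (t i) w))) : T' -> R).
  apply: (measurableT_comp mG); apply: measurable_sum => i.
  exact: (measurableT_comp (mF i)).
have := mf measurableT `[c, +oo[%classic (measurable_itv _).
rewrite setTI (_ : _ @^-1` _ = [set w | c <= G (\sum_(i <- s) F i (X (t i) w))])//.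
by apply/seteqP; split => w /=; rewrite in_itv/= andbT.
Qed.

End independence.

(** * Harmonic sums and logarithms *)

Section sums.
Context {R : realType}.

(** Each term is at most the corresponding increment of the logarithm, since
    ln (1 - z) <= - z. *)
Lemma harmonic_ln (A : R) n : 0 < A ->
  \sum_(m < n) (m.+1%:R + A)^-1 <= ln ((n%:R + A) / A).
Proof.
move=> A0; elim: n => [|n IH].
  by rewrite big_ord0 add0r mulfV ?gt_eqF// ln1.
have n0 : 0 <= n%:R :> R by [].
have nA : 0 < n%:R + A by rewrite ltr_wpDl.
have nA1 : 0 < n.+1%:R + A by rewrite addr_gt0.
rewrite big_ord_recr/= (le_trans (lerD IH (lexx _)))//.
rewrite !ln_div ?posrE// addrAC lerD2r.
have h : ln ((n%:R + A) / (n.+1%:R + A)) <= - (n.+1%:R + A)^-1.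
  have -> : (n%:R + A) / (n.+1%:R + A) = 1 + - (n.+1%:R + A)^-1.
    by rewrite -natr1; field; rewrite -natr1 in nA1; rewrite gt_eqF.
  apply: le_ln1Dx; rewrite ltrN2 invf_lt1//.
  by rewrite -natr1; lra.
rewrite ln_div ?posrE// in h; lra.
Qed.

Definition ndist (l m : nat) : nat := (l - m) + (m - l).

(** For a given l each distance is attained by at most two indices. *)
Lemma sum_ndist (F : nat -> R) n : (forall m, 0 <= F m) ->
  \sum_(l < n) \sum_(l' < n) F (ndist l l') <= 2 * n%:R * \sum_(m < n) F m.
Proof.
move=> F0.
have cnt (p : pred 'I_n) : (forall i j, p i -> p j -> i = j) ->
    \sum_(i < n) (p i)%:R <= 1 :> R.
  move=> hp; case: (pickP p) => [i pi|np]; last first.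
    by rewrite big1// => i _; rewrite np.
  rewrite (bigD1 i)//= pi big1 ?addr0// => j /eqP ji.
  by case: (boolP (p j)) => // pj; case: ji; exact: hp.
have h (l : 'I_n) : \sum_(l' < n) F (ndist l l') <= 2 * \sum_(m < n) F m.
  apply: (@le_trans _ _ (\sum_(l' < n) \sum_(m < n)
      F m * ((l == l' + m :> nat)%N%:R + (l' == l + m :> nat)%N%:R))).
    apply: ler_sum => l' _.
    have dlt : (ndist l l' < n)%N by rewrite /ndist; have := ltn_ord l; have := ltn_ord l'; lia.
    rewrite (bigD1 (Ordinal dlt))//= -[leLHS]addr0 lerD//; last first.
      by apply: sumr_ge0 => m _; rewrite mulr_ge0// addr_ge0.
    rewrite -[leLHS]mulr1 ler_wpM2l//.
    have [ll|ll] := leqP l' l.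
      have -> : (l == l' + ndist l l' :> nat)%N by apply/eqP; rewrite /ndist; lia.
      by rewrite lerDl.
    have -> : (l' == l + ndist l l' :> nat)%N by apply/eqP; rewrite /ndist; lia.
    by rewrite lerDr.
  rewrite exchange_big/= mulr_sumr; apply: ler_sum => m _.
  rewrite -mulr_sumr mulrC ler_wpM2r// big_split/=.
  have -> : 2 = 1 + 1 :> R by [].
  apply: lerD; apply: cnt => i j /eqP e1 /eqP e2; apply: val_inj => /=; lia.
apply: le_trans (ler_sum _ (fun l _ => h l)) _.
by rewrite sumr_const card_ord -[_ *+ n]mulr_natl mulrCA mulrA.
Qed.

Definition expC (d : nat) : R := 1 + d`!%:R * expR 1.

Lemma expC_gt0 d : 0 < expC d.
Proof. by rewrite /expC ltr_pwDl// mulr_ge0// expR_ge0. Qed.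

(** Gaussian decay beats the power: y^d <= d! e^y and y - y^2 <= 1. *)
Lemma exp_sq_le (d : nat) (y : R) : (0 < d)%N -> 0 <= y ->
  (1 + y ^+ d) * expR (- y ^+ 2) <= expC d.
Proof.
move=> d0 y0.
have h : y ^+ d <= d`!%:R * expR y.
  case: d d0 => // n _.
  have := expR_ge1Dxn n y0 => h.
  have f0 : 0 < n.+1`!%:R :> R by rewrite ltr0n fact_gt0.
  rewrite mulrC -ler_pdivrMr//; lra.
(* the two summands 1 and y^d are bounded separately *)
rewrite mulrDl mul1r /expC lerD//.
  by rewrite expR_le1 oppr_le0 sqr_ge0.
apply: (@le_trans _ _ (d`!%:R * expR y * expR (- y ^+ 2))).
  by rewrite ler_wpM2r ?expR_ge0.
rewrite -mulrA -expRD ler_wpM2l// ler_expR.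
have : 0 <= (2 * y - 1) ^+ 2 by exact: sqr_ge0.
nra.
Qed.

(** A bound with the decay z_i for every i implies the bound with the mean of
    the z_i, which spreads the decay evenly over the k factors of a product. *)
Lemma le_expR_mean (k : nat) (v D : R) (z : 'I_k -> R) : (0 < k)%N -> 0 <= D ->
  (forall i, v <= D * expR (- z i)) ->
  v <= D * \prod_i expR (- (z i / k%:R)).
Proof.
move=> k0 D0 h.
have kR : 0 < k%:R :> R by rewrite ltr0n.
rewrite -expR_sum sumrN -mulr_suml; set Z := \sum_i z i.
suff [i zi] : exists i, Z / k%:R <= z i.
  by apply: le_trans (h i) _; rewrite ler_wpM2l// ler_expR lerN2.
apply: contrapT => /forallNP hn.
have : Z < \sum_(i < k) (Z / k%:R).
  rewrite /Z; apply: ltr_sum => [|i _]; last by rewrite ltNge; apply/negP/hn.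
  by apply/hasP; exists (Ordinal k0); rewrite ?mem_index_enum.
by rewrite sumr_const card_ord -[_ *+ k]mulr_natr divfK ?ltxx// gt_eqF.
Qed.

(** Subadditivity 1 + x^d <= (1 + x)^d, then a case distinction on rho <= 1. *)
Lemma ln_1DV (rho form_const : R) (d : nat) : 0 < rho -> 0 < form_const -> (0 < d)%N ->
  ln (1 + ((rho / form_const) ^+ d)^-1) <= d%:R * (ln (1 + form_const) + Num.max (ln rho^-1) 0).
Proof.
move=> r0 k0 d0.
set x := form_const / rho; have x0 : 0 < x by rewrite divr_gt0.
have -> : ((rho / form_const) ^+ d)^-1 = x ^+ d by rewrite -exprVn invf_div.
have h1 : 1 + x ^+ d <= (1 + x) ^+ d.
  case: d d0 => // n _; elim: n => [|n IH]; first by rewrite !expr1.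
  rewrite exprS [leRHS]exprS.
  have := ler_wpM2l (ltW (addr_gt0 ltr01 x0)) IH.
  apply: le_trans; rewrite mulrDr mulr1 mulrDl mul1r.
  have : 0 <= x ^+ n.+1 by rewrite exprn_ge0// ltW.
  lra.
have x1 : 0 < 1 + x by rewrite addr_gt0.
apply: (@le_trans _ _ (ln ((1 + x) ^+ d))).
  by rewrite ler_ln ?posrE ?exprn_gt0// addr_gt0// exprn_gt0.
rewrite lnXn// -[_ *+ d]mulr_natl ler_wpM2l//.
have k1 : 0 < 1 + form_const by rewrite addr_gt0.
have [rho1|rho1] := leP rho 1.
  apply: (@le_trans _ _ (ln ((1 + form_const) * rho^-1))).
    rewrite ler_ln ?posrE ?mulr_gt0 ?invr_gt0//.
    rewrite mulrDl mul1r lerD2r.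
    by rewrite -(invr1 R) lef_pV2 ?posrE.
  by rewrite lnM ?posrE ?invr_gt0// lerD2l le_max lexx.
apply: (@le_trans _ _ (ln (1 + form_const))).
  rewrite ler_ln ?posrE// lerD2l /x ler_pdivrMr// ler_peMr// ltW//.
by rewrite lerDl le_max lexx orbT.
Qed.

End sums.

(** * Grid times *)

Lemma powR_double {R : realType} (x H : R) : x `^ (2 * H) = (x `^ H) ^+ 2.
Proof. by rewrite mulrC powRrM powR_mulrn ?powR_ge0. Qed.

Section grid_component.
Context {disp : measure_display} {T : measurableType disp} {R : realType}.
Variables (P : probability T R) (H : R) (X : R -> T -> R).
Hypothesis fX : fbm1 P H X.
Local Notation a := (2 * H).
Hypotheses (a0 : 0 < a) (a1 : a <= 1).
Variables (k : nat) (tau : R) (N : nat).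
Hypotheses (k0 : (0 < k)%N) (tau1 : 1 <= tau) (N0 : (0 < N)%N).

Definition grid_time (j l : nat) : R := tau * (2 * j%:R + 1 + l%:R / N%:R).

(** The width N^-H of the kernels is the size of an increment of the process
    over one grid step. *)
Definition mesh : R := (N%:R `^ H)^-1.

Let tau0 : 0 < tau. Proof. exact: lt_le_trans tau1. Qed.
Let NR : 0 < N%:R :> R. Proof. by rewrite ltr0n. Qed.
Let NH : 0 < N%:R `^ H :> R. Proof. by rewrite powR_gt0. Qed.

Lemma mesh_gt0 : 0 < mesh. Proof. by rewrite invr_gt0. Qed.

Lemma mesh_sq : mesh ^+ 2 = (N%:R `^ a)^-1.
Proof. by rewrite /mesh exprVn powR_double. Qed.

Lemma grid_block (l : nat -> nat) : (forall j, (l j < N)%N) ->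
  block_times tau (fun j => grid_time j (l j)).
Proof.
move=> lN j; rewrite /grid_time !ler_pM2l//.
have h0 : 0 <= (l j)%:R / N%:R :> R by rewrite divr_ge0.
have h1 : (l j)%:R / N%:R <= 1 :> R by rewrite ler_pdivrMr// mul1r ler_nat ltnW.
by apply/andP; split; lra.
Qed.

Definition cgrid : R := (Num.sqrt (cupper H k / 8))^-1 * (Num.sqrt (Num.min 1 (cupper H k / 8)))^-1.

Lemma cupper_gt0 : 0 < cupper H k :> R.
Proof. by rewrite /cupper divr_gt0 ?form_const_gt0// mulr_gt0// ltr0n. Qed.

Lemma cgrid_ge0 : 0 <= cgrid.
Proof. by rewrite mulr_ge0// invr_ge0 sqrtr_ge0. Qed.

Lemma powR_add1 (m : nat) : (m.+1%:R : R) `^ a <= 1 + m%:R `^ a.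
Proof.
have := powR_4pt a0 a1 (ler01 : 0 <= 1 :> R) (lexx 0) (ler0n R m).
rewrite addr0 add0r powR0 ?gt_eqF// addr0 powR1.
by rewrite nat1r.
Qed.

Lemma grid_dist (l l' : nat -> nat) j :
  `|grid_time j (l' j) - grid_time j (l j)| = tau * ((ndist (l j) (l' j))%:R / N%:R).
Proof.
rewrite /grid_time -mulrBr normrM (gtr0_norm tau0); congr (_ * _).
have -> : 2 * j%:R + 1 + (l' j)%:R / N%:R - (2 * j%:R + 1 + (l j)%:R / N%:R) =
  ((l' j)%:R - (l j)%:R) / N%:R :> R by ring.
rewrite normrM (ger0_norm (_ : 0 <= N%:R^-1 :> R)) ?invr_ge0//; congr (_ / _).
rewrite /ndist; have [h|h] := leqP (l j) (l' j).
  have -> : (l j - l' j)%N = 0%N by apply/eqP; rewrite subn_eq0.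
  by rewrite add0n natrB// ger0_norm// subr_ge0 ler_nat.
have -> : (l' j - l j)%N = 0%N by apply/eqP; rewrite subn_eq0 ltnW.
by rewrite addn0 natrB ?(ltnW h)// ltr0_norm ?subr_lt0 ?ltr_nat// opprB.
Qed.

(** On the grid eps^2 + u^(2 H) is of order ((m + 1) / N)^(2 H), m being the
    distance of the indices; the term eps^2 accounts for the summand 1. *)
Lemma comp_upper_grid (l l' : nat -> nat) (x y : R) (i0 : 'I_k) :
  (forall j, (l j < N)%N) -> (forall j, (l' j < N)%N) ->
  Ex P (fun w => expR (- (\sum_(j < k) ((X (grid_time j (l j)) w - x) ^+ 2 +
     (X (grid_time j (l' j)) w - y) ^+ 2)) / (2 * mesh ^+ 2))) <=
  expR (- ((y - x) ^+ 2 * ((N%:R / (ndist (l i0) (l' i0)).+1%:R) `^ H) ^+ 2 / (18 * tau `^ a))) *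
  \prod_(j < k) (cgrid * (N%:R `^ H)^-1 * ((ndist (l j) (l' j)).+1%:R `^ H)^-1).
Proof.
move=> lN lN'.
have := comp_upper fX a0 a1 k0 tau0 (grid_block lN) (grid_block lN') x y i0 mesh_gt0.
have cu := cupper_gt0.
have ta1 : 1 <= tau `^ a.
  by rewrite -[leLHS](one_powR a) ge0_ler_powR ?(ltW a0)// ?nnegrE// ltW.
have Na0 : 0 < N%:R `^ a :> R by rewrite powR_gt0.
have uE j : `|grid_time j (l' j) - grid_time j (l j)| `^ a =
    tau `^ a * (ndist (l j) (l' j))%:R `^ a / N%:R `^ a.
  rewrite grid_dist powRM ?(ltW tau0) ?divr_ge0// powRM ?invr_ge0// mulrA; congr (_ * _).
  by rewrite -powR_inv1 ?(ltW NR)// powRAC powR_inv1 ?powR_ge0.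
move/le_trans; apply; apply: ler_pM.
- exact: expR_ge0.
- by apply: prodr_ge0 => j _; rewrite mulr_ge0// invr_ge0 sqrtr_ge0.
- rewrite ler_expR lerN2 uE mesh_sq.
  set m := ndist _ _.
  have m0 : 0 < m.+1%:R `^ a :> R by rewrite powR_gt0// ltr0n.
  have den0 : 0 < 8 / N%:R `^ a + tau `^ a * m%:R `^ a / N%:R `^ a.
    by rewrite ltr_pwDl ?divr_gt0// divr_ge0 ?(ltW Na0)// mulr_ge0 ?powR_ge0.
  have -> : ((N%:R / m.+1%:R) `^ H) ^+ 2 = N%:R `^ a / m.+1%:R `^ a.
    rewrite -powR_double powRM ?(ltW NR) ?invr_ge0//; congr (_ * _).
    by rewrite -powR_inv1// powRAC powR_inv1 ?powR_ge0.
  rewrite -[leLHS]mulrA ler_wpM2l ?sqr_ge0//.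
  have -> : N%:R `^ a / m.+1%:R `^ a / (18 * tau `^ a) =
      (2 * (9 * tau `^ a * m.+1%:R `^ a / N%:R `^ a))^-1.
    by field; rewrite !gt_eqF// (lt_le_trans _ ta1).
  rewrite lef_pV2 ?posrE ?mulr_gt0 ?divr_gt0 ?invr_gt0//; last first.
    by rewrite (lt_le_trans _ ta1).
  rewrite ler_pM2l// -mulrDl ler_pM2r ?invr_gt0//.
  have m1 : 1 <= m.+1%:R `^ a :> R.
    by rewrite -[leLHS](one_powR a) ge0_ler_powR ?(ltW a0)// ?nnegrE// ler1n.
  have h1 : m%:R `^ a <= m.+1%:R `^ a :> R.
    by rewrite ge0_ler_powR ?(ltW a0)// ?nnegrE// ler_nat.
  have h2 : tau `^ a * m%:R `^ a <= tau `^ a * m.+1%:R `^ a.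
    by rewrite ler_wpM2l ?powR_ge0.
  have h3 : 1 <= tau `^ a * m.+1%:R `^ a by rewrite -[leLHS]mulr1 ler_pM.
  lra.
- apply: ler_prod => j _.
  rewrite mulr_ge0 ?invr_ge0 ?sqrtr_ge0//=.
  rewrite uE mesh_sq /cgrid; set m := ndist _ _.
  move: (cupper H k) cu => c cu.
  have c8 : 0 < c / 8 :> R by rewrite divr_gt0.
  have cm : 0 < Num.min 1 (c / 8) :> R by rewrite lt_min ltr01.
  have mH : 0 < m.+1%:R `^ H :> R by rewrite powR_gt0// ltr0n.
  have -> : (Num.sqrt (c / 8))^-1 * (Num.sqrt (Num.min 1 (c / 8)))^-1 * (N%:R `^ H)^-1 * (m.+1%:R `^ H)^-1 =
     (Num.sqrt (c / 8) * N%:R `^ H)^-1 *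
     (Num.sqrt (Num.min 1 (c / 8)) * m.+1%:R `^ H)^-1.
    by rewrite !invfM; ring.
  apply: ler_pM; rewrite ?invr_ge0 ?sqrtr_ge0//.
    rewrite lef_pV2 ?posrE ?mulr_gt0 ?sqrtr_gt0//; last first.
      by rewrite addr_gt0// divr_gt0 ?mulr_gt0 ?invr_gt0// (lt_le_trans _ ta1).
    rewrite -[N%:R `^ H]ger0_norm ?powR_ge0// -sqrtr_sqr -sqrtrM ?(ltW c8)//.
    rewrite ler_wsqrtr// -powR_double.
    have -> : c * tau `^ a / (8 * (N%:R `^ a)^-1) = c / 8 * (tau `^ a * N%:R `^ a).
      by field; rewrite gt_eqF.
    rewrite ler_wpDl// ler_wpM2l ?(ltW c8)//.
    by rewrite ler_peMl ?(ltW Na0).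
  rewrite lef_pV2 ?posrE ?mulr_gt0 ?sqrtr_gt0//; last first.
    rewrite ltr_pwDl// divr_ge0 ?mulr_ge0 ?invr_ge0 ?powR_ge0 ?(ltW cu)//.
  rewrite -[m.+1%:R `^ H]ger0_norm ?powR_ge0// -sqrtr_sqr -sqrtrM ?(ltW cm)//.
  rewrite ler_wsqrtr// -powR_double.
  have -> : c * (tau `^ a * m%:R `^ a / N%:R `^ a) / (8 * (N%:R `^ a)^-1) =
      c / 8 * (tau `^ a * m%:R `^ a) by field; rewrite gt_eqF.
  set c' := Num.min _ _ in cm *.
  apply: (@le_trans _ _ (c' * (1 + m%:R `^ a))).
    by rewrite ler_wpM2l ?(ltW cm)// powR_add1.
  rewrite mulrDr mulr1 lerD//; first by rewrite /c' ge_min lexx.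
  apply: ler_pM; rewrite ?powR_ge0 ?(ltW cm)//; first by rewrite /c' ge_min lexx orbT.
  by rewrite ler_peMl ?powR_ge0.
Qed.

End grid_component.

(** * First and second moments of the kernel sums *)

Section moments.
Context {disp : measure_display} {T : measurableType disp} {R : realType}.
Variables (P : probability T R) (d : nat) (H : R) (B : R -> T -> 'rV[R]_d).
Hypothesis fB : fbm P H B.
Local Notation a := (2 * H).
Hypotheses (a0 : 0 < a) (a1 : a <= 1) (Hd : H * d%:R = 1).
Variables (k : nat) (tau : R) (N : nat).
Hypotheses (k0 : (0 < k)%N) (tau1 : 1 <= tau) (N0 : (0 < N)%N).

Let tau0 : 0 < tau. Proof. exact: lt_le_trans tau1. Qed.
Let NR : 0 < N%:R :> R. Proof. by rewrite ltr0n. Qed.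
Local Notation gt := (grid_time tau N).
Local Notation eps := (mesh H N).

Lemma d_gt0 : (0 < d)%N.
Proof. by case: d Hd => // /eqP; rewrite mulr0 eq_sym oner_eq0. Qed.

Lemma powR_H_d (x : R) : 0 <= x -> (x `^ H) ^+ d = x.
Proof. by move=> x0; rewrite -powR_mulrn ?powR_ge0// -powRrM Hd powRr1. Qed.

(** Its integral in x over R^d is of order eps^d = 1 / N, as H d = 1. *)
Definition kern (j l : nat) (x : 'rV[R]_d) (w : T) : R :=
  expR (- (\sum_(c < d) (Defs.coord B c (gt j l) w - x ord0 c) ^+ 2) / (2 * eps ^+ 2)).

(** A choice of one grid index in each of the k blocks, extended to all blocks
    by index 0, as block_times asks for an infinite sequence of times. *)
Definition ffun_nat (h : {ffun 'I_k -> 'I_N}) (j : nat) : nat := oapp (fun i => h i : nat) 0%N (insub j).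

Lemma ffun_natE h (j : 'I_k) : ffun_nat h j = h j.
Proof. by rewrite /ffun_nat valK. Qed.

Lemma ffun_nat_lt h j : (ffun_nat h j < N)%N.
Proof. by rewrite /ffun_nat; case: insub => [i|]//=. Qed.

Lemma gt_ge0 h j : 0 <= gt j (ffun_nat h j).
Proof. exact: (block_times_ge0 tau0 j (grid_block tau1 N0 (ffun_nat_lt h))). Qed.

Lemma mesh2_gt0 : 0 < 2 * eps ^+ 2.
Proof. by rewrite mulr_gt0// exprn_gt0// mesh_gt0. Qed.

Lemma coord_measurable c (t : R) : 0 <= t -> measurable_fun setT (Defs.coord B c t).
Proof. by move=> t0; exact: (fbm1_measurable (fbm_coord fB c) t0). Qed.

Lemma kern_bound j l x w : 0 <= kern j l x w <= 1.
Proof.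
rewrite /kern expR_ge0 expR_le1 mulNr oppr_le0 divr_ge0// ?(ltW mesh2_gt0)//.
by apply: sumr_ge0 => c _; exact: sqr_ge0.
Qed.

Lemma prod_kern (h : {ffun 'I_k -> 'I_N}) x w :
  \prod_(j < k) kern j (h j) x w =
  \prod_(c < d) expR (- (\sum_(j < k) (Defs.coord B c (gt j (ffun_nat h j)) w - x ord0 c) ^+ 2) / (2 * eps ^+ 2)).
Proof.
rewrite -!expR_sum; congr expR; rewrite -!mulr_suml; congr (_ / _).
rewrite !sumrN exchange_big/=; congr (- _); apply: eq_bigr => c _.
by apply: eq_bigr => j _; rewrite ffun_natE.
Qed.

Lemma sum_sq_expR_bound (I : finType) (Y : I -> R) :
  0 <= expR (- (\sum_i Y i ^+ 2) / (2 * eps ^+ 2)) <= 1.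
Proof.
rewrite expR_ge0 expR_le1 mulNr oppr_le0 divr_ge0// ?(ltW mesh2_gt0)//.
by apply: sumr_ge0 => c _; exact: sqr_ge0.
Qed.

Lemma gauss_profile_measurable : measurable_fun setT (fun v : R => expR (- v / (2 * eps ^+ 2))).
Proof.
have -> : (fun v : R => expR (- v / (2 * eps ^+ 2))) = expR \o (fun v : R => (- (2 * eps ^+ 2)^-1) * v).
  by apply/funext => v /=; rewrite !mulNr [in RHS]mulrC.
by apply: measurableT_comp => //; exact: mulrl_measurable.
Qed.

(** The Gaussian kernel is a product over the coordinates, which are
    independent. *)
Lemma indep_coord (I : finType) (t : I -> R) (x : I -> 'rV[R]_d) : (forall i, 0 <= t i) ->
  Ex P (fun w => \prod_(c < d) expR (- (\sum_i (Defs.coord B c (t i) w - x i ord0 c) ^+ 2) / (2 * eps ^+ 2))) =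
  \prod_(c < d) Ex P (fun w => expR (- (\sum_i (Defs.coord B c (t i) w - x i ord0 c) ^+ 2) / (2 * eps ^+ 2))).
Proof.
move=> t0.
apply: (indep_Ex_prod (fbm_indep fB)).
- by move=> c; apply: sigma_process_sub => t' t0'; exact: coord_measurable.
- by move=> c w; exact: sum_sq_expR_bound.
- move=> c; apply: (measurableT_comp gauss_profile_measurable); apply: measurable_sum => i.
  by apply: measurable_funX; apply: measurable_funB => //; exact: coord_measurable.
- move=> c r.
  apply: (@sigma_process_ge _ _ _ (Defs.coord B c) _ _ (fun i v => (v - x i ord0 c) ^+ 2) t (fun v => expR (- v / (2 * eps ^+ 2)))) => //.
    by move=> i; apply: measurable_funX; exact: measurable_funB.
  exact: gauss_profile_measurable.
Qed.

Lemma bmfun_prod_kern (h : {ffun 'I_k -> 'I_N}) x : bmfun (fun w => \prod_(j < k) kern j (h j) x w).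
Proof.
apply: bmfun_prod => j; split; last first.
  by exists 1 => w; have /andP[h0 h1] := kern_bound j (h j) x w; rewrite ger0_norm.
apply: (measurableT_comp gauss_profile_measurable).
apply: measurable_sum => c; apply: measurable_funX; apply: measurable_funB => //.
by rewrite -ffun_natE; exact: coord_measurable (gt_ge0 _ _).
Qed.

Lemma prod_sum_kern x w : \prod_(j < k) \sum_(l < N) kern j l x w =
  \sum_(h : {ffun 'I_k -> 'I_N}) \prod_(j < k) kern j (h j) x w.
Proof. by rewrite (bigA_distr_bigA (fun (j : 'I_k) (l : 'I_N) => kern j l x w)). Qed.

Definition cfirst : R := (2^-1) ^+ d * ((Num.sqrt (1 + cmajor H k * tau `^ a))^-1 ^+ k) ^+ d.

(** Each of the N^k families of grid times contributes at least a constant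
    times eps^(d k) = N^-k. *)
Lemma first_moment_pt (x : 'rV[R]_d) (M : R) : (forall c, `|x ord0 c| <= M) ->
  scale_large H k tau M ->
  cfirst <= Ex P (fun w => \prod_(j < k) \sum_(l < N) kern j l x w).
Proof.
move=> xM sc.
rewrite (@eq_Ex _ _ _ _ _ (fun w : T => \sum_(h : {ffun 'I_k -> 'I_N}) \prod_(j < k) kern j (h j) x w)); last first.
  by move=> w; exact: prod_sum_kern.
rewrite Ex_sum; last by move=> h; exact: bmfun_prod_kern.
have m0 : 0 < eps by exact: mesh_gt0.
have m1 : eps <= 1.
  rewrite /mesh invf_le1 ?powR_gt0//.
  have H0 : 0 <= H by move: a0; rewrite pmulr_rgt0// => /ltW.
  by rewrite -[leLHS](one_powR H) ge0_ler_powR// ?nnegrE// ler1n.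
(* here H d = 1 enters *)
have md : eps ^+ d = N%:R^-1 by rewrite /mesh exprVn powR_H_d.
apply: (@le_trans _ _ (\sum_(h : {ffun 'I_k -> 'I_N}) cfirst * N%:R^-1 ^+ k)).
  rewrite sumr_const card_ffun !card_ord -[_ *+ (N ^ k)]mulr_natr -mulrA natrX -exprMn mulVf ?gt_eqF//.
  by rewrite expr1n mulr1.
apply: ler_sum => h _.
under eq_Ex do rewrite prod_kern.
rewrite (indep_coord (fun j : 'I_k => x) (fun j : 'I_k => gt_ge0 h j)).
have -> : cfirst * N%:R^-1 ^+ k = \prod_(c < d) (2^-1 * ((Num.sqrt (1 + cmajor H k * tau `^ a))^-1 * eps) ^+ k).
  by rewrite prodr_const card_ord /cfirst exprMn -mulrA; congr (_ * _); rewrite [in RHS]exprMn [in RHS]exprMn -md -!exprM [(d * k)%N]mulnC.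
apply: ler_prod => c _; apply/andP; split.
  by rewrite mulr_ge0// exprn_ge0// mulr_ge0 ?(ltW m0)// invr_ge0 sqrtr_ge0.
have := @comp_lower _ _ _ P H (Defs.coord B c) (fbm_coord fB c) a0 a1 k tau k0 tau0
  (fun j => gt j (ffun_nat h j)) (grid_block tau1 N0 (ffun_nat_lt h)) (x ord0 c) M eps m0 m1 (xM c) sc.
by [].
Qed.

Definition cpair : R := (cgrid H k) ^+ d * expC d.
(** Unit of length in which the decay of comp_upper_grid becomes exp (- k
    y^2). *)
Definition kappa : R := Num.sqrt (18 * k%:R * tau `^ a).

Lemma kappa_gt0 : 0 < kappa.
Proof. by rewrite sqrtr_gt0 !mulr_gt0 ?ltr0n ?powR_gt0. Qed.

Lemma enorm_sq (x : 'rV[R]_d) : enorm x ^+ 2 = \sum_(c < d) x ord0 c ^+ 2.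
Proof. by rewrite /enorm sqr_sqrtr// sumr_ge0// => c _; exact: sqr_ge0. Qed.

(** Raising the bounds of comp_upper_grid to the power d removes the exponent
    H: the j-th pair costs 1 / (N (m_j + 1)). The decay is shared among the k
    pairs and, by exp_sq_le, turned into the factor 1 / (1 + A / (m_j + 1)),
    which truncates the harmonic sum at m_j of order A. *)
Lemma pair_moment (h h' : {ffun 'I_k -> 'I_N}) (x y : 'rV[R]_d) : 0 < enorm (y - x) ->
  Ex P (fun w => (\prod_(j < k) kern j (h j) x w) * \prod_(j < k) kern j (h' j) y w) <=
  \prod_(j < k) (cpair / N%:R * ((ndist (h j) (h' j)).+1%:R + (enorm (y - x) / kappa) ^+ d * N%:R)^-1).
Proof.
set rho := enorm (y - x) => rho0; set A := (rho / kappa) ^+ d * N%:R.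
pose tt (i : bool * 'I_k) := if i.1 then gt i.2 (ffun_nat h i.2) else gt i.2 (ffun_nat h' i.2).
pose xx (i : bool * 'I_k) := if i.1 then x else y.
have tt0 i : 0 <= tt i by rewrite /tt; case: ifP => _; exact: gt_ge0.
have E c w : \sum_i (Defs.coord B c (tt i) w - xx i ord0 c) ^+ 2 =
   \sum_(j < k) ((Defs.coord B c (gt j (ffun_nat h j)) w - x ord0 c) ^+ 2 +
     (Defs.coord B c (gt j (ffun_nat h' j)) w - y ord0 c) ^+ 2).
  by rewrite sum_pair_family.
rewrite (@eq_Ex _ _ _ _ _ (fun w : T => \prod_(c < d) expR (- (\sum_i (Defs.coord B c (tt i) w - xx i ord0 c) ^+ 2) / (2 * eps ^+ 2)))); last first.
  move=> w; rewrite !prod_kern -big_split/=; apply: eq_bigr => c _.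
  by rewrite E big_split/= -expRD; congr expR; ring.
rewrite (indep_coord _ tt0).
pose m (j : nat) := ndist (ffun_nat h j) (ffun_nat h' j).
pose z (i : 'I_k) := rho ^+ 2 * ((N%:R / (m i).+1%:R) `^ H) ^+ 2 / (18 * tau `^ a).
pose D := \prod_(j < k) (cgrid H k ^+ d * N%:R^-1 * ((m j).+1%:R)^-1).
have cg0 : 0 <= cgrid H k :> R by exact: cgrid_ge0.
have D0 : 0 <= D by apply: prodr_ge0 => j _; rewrite !mulr_ge0 ?exprn_ge0.
have main i0 : \prod_(c < d) Ex P (fun w => expR (- (\sum_i (Defs.coord B c (tt i) w - xx i ord0 c) ^+ 2) / (2 * eps ^+ 2))) <=
    D * expR (- z i0).
  have -> : D * expR (- z i0) = \prod_(c < d)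
     (expR (- ((y ord0 c - x ord0 c) ^+ 2 * ((N%:R / (m i0).+1%:R) `^ H) ^+ 2 / (18 * tau `^ a))) *
      \prod_(j < k) (cgrid H k * (N%:R `^ H)^-1 * ((m j).+1%:R `^ H)^-1)).
    rewrite big_split/= mulrC; congr (_ * _).
      rewrite -expR_sum; congr expR; rewrite sumrN; congr (- _).
      rewrite /z /rho enorm_sq -mulrA mulr_suml; apply: eq_bigr => c _.
      by rewrite !mxE mulrA.
    rewrite exchange_big/= /D; apply: eq_bigr => j _.
    by rewrite prodr_const card_ord !exprMn !exprVn !powR_H_d.
  apply: ler_prod => c _; apply/andP; split.
    by apply: Ex_ge0 => w; exact: expR_ge0.
  under eq_Ex do rewrite E.
  exact: (comp_upper_grid (fbm_coord fB c) a0 a1 k0 tau1 N0 _ _ i0 (ffun_nat_lt h) (ffun_nat_lt h')).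
apply: le_trans (le_expR_mean k0 D0 main) _.
rewrite /D -big_split/=; apply: ler_prod => j _.
rewrite !mulr_ge0 ?exprn_ge0 ?expR_ge0//=.
rewrite -!ffun_natE -/(m j).
have m0 : 0 < (m j).+1%:R :> R by rewrite ltr0n.
have t0 : 0 < tau `^ a by rewrite powR_gt0.
pose y0 := rho / kappa * (N%:R / (m j).+1%:R) `^ H.
have kp := kappa_gt0.
have kR : 0 < k%:R :> R by rewrite ltr0n.
have y00 : 0 <= y0 by rewrite mulr_ge0 ?powR_ge0// divr_ge0 ?(ltW rho0) ?(ltW kp).
(* the constant 18 k tau^a in kappa is chosen for this identity *)
have zE : z j / k%:R = y0 ^+ 2.
  have kE : kappa ^+ 2 = 18 * k%:R * tau `^ a by rewrite sqr_sqrtr// !mulr_ge0 ?powR_ge0.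
  rewrite /y0 exprMn expr_div_n kE.
  by rewrite /z; field; rewrite !gt_eqF.
have yE : y0 ^+ d = A / (m j).+1%:R.
  by rewrite /y0 exprMn powR_H_d ?divr_ge0// /A mulrA.
have := exp_sq_le d_gt0 y00; rewrite -zE yE => hE.
have A0 : 0 < A by rewrite mulr_gt0// exprn_gt0// divr_gt0.
have -> : cpair / N%:R * ((m j).+1%:R + A)^-1 =
    cgrid H k ^+ d / N%:R / (m j).+1%:R * (expC d / (1 + A / (m j).+1%:R)).
  have mA : 0 < (m j).+1%:R + A by rewrite addr_gt0.
  have mA' : 1 + A / (m j).+1%:R = ((m j).+1%:R + A) / (m j).+1%:R.
    by rewrite [RHS]mulrDl mulfV ?gt_eqF.
  rewrite mA' /cpair; move: (m j).+1%:R m0 mA {mA'} => q m0 mA; field.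
  by rewrite (gt_eqF NR) (gt_eqF m0) (gt_eqF mA).
rewrite ler_wpM2l//; first by rewrite !mulr_ge0 ?exprn_ge0.
have q0 : 0 < 1 + A / (m j).+1%:R by rewrite addr_gt0// divr_gt0.
by rewrite ler_pdivlMr// mulrC; exact: hE.
Qed.

Definition csecond : R := 2 * cpair * d%:R.

(** The sum over pairs of grid families factorizes over the blocks into k
    equal truncated harmonic sums. *)
Lemma second_moment_pt (x y : 'rV[R]_d) : 0 < enorm (y - x) ->
  Ex P (fun w => (\prod_(j < k) \sum_(l < N) kern j l x w) *
                 \prod_(j < k) \sum_(l < N) kern j l y w) <=
  (csecond * (ln (1 + kappa) + Num.max (ln (enorm (y - x))^-1) 0)) ^+ k.
Proof.
set rho := enorm (y - x) => rho0.
rewrite (@eq_Ex _ _ _ _ _ (fun w : T => \sum_(h : {ffun 'I_k -> 'I_N}) \sum_(h' : {ffun 'I_k -> 'I_N})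
   (\prod_(j < k) kern j (h j) x w) * \prod_(j < k) kern j (h' j) y w)); last first.
  by move=> w; rewrite !prod_sum_kern mulr_suml; apply: eq_bigr => h _; rewrite mulr_sumr.
rewrite Ex_sum; last by move=> h; apply: bmfun_sum => h'; apply: bmfunM; exact: bmfun_prod_kern.
set A := (rho / kappa) ^+ d * N%:R.
have kp := kappa_gt0.
have A0 : 0 < A by rewrite mulr_gt0// exprn_gt0// divr_gt0.
pose F (m : nat) := cpair / N%:R * (m.+1%:R + A)^-1.
have cp0 : 0 <= cpair.
  by rewrite mulr_ge0 ?(ltW (expC_gt0 d))// exprn_ge0// cgrid_ge0.
have F0 m : 0 <= F m.
  by rewrite mulr_ge0 ?divr_ge0// invr_ge0 addr_ge0// ltW.
apply: (@le_trans _ _ (\sum_(h : {ffun 'I_k -> 'I_N}) \sum_(h' : {ffun 'I_k -> 'I_N})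
   \prod_(j < k) F (ndist (h j) (h' j)))).
  apply: ler_sum => h _; rewrite Ex_sum; last by move=> h'; apply: bmfunM; exact: bmfun_prod_kern.
  by apply: ler_sum => h' _; exact: pair_moment.
rewrite (eq_bigr (fun h : {ffun 'I_k -> 'I_N} => \prod_(j < k) \sum_(l < N) F (ndist (h j) l))); last first.
  by move=> h _; rewrite (bigA_distr_bigA (fun (j : 'I_k) (l : 'I_N) => F (ndist (h j) l))).
rewrite -(bigA_distr_bigA (fun (j : 'I_k) (l : 'I_N) => \sum_(l' < N) F (ndist l l'))).
rewrite prodr_const card_ord.
have S0 : 0 <= \sum_(l < N) \sum_(l' < N) F (ndist l l').
  by apply: sumr_ge0 => l _; exact: sumr_ge0.
have h1 := sum_ndist N F0.
have h2 : 2 * N%:R * \sum_(m < N) F m <= 2 * cpair * ln ((N%:R + A) / A).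
  rewrite /F -mulr_sumr.
  have -> : 2 * N%:R * (cpair / N%:R * \sum_(i < N) (i.+1%:R + A)^-1) =
    2 * cpair * \sum_(i < N) (i.+1%:R + A)^-1 by field; rewrite gt_eqF.
  apply: ler_wpM2l; first exact: mulr_ge0.
  exact: harmonic_ln.
have h3 : ln ((N%:R + A) / A) <= d%:R * (ln (1 + kappa) + Num.max (ln rho^-1) 0).
  have -> : (N%:R + A) / A = 1 + ((rho / kappa) ^+ d)^-1.
    rewrite mulrDl mulfV ?gt_eqF// addrC; congr (_ + _).
    by rewrite /A invfM mulrCA mulfV ?mulr1// gt_eqF.
  exact: ln_1DV rho0 kp d_gt0.
have h4 : \sum_(l < N) \sum_(l' < N) F (ndist l l') <=
    csecond * (ln (1 + kappa) + Num.max (ln rho^-1) 0).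
  apply: le_trans h1 (le_trans h2 _).
  rewrite /csecond -[leRHS]mulrA; apply: ler_wpM2l => //; exact: mulr_ge0.
by rewrite lerXn2r// nnegrE// (le_trans S0).
Qed.

End moments.
(** * The Paley-Zygmund inequality and mixtures *)

Section paley_zygmund.
Context {disp : measure_display} {T : measurableType disp} {R : realType}.
Variable P : probability T R.

(** Instead of the Cauchy-Schwarz inequality, Z 1_(Z >= a / 2) is bounded
    pointwise by l Z^2 / 2 + 1_(Z >= a / 2) / (2 l), with l chosen so that the
    first term takes a quarter of a. *)
Lemma paley_zygmund (Z : T -> R) (a b : R) : bmfun Z -> (forall w, 0 <= Z w) ->
  0 < a -> 0 < b -> a <= Ex P Z -> Ex P (fun w => Z w ^+ 2) <= b ->
  a ^+ 2 / (4 * b) <= fine (P [set w | a / 2 <= Z w]).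
Proof.
move=> bZ Z0 a0 b0 aZ Zb; set A := [set w | _].
have mA : measurable A.
  have := bZ.1 measurableT `[a / 2, +oo[%classic (measurable_itv _).
  by rewrite setTI; congr measurable; apply/seteqP; split => w /=; rewrite in_itv/= andbT.
have bA := bmfun_indic mA.
(* the value of l for which l b / 2 = a / 4 *)
pose l := a / (2 * b).
have l0 : 0 < l by rewrite divr_gt0// mulr_gt0.
have bZ2 : bmfun (fun w => Z w ^+ 2) by under eq_fun do rewrite expr2; exact: bmfunM.
have zl w : Z w <= a / 2 + (l / 2 * Z w ^+ 2 + (2 * l)^-1 * \1_A w).
  have h2 : 0 <= l / 2 * Z w ^+ 2 by rewrite mulr_ge0 ?sqr_ge0// divr_ge0 ?(ltW l0).
  rewrite indicE; have [Aw|nA] := pselect (A w).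
    rewrite mem_set// mulr1.
    have h : 0 <= (2 * l)^-1 * (l * Z w - 1) ^+ 2.
      by rewrite mulr_ge0 ?sqr_ge0// invr_ge0 mulr_ge0// ltW.
    have E : (2 * l)^-1 * (l * Z w - 1) ^+ 2 = l / 2 * Z w ^+ 2 + (2 * l)^-1 - Z w.
      by field; rewrite gt_eqF.
    rewrite E subr_ge0 in h; apply: le_trans h _; rewrite lerDr divr_ge0//; exact: ltW.
  rewrite memNset// mulr0 addr0 (@le_trans _ _ (a / 2)) ?lerDl//.
  by rewrite ltW// ltNge; apply/negP.
have := le_Ex P bZ _ zl.
have bl : bmfun (fun w => l / 2 * Z w ^+ 2) by apply: bmfunM => //; exact: bmfun_cst.
have bi : bmfun (fun w => (2 * l)^-1 * \1_A w : R) by apply: bmfunM => //; exact: bmfun_cst.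
have bs := bmfunD bl bi.
move=> /(_ (bmfunD (bmfun_cst _) bs)).
rewrite ExD//; last exact: bmfun_cst.
rewrite Ex_cst ExD// !ExZ// Ex_indic// => h.
set p := fine _ in h *.
have h1 : l / 2 * Ex P (fun w => Z w ^+ 2) <= l / 2 * b.
  by rewrite ler_wpM2l// divr_ge0// ltW.
have lb : l / 2 * b = a / 4 by rewrite /l; field; rewrite gt_eqF.
have h2 : a / 4 <= (2 * l)^-1 * p by lra.
have l1 : (2 * l)^-1 = b / a by rewrite /l; field; rewrite !gt_eqF.
have -> : a ^+ 2 / (4 * b) = a / b * (a / 4) by field; rewrite gt_eqF.
have -> : p = a / b * (b / a * p) by field; rewrite !gt_eqF.
by rewrite -l1 ler_wpM2l// divr_ge0// ltW.
Qed.

End paley_zygmund.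

Section mixture.
Context {d1 d2 : measure_display} {V : measurableType d1} {T : measurableType d2} {R : realType}.
Variables (mu : probability V R) (P : probability T R) (f : V * T -> R).
Hypothesis bf : bmfun f.

Lemma Ex_mixture : Ex P (fun w => Ex mu (fun x => f (x, w))) = Ex mu (fun x => Ex P (fun w => f (x, w))).
Proof. by rewrite (Ex_fubini mu P bf). Qed.

Lemma bmfun_comp {d3} {U : measurableType d3} (g : U -> V * T) :
  measurable_fun setT g -> bmfun (fun u => f (g u)).
Proof.
move=> mg; have [mf [M fM]] := bf; split; last by exists M.
exact: measurableT_comp.
Qed.

Lemma bmfun_double : bmfun (fun z : (V * V) * T => f (z.1.1, z.2) * f (z.1.2, z.2)).
Proof.
apply: bmfunM; apply: bmfun_comp.
  apply/measurable_fun_pairP; split => /=; last exact: measurable_snd.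
  exact: (measurableT_comp measurable_fst measurable_fst).
apply/measurable_fun_pairP; split => /=; last exact: measurable_snd.
exact: (measurableT_comp measurable_snd measurable_fst).
Qed.

Lemma bmfun_pair_correlation : bmfun (fun z : V * V => Ex P (fun w => f (z.1, w) * f (z.2, w))).
Proof. exact: (bmfun_Ex1 (mu \x mu)%E P bmfun_double). Qed.

(** The square of an average is a double average over two replicas. *)
Lemma Ex_mixture_sq : Ex P (fun w => Ex mu (fun x => f (x, w)) ^+ 2) =
  Ex mu (fun x => Ex mu (fun y => Ex P (fun w => f (x, w) * f (y, w)))).
Proof.
rewrite -(Ex_prod1 mu mu bmfun_pair_correlation) (Ex_fubini (mu \x mu)%E P bmfun_double)/=.
apply: eq_Ex => w.
rewrite (Ex_prod1 mu mu (bmfun_pair2 w bmfun_double))/= expr2.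
rewrite -(ExZ mu _ (bmfun_pair2 w bf)); apply: eq_Ex => x.
by rewrite mulrC -(ExZ mu _ (bmfun_pair2 w bf)).
Qed.

End mixture.
(** * Borel probabilities of finite logarithmic energy *)

Section borel_vectors.
Context {R : realType} {d : nat}.
Local Notation V := (borel 'rV[R]_d).

Lemma coord_borel (c : 'I_d) : measurable_fun setT (fun x : V => (x : 'rV[R]_d) ord0 c).
Proof.
apply: (measurability _ (RGenOInfty.measurableE R)).
move=> _ [_ [r ->] <-]; rewrite setTI; apply: sub_sigma_algebra.
apply: (@open_comp 'rV[R]_d R (fun x => x ord0 c)); last exact: interval_open.
by move=> x _; exact: coord_continuous.
Qed.

Lemma open_borel (A : set 'rV[R]_d) : open A -> measurable (A : set V).
Proof. exact: sub_sigma_algebra. Qed.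

Lemma closed_borel (A : set 'rV[R]_d) : closed A -> measurable (A : set V).
Proof.
by move=> cA; rewrite -[A]setCK; apply: measurableC; apply: open_borel; exact: closed_openC.
Qed.

Lemma enorm_ge0 (x : 'rV[R]_d) : 0 <= enorm x. Proof. exact: sqrtr_ge0. Qed.

Lemma enorm_sub_measurable : measurable_fun setT
  (fun z : V * V => enorm ((z.2 : 'rV[R]_d) - (z.1 : 'rV[R]_d))).
Proof.
have -> : (fun z : V * V => enorm ((z.2 : 'rV[R]_d) - (z.1 : 'rV[R]_d))) = Num.sqrt \o
  (fun z : V * V => \sum_(c < d) ((z.2 : 'rV[R]_d) - (z.1 : 'rV[R]_d)) ord0 c ^+ 2) by [].
apply: measurableT_comp.
  apply: continuous_measurable_fun; exact: sqrt_continuous.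
apply: measurable_sum => c; apply: measurable_funX.
under eq_fun do rewrite !mxE.
apply: measurable_funB.
  exact: (measurableT_comp (coord_borel c) measurable_snd).
exact: (measurableT_comp (coord_borel c) measurable_fst).
Qed.

Lemma log_plus_invE (s : R) : log_plus_inv s =
  if s == 0 then +oo%E else (Num.max (ln s^-1) 0)%:E.
Proof.
rewrite /log_plus_inv inver; case: ifPn => [_|s0].
  by rewrite /lne maxye.
rewrite /lne EFin_max; case: ifPn => // h.
by rewrite ln0// maxNye maxxx.
Qed.

Lemma log_plus_inv_ge0 (s : R) : (0 <= log_plus_inv s)%E.
Proof. by rewrite /log_plus_inv le_max lexx orbT. Qed.

Lemma log_plus_inv_measurable : measurable_fun setT (@log_plus_inv R).
Proof.
have -> : @log_plus_inv R = (fun s : R => if s == 0 then +oo%E else (Num.max (ln s^-1) 0)%:E).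
  by apply/funext => s; exact: log_plus_invE.
apply: measurable_fun_ifT => //; first exact: measurable_fun_eqr.
apply/measurable_EFinP; apply: measurable_maxr => //.
apply: (@eq_measurable_fun _ _ _ _ _ (fun s : R => if 0 < s then - ln s else 0)).
  move=> s _; case: ifPn => [s0|]; first by rewrite lnV.
  by rewrite -leNgt => s0; rewrite ln0// invr_le0.
apply: measurable_fun_ifT => //; first exact: measurable_fun_ltr.
by apply: measurable_funN; exact: measurable_ln.
Qed.

Lemma expe_measurable {disp} {T : measurableType disp} (f : T -> \bar R) k :
  measurable_fun setT f -> measurable_fun setT (fun x => f x ^+ k)%E.
Proof.
move=> mf; elim: k => [|k IH]; first exact: measurable_cst.
by under eq_fun do rewrite expeS; exact: emeasurable_funM.
Qed.

Variable k : nat.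
Local Notation phi := (fun s : R => log_plus_inv s ^+ k)%E.

Lemma log_kernel_measurable : measurable_fun setT
  (fun z : V * V => phi (enorm ((z.2 : 'rV[R]_d) - (z.1 : 'rV[R]_d)))).
Proof.
apply: expe_measurable.
exact: (measurableT_comp log_plus_inv_measurable enorm_sub_measurable).
Qed.

Lemma log_kernel_ge0 s : (0 <= phi s)%E.
Proof. by apply: expe_ge0; exact: log_plus_inv_ge0. Qed.

(** The infimum of the energies is finite, since its inverse is positive. *)
Lemma finite_energy (E : set 'rV[R]_d) : (0 < capacity phi E)%E ->
  exists2 mu : probability V R, mu E = 1%E & (energy phi E mu < +oo)%E.
Proof.
rewrite /capacity => c0.
have : (ereal_inf [set energy phi E mu | mu in
    [set mu : probability V R | mu E = 1%E]] < +oo)%E.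
  by rewrite ltey; apply/eqP => h; move: c0; rewrite h invey ltxx.
by move=> /ereal_inf_lt[_ [mu mu1 <-] h]; exists mu.
Qed.

Lemma compact_coord_bounded (E : set 'rV[R]_d) : compact E ->
  exists M : R, forall x, E x -> forall c, `|x ord0 c| <= M.
Proof.
move=> /compact_bounded/ex_strict_bound_gt0[M _ hM]; exists M => x Ex c.
apply: le_trans (ltW (hM x Ex)); rewrite [X in _ <= X]/Num.norm/= mx_normrE.
exact: (le_bigmax _ (fun ij => `|x ij.1 ij.2|) (ord0, c)).
Qed.

Variables (E : set 'rV[R]_d) (mu : probability V R).
Hypotheses (mE : measurable (E : set V)) (mu1 : mu E = 1%E).

Let potential (x : V) := (\int[mu]_(y in E) phi (enorm ((y : 'rV[R]_d) - (x : 'rV[R]_d))))%E.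

(** Tonelli, after moving the restriction to E into the integrand. *)
Lemma potential_measurable : measurable_fun setT potential.
Proof.
have -> : potential = fubini_F mu (fun z : V * V =>
    phi (enorm ((z.2 : 'rV[R]_d) - (z.1 : 'rV[R]_d))) * (\1_E z.2)%:E)%E.
  apply/funext => x; rewrite /potential /fubini_F [LHS]integral_mkcond.
  by apply: eq_integral => y _; rewrite epatch_indic.
apply: measurable_fun_fubini_tonelli_F.
  apply: emeasurable_funM; first exact: log_kernel_measurable.
  apply/measurable_EFinP; apply: (measurableT_comp _ measurable_snd).
  exact: measurable_indic.
by move=> z; rewrite mule_ge0 ?log_kernel_ge0// lee_fin.
Qed.

Lemma potential_ge0 x : (0 <= potential x)%E.
Proof. by apply: integral_ge0 => y _; exact: log_kernel_ge0. Qed.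

Lemma integral_affine_le (f g : V -> \bar R) (K : R) : 0 <= K ->
  measurable_fun setT f -> measurable_fun setT g ->
  (forall x, 0 <= f x)%E -> (forall x, 0 <= g x)%E ->
  (forall x, E x -> f x <= K%:E + K%:E * g x)%E ->
  (\int[mu]_(x in E) f x <= K%:E + K%:E * \int[mu]_(x in E) g x)%E.
Proof.
move=> K0 mf mg f0 g0 fg.
have mf' : measurable_fun (E : set V) f by exact: measurable_funTS.
have mg' : measurable_fun (E : set V) g by exact: measurable_funTS.
have mKg : measurable_fun (E : set V) (fun x => K%:E * g x)%E.
  by apply: emeasurable_funM.
apply: (@le_trans _ _ (\int[mu]_(x in E) (K%:E + K%:E * g x))%E).
  apply: ge0_le_integral => //; apply: emeasurable_funD => //.
rewrite ge0_integralD//; last by move=> x _; rewrite mule_ge0.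
have -> : (\int[mu]_(x in E) K%:E = K%:E)%E.
  by rewrite integral_cst// -[RHS]mule1; congr mule; exact: mu1.
by rewrite ge0_integralZl_EFin.
Qed.

(** The pointwise bound is integrated in y and then in x; the additive
    constant survives both integrations because mu is carried by E. *)
Lemma Ex_le_energy (G : V * V -> R) (K : R) : bmfun G -> (forall z, 0 <= G z) ->
  (forall x y, ~ (E x /\ E y) -> G (x, y) = 0) -> 0 <= K ->
  (forall x y : 'rV[R]_d, E x -> E y -> (G (x, y))%:E <= K%:E + K%:E * phi (enorm (y - x)))%E ->
  ((Ex mu (fun x => Ex mu (fun y => G (x, y))))%:E <=
    K%:E + K%:E * energy phi E mu)%E.
Proof.
move=> bG G0 Goff K0 GK.
have bG1 := bmfun_Ex1 mu mu bG.
rewrite EFin_Ex//.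
have restr (h : V -> \bar R) : (forall x, ~ E x -> h x = 0%E) ->
    (\int[mu]_x h x = \int[mu]_(x in E) h x)%E.
  move=> h0; rewrite [RHS]integral_mkcond; apply: eq_integral => x _.
  by rewrite patchE; case: ifPn => // /negP; rewrite in_setE => /h0.
rewrite restr; last first.
  move=> x nx; rewrite (@eq_Ex _ _ _ _ _ (fun=> 0)) ?Ex_cst// => y.
  by apply: Goff => -[].
apply: integral_affine_le => //.
- by apply/measurable_EFinP; exact: bG1.1.
- exact: potential_measurable.
- by move=> x; rewrite lee_fin; apply: Ex_ge0.
- exact: potential_ge0.
move=> x Ex_; have bGx := bmfun_pair1 (x : V) bG.
rewrite EFin_Ex// restr; last by move=> y ny; rewrite Goff// => -[].
apply: integral_affine_le => //.
- by apply/measurable_EFinP; exact: bGx.1.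
- exact: (measurableT_comp log_kernel_measurable (measurable_pair1 (x : V))).
- by move=> y; rewrite lee_fin.
- by move=> y; exact: log_kernel_ge0.
- by move=> y Ey; exact: GK.
Qed.

End borel_vectors.
(** * Near hits with probability bounded below *)

Section near_hits.
Context {disp : measure_display} {T : measurableType disp} {R : realType}.
Variables (P : probability T R) (d : nat) (H : R) (B : R -> T -> 'rV[R]_d).
Hypothesis fB : fbm P H B.
Local Notation a := (2 * H).
Hypotheses (a0 : 0 < a) (a1 : a <= 1) (Hd : H * d%:R = 1).
Variables (k : nat).
Hypotheses (k0 : (0 < k)%N).
Local Notation V := (borel 'rV[R]_d).

Definition dist_sq (t : nat -> R) (x : 'rV[R]_d) (w : T) : R :=
  \sum_(j < k) \sum_(c < d) (Defs.coord B c (t j) w - x ord0 c) ^+ 2.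

Definition chits (v : R) : R := 2 * (`|ln (v / 2)| + k%:R / H).

Lemma hurst_gt0 : 0 < H. Proof. by move: a0; rewrite pmulr_rgt0. Qed.

Lemma mesh_le1 N : (0 < N)%N -> mesh H N <= 1.
Proof.
move=> N0; rewrite /mesh invf_le1 ?powR_gt0 ?ltr0n//.
by rewrite -[leLHS](one_powR H) ge0_ler_powR ?(ltW hurst_gt0)// ?nnegrE// ler1n.
Qed.

(** One of the N^k summands is at least v / (2 N^k), which bounds its exponent
    by a constant plus k ln N <= k N^H / H. After multiplication with eps^2
    the bound is of order eps. *)
Lemma mass_near_hit (tau : R) N x w (v : R) : 1 <= tau -> (0 < N)%N -> 0 < v ->
  v <= \prod_(j < k) \sum_(l < N) kern H B tau N j l x w ->
  exists2 t, block_times tau t & dist_sq t x w <= chits v * mesh H N.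
Proof.
move=> tau1 N0 v0 vZ.
have NR : 0 < N%:R :> R by rewrite ltr0n.
have Nk : 0 < N%:R ^+ k :> R by rewrite exprn_gt0.
have [h hh] : exists h : {ffun 'I_k -> 'I_N}, v / 2 / N%:R ^+ k < \prod_(j < k) kern H B tau N j (h j) x w.
  apply/not_existsP => no; move: vZ; rewrite prod_sum_kern leNgt => /negP; apply.
  apply: (@le_lt_trans _ _ (\sum_(h : {ffun 'I_k -> 'I_N}) v / 2 / N%:R ^+ k)).
    by apply: ler_sum => h _; rewrite leNgt; apply/negP; exact: no.
  rewrite sumr_const card_ffun !card_ord -[_ *+ (N ^ k)]mulr_natr natrX divfK ?gt_eqF//.
  by rewrite ltr_pdivrMr// mulr_natr mulr2n ltrDl.
exists (fun j => grid_time tau N j (ffun_nat h j)).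
  exact: (grid_block tau1 N0 (ffun_nat_lt N0 h)).
set S := dist_sq _ _ _.
have m0 : 0 < mesh H N := mesh_gt0 H N0.
have E : \prod_(j < k) kern H B tau N j (h j) x w = expR (- S / (2 * mesh H N ^+ 2)).
  rewrite -expR_sum; congr expR; rewrite -mulr_suml sumrN; congr (- _ / _).
  by apply: eq_bigr => j _; rewrite ffun_natE.
move: hh; rewrite E -ltr_ln ?posrE ?expR_gt0 ?divr_gt0// expRK.
have -> : ln (v / 2 / N%:R ^+ k) = ln (v / 2) - k%:R * ln N%:R.
  by rewrite ln_div ?posrE ?divr_gt0// lnXn// mulr_natl.
have NH : 0 < N%:R `^ H :> R by rewrite powR_gt0.
have lnN : ln N%:R <= N%:R `^ H / H.
  rewrite ler_pdivlMr ?hurst_gt0// mulrC -ln_powR.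
  exact: ltW (ln_sublinear NH).
move=> hh.
have m2 : 0 < 2 * mesh H N ^+ 2 by rewrite mulr_gt0// exprn_gt0.
have : S < 2 * mesh H N ^+ 2 * (`|ln (v / 2)| + k%:R * (N%:R `^ H / H)).
  rewrite mulrC -ltr_pdivrMr//.
  have h1 : k%:R * ln N%:R <= k%:R * (N%:R `^ H / H) :> R by rewrite ler_wpM2l.
  have h2 : - ln (v / 2) <= `|ln (v / 2)| by rewrite -normrN ler_norm.
  move: hh; rewrite mulNr => hh.
  by move: (S / _) (ln (v / 2)) (ln N%:R) hh h1 h2 => *; lra.
move/ltW/le_trans; apply.
have mN : mesh H N * N%:R `^ H = 1 by rewrite /mesh mulVf// gt_eqF.
have m1 := mesh_le1 N0.
move: (mesh H N) (N%:R `^ H) mN m0 m1 => m n mN m0 m1.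
have -> : 2 * m ^+ 2 * (`|ln (v / 2)| + k%:R * (n / H)) =
  2 * (m * (m * `|ln (v / 2)|) + (m * n) * m * (k%:R / H)) by ring.
rewrite /chits mN mul1r -mulrA ler_pM2l// mulrDl [k%:R / H * m]mulrC lerD2r.
rewrite [leRHS]mulrC ler_pM2l// ler_piMl//.
Qed.

Variable E : set 'rV[R]_d.
Hypothesis cE : compact E.

Definition local_mass (tau : R) (N : nat) (z : V * T) : R :=
  \1_E (z.1 : 'rV[R]_d) * \prod_(j < k) \sum_(l < N) kern H B tau N j l z.1 z.2.

Lemma compact_borel : measurable (E : set V).
Proof. by apply: closed_borel; exact: compact_closed cE. Qed.

Lemma kern_measurable2 tau N j l : 1 <= tau -> (0 < N)%N -> (l < N)%N ->
  bmfun (fun z : V * T => kern H B tau N j l (z.1 : 'rV[R]_d) z.2).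
Proof.
move=> tau1 N0 lN; split; last first.
  by exists 1 => z; have /andP[h0 h1] := kern_bound H B tau N0 j l z.1 z.2; rewrite ger0_norm.
have t0 : 0 <= grid_time tau N j l.
  by apply: (block_times_ge0 (lt_le_trans ltr01 tau1) j (grid_block tau1 N0 (l := fun=> l) (fun=> lN))).
apply: (measurableT_comp (gauss_profile_measurable H N)).
apply: measurable_sum => c; apply: measurable_funX; apply: measurable_funB.
  exact: (measurableT_comp (coord_measurable fB c t0) measurable_snd).
exact: (measurableT_comp (coord_borel c) measurable_fst).
Qed.

Lemma bmfun_local_mass tau N : 1 <= tau -> (0 < N)%N -> bmfun (local_mass tau N).
Proof.
move=> tau1 N0; apply: bmfunM.
  have [m1 [M hM]] := bmfun_indic compact_borel (R := R).
  split; last by exists M => z; exact: hM.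
  exact: (measurableT_comp m1 measurable_fst).
apply: bmfun_prod => j; apply: bmfun_sum => l; exact: kern_measurable2.
Qed.

Lemma local_mass_ge0 tau N z : (0 < N)%N -> 0 <= local_mass tau N z.
Proof.
move=> N0; rewrite mulr_ge0//; apply: prodr_ge0 => j _; apply: sumr_ge0 => l _.
by have /andP[] := kern_bound H B tau N0 j l z.1 z.2.
Qed.

Lemma exists_scale (M : R) : exists2 tau, 1 <= tau & scale_large H k tau M.
Proof.
pose X : R := 4 * k%:R * M ^+ 2 * Num.sqrt (2 * cmajor H k / clower H k) ^+ k.
have cl : 0 < clower H k :> R := clower_gt0 a0 a1 k0.
have X0 : 0 <= X by rewrite mulr_ge0 ?exprn_ge0 ?sqrtr_ge0// mulr_ge0 ?sqr_ge0.
exists (Num.max 1 ((X / clower H k) `^ a^-1)); first by rewrite le_max lexx.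
rewrite /scale_large -/X mulrC -ler_pdivrMr//.
apply: (@le_trans _ _ (((X / clower H k) `^ a^-1) `^ a)).
  by rewrite -powRrM mulVf ?gt_eqF// powRr1// divr_ge0// ltW.
by rewrite ge0_ler_powR ?(ltW a0)// ?nnegrE ?le_max ?powR_ge0 ?ler01 ?lexx ?orbT.
Qed.

Lemma csecond_ge0 : 0 <= csecond d H k :> R.
Proof.
have h : 0 <= cgrid H k ^+ d * expC d :> R.
  by apply: mulr_ge0 (ltW (expC_gt0 d)); apply: exprn_ge0; exact: cgrid_ge0.
by apply: mulr_ge0 => //; apply: mulr_ge0.
Qed.

Lemma exprD_le (x y : R) n : 0 <= x -> 0 <= y -> (x + y) ^+ n <= 2 ^+ n * (x ^+ n + y ^+ n).
Proof.
move=> x0 y0; wlog xy : x y x0 y0 / x <= y.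
  move=> h; have [/h|/ltW/h] := leP x y; first exact.
  by rewrite addrC [_ ^+ n + _]addrC; exact.
apply: (@le_trans _ _ ((2 * y) ^+ n)).
  by rewrite lerXn2r ?nnegrE ?addr_ge0 ?mulr_ge0//; lra.
by rewrite exprMn ler_wpM2l ?exprn_ge0// lerDr exprn_ge0.
Qed.

(** From (l0 + L)^k <= 2^k (l0^k + L^k) with l0 = ln (1 + kappa) and L the
    logarithm of the kernel; adding 1 makes the constant positive, which is
    needed on the diagonal, where the kernel is infinite. *)
Definition clog (tau : R) : R := (2 * csecond d H k) ^+ k * (1 + ln (1 + kappa H k tau) ^+ k) + 1.

Lemma clog_gt0 tau : 0 < clog tau.
Proof.
rewrite ltr_wpDl//; apply: mulr_ge0.
  by apply: exprn_ge0; apply: mulr_ge0 => //; exact: csecond_ge0.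
by apply: addr_ge0 => //; apply: exprn_ge0; rewrite ln_ge0// lerDl sqrtr_ge0.
Qed.

(** The real bound off the diagonal in terms of the kernel of the energy; on
    the diagonal the right-hand side is infinite. *)
Lemma second_moment_log tau N (x y : 'rV[R]_d) : 1 <= tau -> (0 < N)%N ->
  ((Ex P (fun w => (\prod_(j < k) \sum_(l < N) kern H B tau N j l x w) *
                 \prod_(j < k) \sum_(l < N) kern H B tau N j l y w))%:E <=
   (clog tau)%:E + (clog tau)%:E * log_plus_inv (enorm (y - x)) ^+ k)%E.
Proof.
move=> tau1 N0; have [r0|] := ltP 0 (enorm (y - x)); last first.
  move=> r0; have -> : enorm (y - x) = 0 by apply/eqP; rewrite eq_le r0 enorm_ge0.
  have -> : (log_plus_inv (0 : R) ^+ k = +oo)%E.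
    rewrite log_plus_invE eqxx; case: k k0 => // n _.
    by elim: n => [|n IH]; rewrite expeS ?IH ?mulyy// expe0 mule1.
  by rewrite gt0_muley ?lte_fin ?clog_gt0// addey ?leey.
rewrite log_plus_invE gt_eqF// -EFin_expe -EFinM -EFinD lee_fin.
apply: le_trans (second_moment_pt fB a0 a1 Hd k0 tau1 N0 r0) _.
set L := Num.max _ _; set l0 := ln _.
have L0 : 0 <= L by rewrite le_max lexx orbT.
have l00 : 0 <= l0 by rewrite ln_ge0// lerDl sqrtr_ge0.
have cs := csecond_ge0; have K0 := clog_gt0 tau.
have h := exprD_le k l00 L0.
have c2 : 0 <= csecond d H k ^+ k :> R by rewrite exprn_ge0.
rewrite exprMn; apply: le_trans (ler_wpM2l c2 h) _.
rewrite mulrA -exprMn [csecond d H k * 2]mulrC.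
rewrite /clog -/l0.
have s0 : 0 <= (2 * csecond d H k) ^+ k :> R by rewrite exprn_ge0// mulr_ge0.
have u0 := exprn_ge0 k l00; have v0 := exprn_ge0 k L0.
move: ((2 * csecond d H k) ^+ k) (l0 ^+ k) (L ^+ k) s0 u0 v0 => s u v s0 u0 v0.
have su : 0 <= s * u by exact: mulr_ge0.
have sv : 0 <= s * v by exact: mulr_ge0.
have suv : 0 <= s * u * v by exact: mulr_ge0.
lra.
Qed.

(** The first and second moments of Z_N are compared with constants that do
    not depend on N, and Paley-Zygmund applies. If the product of kernel sums
    were below v / 4 all over E, then Z_N would be. *)
Lemma near_hits : (0 < capacity (fun s : R => log_plus_inv s ^+ k) E)%E ->
  exists tau C c : R, [/\ 1 <= tau, 0 < c & forall N, (0 < N)%N ->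
    exists F : set T, [/\ measurable F, c <= fine (P F) & forall w, F w ->
      exists2 x, E x & exists2 t, block_times tau t & dist_sq t x w <= C * mesh H N]].
Proof.
move=> /finite_energy[mu mu1 en].
have [M hM] := compact_coord_bounded cE.
have [tau tau1 sc] := exists_scale M.
have mE := compact_borel.
have cs := clog_gt0 tau.
pose v : R := cfirst d H k tau.
have v0 : 0 < v.
  rewrite mulr_gt0 ?exprn_gt0 ?invr_gt0// ?sqrtr_gt0 ltr_pwDl// mulr_ge0 ?powR_ge0//.
  by rewrite mulr_ge0 ?powR_ge0.
have en0 : (0 <= energy (fun s : R => log_plus_inv s ^+ k) E mu)%E.
  by apply: integral_ge0 => x _; apply: integral_ge0 => y _; exact: log_kernel_ge0.
set e := energy _ _ _ in en en0.
have efin : e \is a fin_num by rewrite ge0_fin_numE.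
pose b : R := clog tau + clog tau * fine e.
have b0 : 0 < b by rewrite ltr_pwDl// mulr_ge0 ?(ltW cs)// fine_ge0.
exists tau, (chits (v / 4)), (v ^+ 2 / (4 * b)); split => //.
  by rewrite divr_gt0 ?exprn_gt0// mulr_gt0.
move=> N N0.
have bf := bmfun_local_mass tau1 N0.
have indE x : E x -> \1_E x = 1 :> R by move=> h; rewrite indicE mem_set.
have indN x : ~ E x -> \1_E x = 0 :> R by move=> h; rewrite indicE memNset.
have massE (x : 'rV[R]_d) w : E x -> local_mass tau N (x : V, w) =
    \prod_(j < k) \sum_(l < N) kern H B tau N j l x w.
  by move=> h; rewrite /local_mass/= indE// mul1r.
have massN (x : 'rV[R]_d) w : ~ E x -> local_mass tau N (x : V, w) = 0.
  by move=> h; rewrite /local_mass/= indN// mul0r.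
have f0 z := local_mass_ge0 tau z N0.
pose Z w := Ex mu (fun x => local_mass tau N (x, w)).
have bZ : bmfun Z := bmfun_Ex2 mu P bf.
have Z0 w : 0 <= Z w by apply: Ex_ge0.
have EZ : v <= Ex P Z.
  rewrite /Z Ex_mixture//.
  have -> : v = Ex mu (fun x => v * \1_E x).
    rewrite ExZ; last exact: bmfun_indic.
    by rewrite Ex_indic// (_ : mu E = 1%E)// mulr1.
  apply: le_Ex.
  - by apply: bmfunM; [exact: bmfun_cst|exact: bmfun_indic].
  - exact: (bmfun_Ex1 mu P bf).
  move=> x; have [Ex_|nEx] := pselect (E x); last by rewrite indN// mulr0; apply: Ex_ge0.
  rewrite indE// mulr1 (@eq_Ex _ _ _ _ _ (fun w : T => \prod_(j < k) \sum_(l < N) kern H B tau N j l x w)).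
    exact: (first_moment_pt fB a0 a1 Hd k0 tau1 N0 (hM x Ex_) sc).
  by move=> w; exact: massE.
have EZ2 : Ex P (fun w => Z w ^+ 2) <= b.
  rewrite /Z Ex_mixture_sq// -lee_fin.
  have -> : b%:E = ((clog tau)%:E + (clog tau)%:E * e)%E by rewrite /b EFinD EFinM fineK.
  apply: (Ex_le_energy mE mu1 (bmfun_pair_correlation mu P bf)).
  - by move=> z; apply: Ex_ge0 => w; exact: mulr_ge0.
  - move=> x y nxy /=; rewrite (@eq_Ex _ _ _ _ _ (fun=> 0)) ?Ex_cst// => w.
    have [Ex_|/massN->] := pselect (E x); last by rewrite mul0r.
    have [Ey|/massN->] := pselect (E y); last by rewrite mulr0.
    by case: nxy.
  - exact: ltW.
  move=> x y Ex_ Ey /=.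
  rewrite (@eq_Ex _ _ _ _ _ (fun w : T => (\prod_(j < k) \sum_(l < N) kern H B tau N j l x w) *
      \prod_(j < k) \sum_(l < N) kern H B tau N j l y w)); last by move=> w; rewrite !massE.
  exact: second_moment_log.
exists [set w | v / 2 <= Z w]; split.
- have := bZ.1 measurableT `[v / 2, +oo[%classic (measurable_itv _).
  by rewrite setTI; congr measurable; apply/seteqP; split => w /=; rewrite in_itv/= andbT.
- exact: paley_zygmund.
move=> w /= Zw.
have [x [Ex_ hx]] : exists x, E x /\ v / 4 <= \prod_(j < k) \sum_(l < N) kern H B tau N j l x w.
  apply/not_existsP => no; move: Zw; rewrite leNgt => /negP; apply.
  apply: (@le_lt_trans _ _ (v / 4)); last lra.
  rewrite -[leRHS](Ex_cst mu); apply: le_Ex; first exact: (bmfun_pair2 w bf).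
    exact: bmfun_cst.
  move=> x; have [Ex_|/massN->] := pselect (E x); last by rewrite divr_ge0// ltW.
  by rewrite massE// leNgt; apply/negP => /ltW h; apply: (no x).
exists x => //; apply: (mass_near_hit tau1 N0 _ hx); lra.
Qed.

End near_hits.
(** * Compactness: from near hits to hits *)

Section dense_sequence.
Context {R : realType} {n : nat}.

Lemma rat_row_approx (x : 'rV[R]_n) (e : R) : 0 < e ->
  exists q : 'rV[rat]_n, ball x e (map_mx ratr q : 'rV[R]_n).
Proof.
move=> e0.
have /choice[f hf] (j : 'I_n) : exists q : rat, `|x ord0 j - ratr q| < e.
  have [|q] := @rat_in_itvoo R (x ord0 j - e) (x ord0 j + e).
    by rewrite ltrBlDr -addrA ltrDl addr_gt0.
  by rewrite in_itv/= => h; exists q; rewrite ltr_distlC.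
exists (\row_j f j); split => // i j; rewrite !mxE ord1; exact: hf.
Qed.

(** Rational points are dense but need not lie in S; for each rational point
    and each scale a nearby point of S is chosen whenever there is one. *)
Lemma dense_sequence (S : set 'rV[R]_n) : S !=set0 ->
  exists u : nat -> 'rV[R]_n, (forall i, S (u i)) /\
    forall x, S x -> forall e : R, 0 < e -> exists i, ball x e (u i).
Proof.
move=> [x0 Sx0].
pose near (p : 'rV[rat]_n * nat) : set 'rV[R]_n :=
  [set y | S y /\ ball (map_mx ratr p.1 : 'rV[R]_n) p.2.+1%:R^-1 y].
pose u i := if unpickle i is Some p then
  (if pselect (exists y, near p y) is left _ then xget x0 (near p) else x0) else x0.
exists u; split=> [i|x Sx e e0].
  rewrite /u; case: unpickle => // p; case: pselect => // /(xgetPex x0) [].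
  by [].
(* half of e to reach the rational point, half to come back to S *)
have [m hm] : exists m : nat, m.+1%:R^-1 < e / 2.
  exists (Num.truncn (e / 2)^-1); rewrite invf_plt ?posrE ?divr_gt0//.
  exact: truncnS_gt.
have m0 : 0 < m.+1%:R^-1 :> R by rewrite invr_gt0.
have [q hq] := rat_row_approx x m0.
exists (pickle (q, m)); rewrite /u pickleK; case: pselect => [h|]; last first.
  by case; exists x; split => //; apply: ball_sym.
have [_ h2] := xgetPex x0 h.
apply: (@le_ball _ _ _ (m.+1%:R^-1 + m.+1%:R^-1)); first by rewrite (splitr e) lerD// ltW.
exact: ball_triangle hq h2.
Qed.

End dense_sequence.

Section paths.
Context {R : realType} (k d : nat).
Implicit Types (b : 'I_d -> R -> R) (E : set 'rV[R]_d).

(** Absolute values of the times make this function continuous on the whole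
    space, although the path is only controlled at nonnegative times. *)
Definition gap b (p : 'rV[R]_k * 'rV[R]_d) : R :=
  \sum_(j < k) \sum_(c < d) (b c `|p.1 ord0 j| - p.2 ord0 c) ^+ 2.

(** Compact sets of times that exhaust the increasing families of nonnegative
    times. *)
Definition spaced (n : nat) : set 'rV[R]_k :=
  [set t | (forall i, 0 <= t ord0 i <= n%:R) /\
           forall i j : 'I_k, (i < j)%N -> t ord0 i + n.+1%:R^-1 <= t ord0 j].

Lemma continuous_norm_comp (f : R -> R) : {within `[0, +oo[, continuous f} ->
  continuous (fun s : R => f `|s|).
Proof.
move=> /subspace_continuousP cf x.
have cfx : f y @[y --> within `[0, +oo[ (nbhs `|x|)] --> f `|x|.
  by apply: cf; rewrite /= in_itv/= normr_ge0.
move=> P /cfx PP; have h := @norm_continuous R R x _ PP.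
have : nbhs x [set y : R | `[0, +oo[%classic `|y| -> P (f `|y|)] by exact: h.
by apply: filterS => y /=; apply; rewrite in_itv/= normr_ge0.
Qed.

Lemma continuous_sum_fun (T : topologicalType) (I : Type) (s : seq I) (F : I -> T -> R) :
  (forall i, continuous (F i)) -> continuous (fun x => \sum_(i <- s) F i x).
Proof.
move=> cF; elim: s => [|i s IH] x.
  by under eq_fun do rewrite big_nil; exact: cvg_cst.
by under eq_fun do rewrite big_cons; apply: continuousD; [exact: cF|exact: IH].
Qed.

Lemma gap_continuous b : (forall c, {within `[0, +oo[, continuous (b c)}) ->
  continuous (gap b).
Proof.
move=> cb; apply: continuous_sum_fun => j; apply: continuous_sum_fun => c p.
have h1 : {for p, continuous (fun p : 'rV[R]_k * 'rV[R]_d => b c `|p.1 ord0 j|)}.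
  apply: (@continuous_comp _ _ _ (fun p : 'rV[R]_k * 'rV[R]_d => p.1 ord0 j) (fun s : R => b c `|s|)).
    apply: (@continuous_comp _ _ _ fst (fun t : 'rV[R]_k => t ord0 j)); first exact: cvg_fst.
    exact: coord_continuous.
  exact: continuous_norm_comp.
have h2 : {for p, continuous (fun p : 'rV[R]_k * 'rV[R]_d => p.2 ord0 c)}.
  apply: (@continuous_comp _ _ _ snd (fun t : 'rV[R]_d => t ord0 c)); first exact: cvg_snd.
  exact: coord_continuous.
by under eq_fun do rewrite expr2; apply: cvgM; apply: cvgB; [exact: h1|exact: h2|exact: h1|exact: h2].
Qed.

Lemma gap_ge0 b p : 0 <= gap b p.
Proof. by apply: sumr_ge0 => j _; apply: sumr_ge0 => c _; exact: sqr_ge0. Qed.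

Lemma spaced_compact n : compact (spaced n).
Proof.
apply: bounded_closed_compact.
  exists n%:R; split; first exact: num_real.
  move=> y ny t [ht _] /=; apply: le_trans (ltW ny).
  rewrite [X in X <= _]/Num.norm/= mx_normrE; apply: bigmax_le => //.
  by move=> [i j] _ /=; rewrite ord1; have /andP[h0 h1] := ht j; rewrite ger0_norm.
have -> : spaced n =
   (\bigcap_(i in [set: 'I_k]) ((fun t : 'rV[R]_k => t ord0 i) @^-1` [set s | 0 <= s])) `&`
   (\bigcap_(i in [set: 'I_k]) ((fun t : 'rV[R]_k => t ord0 i) @^-1` [set s | s <= n%:R])) `&`
   (\bigcap_(p in [set p : 'I_k * 'I_k | (p.1 < p.2)%N])
      ((fun t : 'rV[R]_k => t ord0 p.2 - t ord0 p.1) @^-1` [set s | n.+1%:R^-1 <= s])).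
  apply/seteqP; split => t.
    move=> [h1 h2]; split; [split|] => /= [i _|i _|p hp] /=.
    - by have /andP[] := h1 i.
    - by have /andP[] := h1 i.
    - by rewrite lerBrDl; exact: h2.
  move=> [[h1 h2] h3]; split=> [i|i j ij].
    by rewrite (h1 i)//= (h2 i).
  by have := h3 (i, j) ij; rewrite /= lerBrDl.
apply: closedI; first apply: closedI.
- apply: closed_bigI => i _; apply: preimage_closed; last exact: closed_ge.
  by move=> t _; exact: coord_continuous.
- apply: closed_bigI => i _; apply: preimage_closed; last exact: closed_le.
  by move=> t _; exact: coord_continuous.
apply: closed_bigI => i _; apply: preimage_closed; last exact: closed_ge.
by move=> t _; apply: continuousB; exact: coord_continuous.
Qed.

(** The image of a compact set under a continuous function is closed, so a gap
    that is arbitrarily small vanishes somewhere. *)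
Lemma gap_attained b E n : (forall c, {within `[0, +oo[, continuous (b c)}) -> compact E ->
  (forall e : R, 0 < e -> exists2 p, (spaced n `*` E) p & gap b p < e) ->
  exists2 p, (spaced n `*` E) p & gap b p = 0.
Proof.
move=> cb cE small.
have cK : compact (gap b @` (spaced n `*` E)).
  apply: continuous_compact; last by apply: compact_setX => //; exact: spaced_compact.
  by apply: continuous_subspaceT; exact: gap_continuous.
have clK := compact_closed (@norm_hausdorff _ R) cK.
suff : (gap b @` (spaced n `*` E)) 0 by move=> [p hp e]; exists p.
apply: clK => U /nbhs_ballP[e /= e0 he].
have [p hp pe] := small e e0.
exists (gap b p); split; first by exists p.
by apply: he; rewrite /ball/= sub0r normrN ger0_norm// gap_ge0.
Qed.

Lemma gap0P b p : gap b p = 0 <-> forall j c, b c `|p.1 ord0 j| = p.2 ord0 c.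
Proof.
split=> [/eqP|h]; last first.
  by rewrite /gap big1// => j _; rewrite big1// => c _; rewrite h subrr expr0n.
rewrite psumr_eq0; last by move=> j _; apply: sumr_ge0 => c _; exact: sqr_ge0.
move=> /allP h j c; have := h j (mem_index_enum _).
rewrite /= psumr_eq0; last by move=> i _; exact: sqr_ge0.
by move=> /allP/(_ c (mem_index_enum _))/=; rewrite sqrf_eq0 subr_eq0 => /eqP.
Qed.

(** One integer dominates all the times and all the inverses of their
    differences. *)
Lemma increasing_spaced (t : 'I_k -> R) : (forall i, 0 <= t i) ->
  (forall i j : 'I_k, (i < j)%N -> t i < t j) -> exists n, spaced n (\row_i t i).
Proof.
move=> t0 inc.
pose S := \sum_(i < k) t i + \sum_(i < k) \sum_(j < k | (i < j)%N) (t j - t i)^-1.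
have S1 : 0 <= \sum_(i < k) \sum_(j < k | (i < j)%N) (t j - t i)^-1.
  by apply: sumr_ge0 => i _; apply: sumr_ge0 => j ij; rewrite invr_ge0 subr_ge0 ltW// inc.
have S0 : 0 <= \sum_(i < k) t i by exact: sumr_ge0.
have hS : S < (Num.truncn S).+1%:R by exact: truncnS_gt.
exists (Num.truncn S).+1; split=> [i|i j ij]; rewrite !mxE.
  rewrite t0/=; apply: le_trans (ltW hS).
  rewrite /S (bigD1 i)//= -addrA lerDl addr_ge0//.
  exact: sumr_ge0.
rewrite -lerBrDl invf_ple ?posrE ?subr_gt0 ?inc//.
have pos (i' j' : 'I_k) : (i' < j')%N -> 0 <= (t j' - t i')^-1.
  by move=> h; rewrite invr_ge0 subr_ge0 ltW// inc.
have h1 : (t j - t i)^-1 <= \sum_(j' < k | (i < j')%N) (t j' - t i)^-1.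
  rewrite (bigD1 j)//= lerDl; apply: sumr_ge0 => j' /andP[h _]; exact: pos.
have h2 : \sum_(j' < k | (i < j')%N) (t j' - t i)^-1 <=
    \sum_(i' < k) \sum_(j' < k | (i' < j')%N) (t j' - t i')^-1.
  rewrite [leRHS](bigD1 i)//= lerDl; apply: sumr_ge0 => i' _; apply: sumr_ge0 => j' h; exact: pos.
have h3 : \sum_(i' < k) \sum_(j' < k | (i' < j')%N) (t j' - t i')^-1 <= S.
  by rewrite /S lerDr sumr_ge0.
apply: le_trans h1 (le_trans h2 (le_trans h3 (le_trans (ltW hS) _))).
by rewrite ler_nat.
Qed.

End paths.
(** * The event of hitting the set *)

Section hitting.
Context {disp : measure_display} {T : measurableType disp} {R : realType}.
Variables (P : probability T R) (d k : nat) (H : R) (B : R -> T -> 'rV[R]_d).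
Hypothesis fB : fbm P H B.
Variable E : set 'rV[R]_d.
Hypothesis cE : compact E.

Definition trajectory (w : T) (c : 'I_d) (s : R) : R := Defs.coord B c s w.

Lemma trajectory_continuous w c : {within `[0, +oo[, continuous (trajectory w c)}.
Proof. by have := fbm_coord fB c; case=> _ _ _ h; exact: (h w). Qed.

Definition hits (n : nat) : set T :=
  [set w | exists2 p : 'rV[R]_k * 'rV[R]_d, (spaced n `*` E) p & gap (trajectory w) p = 0].

Lemma tuple_point_hits : [set w | exists2 x, E x & tuple_point k (fun t => B t w) x] =
  \bigcup_n hits n.
Proof.
apply/seteqP; split => [w [x Ex_ [t [t0 inc Bt]]]|w [n _ [[t x] [[t0 inc] Ex_] /gap0P hp]]].
  have [n hn] := increasing_spaced t0 inc.
  exists n => //; exists (\row_i t i, x) => //; apply/gap0P => j c /=.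
  by rewrite mxE ger0_norm// /trajectory /Defs.coord Bt.
exists x => //; exists (fun i => t ord0 i); split => [i|i j ij|i].
- by have /andP[] := t0 i.
- by apply: lt_le_trans (inc i j ij); rewrite ltrDl invr_gt0.
- apply/rowP => c; have := hp i c; rewrite /= ger0_norm//.
  by have /andP[] := t0 i.
Qed.

Lemma gap_measurable (p : 'rV[R]_k * 'rV[R]_d) : measurable_fun setT (fun w => gap (trajectory w) p).
Proof.
apply: measurable_sum => j; apply: measurable_sum => c; apply: measurable_funX.
apply: measurable_funB => //; exact: (coord_measurable fB c (normr_ge0 _)).
Qed.

(** By gap_attained the path hits if and only if the gap takes arbitrarily
    small values, and by continuity these are also taken on a countable dense
    set of times and points, which does not depend on the outcome. *)
Lemma hits_measurable n : measurable (hits n).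
Proof.
have [K0|/set0P Kn] := eqVneq (spaced n : set 'rV[R]_k) set0.
  rewrite (_ : hits n = set0) ?measurable0//.
  by apply/seteqP; split => // w [p []]; rewrite K0.
have [E0|/set0P En] := eqVneq E set0.
  rewrite (_ : hits n = set0) ?measurable0//.
  by apply/seteqP; split => // w [p []]; rewrite E0.
have [u [uK du]] := dense_sequence Kn; have [v [vE dv]] := dense_sequence En.
have -> : hits n = \bigcap_m \bigcup_i \bigcup_j [set w | gap (trajectory w) (u i, v j) < m.+1%:R^-1].
  apply/seteqP; split => w.
    move=> [[t x] [Kt Ex_] hp] m _.
    have ct c : {within `[0, +oo[, continuous (trajectory w c)} by exact: trajectory_continuous.
    have := @gap_continuous _ _ _ (trajectory w) ct (t, x).
    have m0 : 0 < m.+1%:R^-1 :> R by rewrite invr_gt0.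
    rewrite /continuous_at hp => /(_ _ (nbhsx_ballx 0 _ m0)) /nbhs_ballP[e /= e0 he].
    have [i hi] := du t Kt e e0; have [j hj] := dv x Ex_ e e0.
    exists i => //; exists j => //=.
    have := he (u i, v j) (conj hi hj).
    by rewrite /ball/= sub0r normrN ger0_norm// gap_ge0.
  move=> hw; apply: gap_attained => //; first by move=> c; exact: trajectory_continuous.
  move=> e e0; have [i _ [j _ /= hij]] := hw (Num.truncn e^-1) I.
  exists (u i, v j); first by split; [exact: uK|exact: vE].
  apply: lt_trans hij _; rewrite invf_plt ?posrE//; exact: truncnS_gt.
apply: bigcapT_measurable => m; apply: bigcupT_measurable => i; apply: bigcupT_measurable => j.
have := gap_measurable (u i, v j) measurableT (measurable_itv `]-oo, m.+1%:R^-1[).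
by rewrite setTI; congr measurable; apply/seteqP; split => w /=; rewrite in_itv.
Qed.

Lemma block_spaced (tau : R) : 1 <= tau ->
  exists n, forall t, block_times tau t -> spaced n (\row_(j < k) t j).
Proof.
move=> tau1; have tau0 : 0 < tau := lt_le_trans ltr01 tau1.
exists (Num.truncn (tau * (2 * k%:R))).+1 => t bt; split => [i|i j ij]; rewrite !mxE.
  rewrite (block_times_ge0 tau0 i bt)/=; have /andP[_ h] := bt i.
  apply: le_trans h _; apply: le_trans (ltW (truncnS_gt _)); rewrite ler_wpM2l ?(ltW tau0)//.
  have : (i.+1%:R : R) <= k%:R by rewrite ler_nat.
  by rewrite -natr1; lra.
have /andP[_ h1] := bt i; have /andP[h2 _] := bt j.
apply: le_trans h2; apply: (@le_trans _ _ (tau * (2 * i%:R + 2) + 1)).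
  by rewrite lerD// invf_le1// ler1n.
have : (i.+1%:R : R) <= j%:R by rewrite ler_nat.
rewrite -natr1 => h3.
apply: (@le_trans _ _ (tau * (2 * i%:R + 2) + tau)); first by rewrite lerD2l.
rewrite -[X in _ + X]mulr1 -mulrDr ler_wpM2l ?(ltW tau0)//; lra.
Qed.

Lemma mesh_small (C e : R) : 0 < H -> 0 < e -> exists m, forall N, (m <= N)%N -> C * mesh H N.+1 < e.
Proof.
move=> H0 e0; pose C' := `|C| + 1.
have C0 : 0 < C' by rewrite ltr_wpDl.
exists (Num.truncn ((C' / e) `^ H^-1)) => N hN.
have hm : (C' / e) `^ H^-1 < N.+1%:R.
  by apply: lt_le_trans (truncnS_gt _) _; rewrite ler_nat.
have h : C' / e < N.+1%:R `^ H.
  have := gt0_ltr_powR H0 (_ : _ \in Num.nneg) (_ : _ \in Num.nneg) hm.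
  rewrite -powRrM mulVf ?gt_eqF// powRr1 ?divr_ge0 ?(ltW C0) ?(ltW e0)//.
  by apply; rewrite nnegrE ?powR_ge0.
rewrite /mesh ltr_pdivrMr ?powR_gt0//.
apply: (@lt_trans _ _ C'); first by apply: le_lt_trans (ler_norm C) _; rewrite ltrDl.
by rewrite mulrC -ltr_pdivrMr.
Qed.

End hitting.

Theorem theorem2p2 (R : realType) (disp : measure_display)
    (T : measurableType disp) (P : probability T R)
    (k d : nat) (H : R) (B : R -> T -> 'rV[R]_d) (E : set 'rV[R]_d)
    (k_gt0 : (0 < k)%N) (H_gt0 : 0 < H) (H_lt1 : H < 1)
    (Hd : H * d%:R = 1) (B_fbm : fbm P H B)
    (E_neq0 : E !=set0) (E_compact : compact E)
    (E_capacity :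
       (0 < capacity (fun s : R => log_plus_inv s ^+ k) E)%E) :
  let A := [set w | exists2 x, E x & tuple_point k (fun t => B t w) x] in
  measurable A /\ (0 < P A)%E.
Proof.
have a0 : 0 < 2 * H by rewrite mulr_gt0.
have a1 : 2 * H <= 1.
  have d2 : (2 <= d)%N.
    case: d Hd {B B_fbm E E_neq0 E_compact E_capacity} => [|[|//]].
      by move=> /eqP; rewrite mulr0 eq_sym oner_eq0.
    by rewrite mulr1 => HE; move: H_lt1; rewrite HE ltxx.
  by rewrite -[leRHS]Hd mulrC ler_pM2l// ler_nat.
have mA : measurable (\bigcup_n hits k B E n).
  by apply: bigcupT_measurable => n; exact: (@hits_measurable _ _ _ _ _ _ _ _ B_fbm _ E_compact n).
move=> A; have -> : A = \bigcup_n hits k B E n by exact: tuple_point_hits.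
split => //.
have [tau [C [c [tau1 c0 near]]]] := near_hits B_fbm a0 a1 Hd k_gt0 E_compact E_capacity.
have [n sep] := block_spaced k tau1.
have /choice[F hF] (N : nat) := near N.+1 isT.
have mF N : measurable (F N) by have [] := hF N.
have sub : lim_sup_set F `<=` \bigcup_n hits k B E n.
  move=> w limw; exists n => //; apply: gap_attained => //.
    by move=> i; exact: (trajectory_continuous B_fbm).
  move=> e e0; have [m hm] := mesh_small C H_gt0 e0.
  have [N /= mN FN] := limw m I.
  have [_ _ /(_ w FN)[x Ex_ [t bt ht]]] := hF N.
  exists (\row_(j < k) t j, x); first by split => //; exact: sep.
  apply: le_lt_trans (hm N mN); apply: le_trans ht; rewrite le_eqVlt; apply/orP; left; apply/eqP.
  apply: eq_bigr => j _; apply: eq_bigr => i _; rewrite /= mxE ger0_norm//.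
  exact: (block_times_ge0 (lt_le_trans ltr01 tau1) j bt).
have mU m : measurable (\bigcup_(N in [set N | (m <= N)%N]) F N) by apply: bigcup_measurable.
(* continuity from above gives P (limsup F) >= c *)
have mL : measurable (lim_sup_set F) by apply: bigcapT_measurable.
apply: (@lt_le_trans _ _ c%:E); first by rewrite lte_fin.
apply: (@le_trans _ _ (P (lim_sup_set F))); last by apply: le_measure; rewrite ?inE.
have cvgP := lim_sup_set_cvg P F mF (le_lt_trans (probability_le1 P (mU 0%N)) (ltry 1)).
rewrite -(cvg_lim _ cvgP)//; apply: lime_ge; first by apply/cvg_ex; exists (P (lim_sup_set F)).
apply: nearW => m.
have [_ cP _] := hF m.
apply: (@le_trans _ _ (P (F m))).
  by rewrite -[leRHS]fineK ?lee_fin// fin_num_measure.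
apply: le_measure; rewrite ?inE// => w Fw; exists m => //=.
Qed.
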